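(* Let $F$, the partitions $\{A_j^m\}_{j=0}^m$ of $Y=\mathbb{R}^d$ and $\{B_i^m\}_{i=1}^{N(m)}$ of $X=[0,1]^{d_x}$, the sequences $h_m,\delta_m,\sigma_m,R_m>0$, the constant $\sigma_0>0$ and the model $p(y|x,\mathcal{M}_3)$ be as described in the context. Part (i). Suppose: (a) $h_m\to0$, and for every $y\in Y$ there exists $M_0$ such that $C_{\delta_m}(y)\cap A_0^m=\varnothing$ for all $m\ge M_0$; (b) $\delta_m\to 0$, $\sigma_m/\delta_m\to 0$, $\delta_m^{d-1}h_m/\sigma_m^d\to 0$; (c) $R_m\to\infty$ and $\exp\{-R_ms_m\}/s_m^{d_x/2}\to0$, where $s_m=d_x\lambda(B_i^m)^{2/d_x}\to0$; (d) $f(y|x)$ is positive for any $y\in Y=\mathbb{R}^d$ and any $x\in X$, and $f(y|x)$ is continuously differentiable in $(y,x)$; (e) the second moments of $y$ under $F$ are finite; (f) for some $r>0$, $$\int\sup_{z\in C_r(y),\,\|x-t\|\le r}\Big\|\frac{d\log f(z|t)}{d(z,t)}\Big\|F(dy,dx)<\infty,$$ and $1>2^{-(d+1)}>\phi(y,0,\sigma_0)(r/2)^d$ for all $y$. Then, for all sufficiently large $m$, $$\begin{aligned}d_{\mathrm{KL}}(F,\mathcal{M}_3)\le{}&\Big(\delta_m\frac{d^{1/2}}{2}+s_m^{1/2}\Big)\int\sup_{z\in C_{\delta_m}(y),\,\|x-t\|\le s_m^{1/2}}\Big\|\frac{d\log f(z|t)}{d(z,t)}\Big\|F(dy,dx)\\&+2\,\frac{3d^{3/2}\delta_m^{d-1}h_m}{(2\pi)^{d/2}\sigma_m^d}+2\exp\Big\{-\frac{(\delta_m/\sigma_m)^2}{8}\Big\}\\&+\frac{rd^{1/2}}{2}\int_{B_{\delta_m}(A_0^m)}\sup_{z\in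 C_r(y),\,\|x-t\|\le r}\Big\|\frac{d\log f(z|t)}{d(z,t)}\Big\|F(dy,dx)\\&+\int_{B_{\delta_m}(A_0^m)}\Big[\frac{y'y}{2\sigma_0^2}-\log\frac{(r/2)^d}{(2\pi\sigma_0^2)^{d/2}}\Big]F(dy,dx)\\&-\log\Big[1-d_x^{d_x/2}\exp\{-R_ms_m\}/s_m^{d_x/2}\Big],\end{aligned}$$ and the terms of this bound converge to zero as $m\to\infty$. Part (ii). If, in addition to the assumptions on $F$, $r$ and $\sigma_0$ of part (i), for some $q>2$ and some $i_1\in\{1,\dots,d\}$, $$\int|y_i|^qF(dy)<\infty,\quad i\in\{1,\dots,d\},$$ and $$\int|y_{i_1}|^{q-2}\sup_{z\in C_r(y),\,\|x-t\|\le r}\Big\|\frac{d\log f(z|t)}{d(z,t)}\Big\|F(dy,dx)<\infty,$$ then for every $\varepsilon>0$ (arbitrarily close to zero) the partitions and the sequences $\delta_m,\sigma_m,h_m,R_m$ can be chosen, satisfying the requirements in part (i), so that for all sufficiently large $m$ $$d_{\mathrm{KL}}(F,\mathcal{M}_3)\le\text{constant}\cdot[mN(m)]^{-1/(d_x+d\cdot[2+1/(q-2)+\varepsilon])},$$ where the constant does not depend on $m$ and $mN(m)$ is, up to its lower-order part, the number of mixture components in $\mathcal{M}_3$.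
   Context: $F$ is a probability distribution on $Y\times X$, $Y=\mathbb{R}^d$, $X=[0,1]^{d_x}$. The conditional distribution of $y$ given $x$ has a density $f(y|x)$ with respect to Lebesgue measure $\lambda$; the marginal of $x$ has a density $f(x)$ with respect to some generic measure. $F(A|x)=\int_A f(y|x)\,dy$. $\phi(y,\mu,\sigma)$ is the density at $y\in\mathbb{R}^d$ of the normal distribution with mean $\mu$ and covariance matrix $\sigma^2 I$. For a model $\mathcal{M}$ with conditional density $p(y|x,\mathcal{M})$, $$d_{\mathrm{KL}}(F,\mathcal{M})=\int\log\frac{f(y|x)}{p(y|x,\mathcal{M})}\,F(dy,dx).$$ Hypercubes have edges parallel to the coordinate axes. $C_\delta(y)$ is the hypercube with center $y$ and side length $\delta$. For each $m$, $A_0^m,A_1^m,\dots,A_m^m$ is a partition of $Y$, where $A_1^m,\dots,A_m^m$ are adjacent half-open half-closed hypercubes with side length $h_m$ (cells of a regular cubic grid) and $A_0^m$ is the rest of $Y$. $\mu_j^m$ is the center of $A_j^m$, $j\ge1$; $\sigma_0$ is fixed (independent of $m$). $B_{\delta_m}(A_0^m)=\{(y,x):C_{\delta_m}(y)\cap A_0^m\neq\varnothing\}$. $B_i^m$, $i=1,\dots,N(m)$, are equal size half-open half-closed hypercubes forming a partition of $X=[0,1]^{d_x}$, with $\lambda(B_i^m)=N(m)^{-1}\to0$ as $m\to\infty$ ($\lambda$ here is Lebesgue measure on $\mathbb{R}^{d_x}$); $x_i^m$ is the center of $B_i^m$; $s_m$ is the squared diagonal of $B_i^m$. In suprema over $\|x-t\|\le\cdot$,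 $t$ ranges over $X$. $d\log f(z|t)/d(z,t)$ is the gradient with respect to $(z,t)$. The model is $$p(y|x,\mathcal{M}_3)=\sum_{i=1}^{N(m)}\Big[\sum_{j=1}^m\alpha_{ij}^m(x)\phi(y,\mu_j^m,\sigma_m)+\alpha_{i0}^m(x)\phi(y,0,\sigma_0)\Big],$$ $$\alpha_{ij}^m(x)=F(A_j^m|x_i^m)\,\frac{\exp\{-R_m(x_i^{m\prime}x_i^m-2x_i^{m\prime}x)\}}{\sum_{l=1}^{N(m)}\exp\{-R_m(x_l^{m\prime}x_l^m-2x_l^{m\prime}x)\}},\quad j=0,1,\dots,m.$$
   Formalization: ''Adjacent'' hypercubes A_1,…,A_m is made precise: they fill a rectangular block of the cubic grid, up to an incomplete outermost layer; for arbitrary connected sets of grid cells (for example with a thin slit moving off to infinity) the bound of part (i) can fail. *)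

(* Defs.v *)
From HB Require Import structures.
From mathcomp Require Import all_boot all_order all_algebra.
From mathcomp Require Import all_classical all_reals all_analysis.

Set Implicit Arguments.
Unset Strict Implicit.
Unset Printing Implicit Defensive.

Import Order.TTheory GRing.Theory Num.Theory.
Import numFieldNormedType.Exports.

Local Open Scope classical_set_scope.
Local Open Scope ring_scope.

Definition measure_rV_display : measure_display. Proof. exact. Qed.

(* The product sigma-algebra, generated by the coordinates; it is the Borel one. *)
Section measurable_rV.
Context (R : realType) (n : nat).

Let coord : 'I_n -> 'rV[R]_n -> measurableTypeR R := fun i v => v ord0 i.

Let rV_set0 : g_sigma_preimage coord set0.
Proof. exact: sigma_algebra0. Qed.

Let rV_setC A : g_sigma_preimage coord A -> g_sigma_preimage coord (~` A).
Proof. exact: sigma_algebraC. Qed.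

Let rV_bigcup (F : (set 'rV[R]_n)^nat) :
  (forall i, g_sigma_preimage coord (F i)) ->
  g_sigma_preimage coord (\bigcup_i (F i)).
Proof. exact: sigma_algebra_bigcup. Qed.

HB.instance Definition _ := @isMeasurable.Build measure_rV_display
  'rV[R]_n (g_sigma_preimage coord) rV_set0 rV_setC rV_bigcup.

End measurable_rV.

Section rV_measurability.
Context (R : realType).

Lemma measurable_coord n (i : 'I_n) :
  measurable_fun [set: 'rV[R]_n] (fun v => v ord0 i : measurableTypeR R).
Proof.
move=> _ Y mY; rewrite setTI; apply: sub_sigma_algebra => /=.
rewrite -bigcup_seq/=; exists i => /=; first by rewrite mem_index_enum.
by exists Y => //; rewrite setTI.
Qed.

Lemma measurable_fun_coordP d (T : measurableType d) n (f : T -> 'rV[R]_n) :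
  (forall i, measurable_fun [set: T] (fun x => f x ord0 i : measurableTypeR R)) ->
  measurable_fun [set: T] f.
Proof.
move=> mf _ A mA; rewrite setTI.
have : preimage_set_system [set: T] f
    (g_sigma_preimage (fun i (v : 'rV[R]_n) => v ord0 i : measurableTypeR R))
    (f @^-1` A) by exists A => //; rewrite setTI.
rewrite -g_sigma_preimage_comp; move: (f @^-1` A).
apply: smallest_sub; first exact: sigma_algebra_measurable.
case: n => [|n] in f mf A mA *; first by rewrite big_ord0.
rewrite -bigcup_mkord_ord; apply: bigcup_sub => i Ii.
by move=> B [C mC <-]; exact: mf.
Qed.

Lemma measurable_box n (a b : 'rV[R]_n) : measurable
  [set v : 'rV[R]_n | forall i, v ord0 i \in `[a ord0 i, b ord0 i[].
Proof.
rewrite (_ : [set _ | _] = \bigcap_(i in [set: 'I_n])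
    ((fun v : 'rV[R]_n => v ord0 i) @^-1` [set` `[a ord0 i, b ord0 i[])).
  apply: fin_bigcap_measurable => // i _.
  by rewrite -[X in measurable X]setTI; exact: measurable_coord.
by apply/seteqP; split=> [v vab i _|v vab i]; exact: vab.
Qed.

Definition consrV n (p : measurableTypeR R * 'rV[R]_n) : 'rV[R]_n.+1 :=
  row_mx (const_mx p.1 : 'rV_1) p.2.

Lemma consrV0 n (p : measurableTypeR R * 'rV[R]_n) : consrV p ord0 ord0 = p.1.
Proof. by rewrite mxE; case: splitP => // j _; rewrite mxE. Qed.

Lemma consrVS n (p : measurableTypeR R * 'rV[R]_n) i :
  consrV p ord0 (lift ord0 i) = p.2 ord0 i.
Proof.
rewrite mxE; case: splitP => [j|j /= ji]; first by rewrite (ord1 j).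
by congr (p.2 _ _); apply/val_inj; case: ji.
Qed.

Lemma measurable_consrV n : measurable_fun setT (@consrV n).
Proof.
apply: measurable_fun_coordP => i; case: (unliftP ord0 i) => [j|] ->.
  under eq_fun do rewrite consrVS.
  exact: (measurableT_comp (measurable_coord j) measurable_snd).
under eq_fun do rewrite consrV0.
exact: measurable_fst.
Qed.

Definition unconsrV n (v : 'rV[R]_n.+1) : measurableTypeR R * 'rV[R]_n :=
  (v ord0 ord0, \row_i v ord0 (lift ord0 i)).

Lemma consrVK n : cancel (@consrV n) (@unconsrV n).
Proof.
move=> [a v]; rewrite /unconsrV consrV0; congr pair.
by apply/rowP => i; rewrite mxE consrVS.
Qed.

Lemma measurable_unconsrV n : measurable_fun setT (@unconsrV n).
Proof.
apply: measurable_fun_pair; first exact: measurable_coord.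
apply: measurable_fun_coordP => i; under eq_fun do rewrite mxE.
exact: measurable_coord.
Qed.

End rV_measurability.

Section lebesgue_step.
Context (R : realType) (n : nat).
Variable mu : {sigma_finite_measure set 'rV[R]_n -> \bar R}.

Definition leb_step : set 'rV[R]_n.+1 -> \bar R :=
  pushforward (@lebesgue_measure R \x mu)%E (@consrV R n).

HB.instance Definition _ := Measure.copy leb_step
  (measure_function_pushforward__canonical__measure_function_Measure
     (@lebesgue_measure R \x mu)%E (@measurable_consrV R n)).

Let leb_step_sigma_finite : sigma_finite setT leb_step.
Proof.
have /sigma_finiteP[A [TA ndA Aoo]] := sigma_finiteT (@lebesgue_measure R).
have /sigma_finiteP[B [TB ndB Boo]] := sigma_finiteT mu.
exists (fun k => @unconsrV R n @^-1` (A k `*` B k)).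
  rewrite -preimage_bigcup (_ : \bigcup_k _ = setT) ?preimage_setT//.
  apply/seteqP; split=> // -[x v] _.
  have [i _ Ax] : (\bigcup_i A i) x by rewrite -TA.
  have [j _ Bv] : (\bigcup_i B i) v by rewrite -TB.
  exists (maxn i j) => //; split => /=.
  - by move: x Ax; exact/subsetPset/ndA/leq_maxl.
  - by move: v Bv; exact/subsetPset/ndB/leq_maxr.
move=> k; have [mA Afin] := Aoo k; have [mB Bfin] := Boo k; split.
  by rewrite -[X in measurable X]setTI; apply: measurable_unconsrV => //;
    exact: measurableX.
rewrite /leb_step /pushforward -comp_preimage (_ : _ \o _ = id); last first.
  by apply/funext => p /=; rewrite consrVK.
by rewrite preimage_id product_measure1E// lte_mul_pinfty// ge0_fin_numE.
Qed.

HB.instance Definition _ := @Measure_isSigmaFinite.Build _ _ _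
  leb_step leb_step_sigma_finite.

End lebesgue_step.

(* Lebesgue measure on R^n: the unit mass on R^0 and, recursively, the image of
   the product measure under R * R^n ~ R^n.+1. *)
Fixpoint leb (R : realType) n : {sigma_finite_measure set 'rV[R]_n -> \bar R} :=
  if n is n'.+1 then leb_step (@leb R n') else \d_(0 : 'rV[R]_0).
Arguments leb R n : clear implicits.

Lemma leb_box (R : realType) n (a b : 'rV[R]_n) :
  (forall i, a ord0 i <= b ord0 i) ->
  leb R n [set v | forall i, v ord0 i \in `[a ord0 i, b ord0 i[] =
  (\prod_(i < n) (b ord0 i - a ord0 i))%:E.
Proof.
elim: n a b => [|n IHn] a b ab.
  by rewrite big_ord0 /= diracE mem_set //= => -[].
rewrite big_ord_recl /= /leb_step /pushforward.
have -> : @consrV R n @^-1`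
    [set v | forall i, v ord0 i \in `[a ord0 i, b ord0 i[] =
    [set` `[a ord0 ord0, b ord0 ord0[] `*`
    [set v : 'rV[R]_n | forall i, v ord0 i \in
      `[(unconsrV a).2 ord0 i, (unconsrV b).2 ord0 i[].
  apply/seteqP; split=> [[x v] /= xv|[x v] /= [xab vab] i].
    split; first by have := xv ord0; rewrite consrV0.
    by move=> i; have := xv (lift ord0 i); rewrite consrVS !mxE.
  case: (unliftP ord0 i) => [j|] ->; last by rewrite consrV0.
  by rewrite consrVS; have := vab j; rewrite !mxE.
rewrite product_measure1E//; last first.
  exact: measurable_box.
rewrite IHn; last by move=> i; rewrite !mxE.
rewrite EFinM; congr (_ * _)%E; last first.
  by congr EFin; apply: eq_bigr => i _; rewrite !mxE.
transitivity (lebesgue_measure [set` `[a ord0 ord0, b ord0 ord0[]) => //.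
rewrite lebesgue_measure_itv /= lte_fin; case: ltP => // ba.
by rewrite (@le_anti _ _ (a ord0 ord0) (b ord0 ord0)) ?subrr// ab.
Qed.

Section conditional_density_model.
Context (R : realType) (d dx : nat).

Definition dotrV n (u v : 'rV[R]_n) : R := \sum_(k < n) u ord0 k * v ord0 k.
Definition enorm n (u : 'rV[R]_n) : R := Num.sqrt (dotrV u u).

Definition ucube : set 'rV[R]_dx :=
  [set x | forall k, x ord0 k \in `[0, 1]].

Local Notation YX := ([set: 'rV[R]_d] `*` ucube).

Definition hypercube (delta : R) (y : 'rV[R]_d) : set 'rV[R]_d :=
  [set z | forall k, `|z ord0 k - y ord0 k| <= delta / 2].

(* A pair [(y, x)] is an observation, so [f (y, x)] stands for f(y|x); [g] is
   the density of the marginal of x with respect to [nu]. *)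
Definition has_densities (F : probability ('rV[R]_d * 'rV[R]_dx)%type R)
    (nu : {measure set 'rV[R]_dx -> \bar R})
    (f : 'rV[R]_d * 'rV[R]_dx -> R) (g : 'rV[R]_dx -> R) : Prop :=
  [/\ measurable_fun YX (f : _ -> measurableTypeR R) /\
        (forall p, YX p -> 0 <= f p),
      forall x, ucube x -> (\int[leb R d]_y (f (y, x))%:E = 1)%E,
      measurable_fun ucube (g : _ -> measurableTypeR R) /\
        (forall x, ucube x -> 0 <= g x) &
      forall A, measurable A ->
        (F A = \int[nu]_(x in ucube)
          ((g x)%:E * \int[leb R d]_(y in ysection A x) (f (y, x))%:E))%E].

Definition cprob (f : 'rV[R]_d * 'rV[R]_dx -> R) (A : set 'rV[R]_d)
    (x : 'rV[R]_dx) : R :=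
  fine (\int[leb R d]_(y in A) (f (y, x))%:E)%E.

(* Density of the normal distribution with mean [mu], covariance sigma^2 I. *)
Definition phi (y mu : 'rV[R]_d) (sigma : R) : R :=
  expR (- (dotrV (y - mu) (y - mu) / (2 * sigma ^+ 2))) /
  (2 * pi * sigma ^+ 2) `^ (d%:R / 2).

Definition kl (F : probability ('rV[R]_d * 'rV[R]_dx)%type R)
    (f p : 'rV[R]_d * 'rV[R]_dx -> R) : \bar R :=
  (\int[F]_(q in YX) (ln (f q / p q))%:E)%E.

(* Since the unit cube is closed, differentiability on R^d * [0,1]^dx is
   relative to this set: at boundary points only increments that stay in the
   set count. The set is convex with nonempty interior, so that a gradient is
   unique when it exists. *)
Definition incr (q p : 'rV[R]_d * 'rV[R]_dx) : 'rV[R]_(d + dx) :=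
  row_mx (q.1 - p.1) (q.2 - p.2).

Definition is_grad (g : 'rV[R]_d * 'rV[R]_dx -> R) p (u : 'rV[R]_(d + dx)) :=
  forall e : R, 0 < e -> \forall q \near p, YX q ->
    `|g q - g p - dotrV u (incr q p)| <= e * enorm (incr q p).

Definition grad (g : 'rV[R]_d * 'rV[R]_dx -> R) p : 'rV[R]_(d + dx) :=
  xget 0 [set u | is_grad g p u].

Definition cont_differentiable (g : 'rV[R]_d * 'rV[R]_dx -> R) : Prop :=
  (forall p, YX p -> exists u, is_grad g p u) /\
  {within YX, continuous (grad g)}.

(* sup of || d log f(z|t) / d(z,t) || over z in C_a(y), t in X, ||x-t|| <= b *)
Definition sup_dlog (f : 'rV[R]_d * 'rV[R]_dx -> R) (a b : R)
    (p : 'rV[R]_d * 'rV[R]_dx) : \bar R :=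
  ereal_sup [set (enorm (grad (fun q => ln (f q)) q))%:E | q in
    [set q | [/\ hypercube a p.1 q.1, ucube q.2 & enorm (p.2 - q.2) <= b]]].

(* The cells A_1, ..., A_m are those with (distinct) index vectors [yindex j]
   in the cubic grid of side [yside] based at [yorigin]. They are adjacent in
   the sense that they fill a rectangular block of the grid; as m need not be
   a product of d block lengths, the outermost layer may be incomplete. *)
Record ypartition (m : nat) := YPartition {
  yside : R;
  yorigin : 'rV[R]_d;
  yindex : 'I_m -> 'rV[int]_d;
  yside_gt0 : 0 < yside;
  yindex_inj : injective yindex;
  yadjacent : exists lo hi : 'rV[int]_d,
    (forall k : 'rV[int]_d,
       (forall a, lo ord0 a <= k ord0 a < hi ord0 a) ->
       exists j, yindex j = k) /\
    (forall j a, lo ord0 a - 1 <= yindex j ord0 a < hi ord0 a + 1) }.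

Definition ycell m (P : ypartition m) (j : 'I_m) : set 'rV[R]_d :=
  [set y | forall a, y ord0 a \in
    `[yorigin P ord0 a + yside P * (yindex P j ord0 a)%:~R,
      yorigin P ord0 a + yside P * ((yindex P j ord0 a)%:~R + 1)[].

Definition ycenter m (P : ypartition m) (j : 'I_m) : 'rV[R]_d :=
  \row_a (yorigin P ord0 a + yside P * ((yindex P j ord0 a)%:~R + 2^-1)).

Definition yrest m (P : ypartition m) : set 'rV[R]_d :=
  ~` \bigcup_(j in [set: 'I_m]) ycell P j.

(* Half-open hypercube with center [c] and side [l], closed at those faces
   that lie on the upper boundary of the unit cube. *)
Definition xcell (l : R) (c : 'rV[R]_dx) : set 'rV[R]_dx :=
  [set x | forall a, c ord0 a - l / 2 <= x ord0 a /\
    (x ord0 a < c ord0 a + l / 2 \/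
     x ord0 a = c ord0 a + l / 2 /\ x ord0 a = 1)].

(* The side is not tied to [N] explicitly: N disjoint cells that cover the unit
   cube force N * xside ^+ dx = 1. *)
Record xpartition (N : nat) := XPartition {
  xside : R;
  xcenter : 'I_N -> 'rV[R]_dx;
  xside_gt0 : 0 < xside;
  xcells_disjoint : trivIset [set: 'I_N] (fun i => xcell xside (xcenter i));
  xcells_cover :
    \bigcup_(i in [set: 'I_N]) xcell xside (xcenter i) = ucube }.

Record tuning (m : nat) := Tuning {
  ncells : nat;
  ypart : ypartition m;
  xpart : xpartition ncells;
  delta : R;
  sigma : R;
  gateR : R;
  delta_gt0 : 0 < delta;
  sigma_gt0 : 0 < sigma;
  gateR_gt0 : 0 < gateR }.

(* Squared diagonal of a cell of X, dx * lambda(B_i)^(2/dx); the cells have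
   equal size, so lambda(B_i) = 1/N(m). *)
Definition xdiag2 m (T : tuning m) : R :=
  dx%:R * ((ncells T)%:R^-1 `^ (2 / dx%:R)).

Definition gate m (T : tuning m) (i : 'I_(ncells T)) (x : 'rV[R]_dx) : R :=
  let w l := expR (- (gateR T *
    (dotrV (xcenter (xpart T) l) (xcenter (xpart T) l) -
     2 * dotrV (xcenter (xpart T) l) x))) in
  w i / \sum_(l < ncells T) w l.

Definition alpha f m (T : tuning m) (i : 'I_(ncells T)) (A : set 'rV[R]_d)
    (x : 'rV[R]_dx) : R :=
  cprob f A (xcenter (xpart T) i) * gate i x.

Definition model3 f (sigma0 : R) m (T : tuning m)
    (q : 'rV[R]_d * 'rV[R]_dx) : R :=
  \sum_(i < ncells T)
    (\sum_(j < m) alpha f i (ycell (ypart T) j) q.2 *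
                    phi q.1 (ycenter (ypart T) j) (sigma T) +
     alpha f i (yrest (ypart T)) q.2 * phi q.1 0 sigma0).

Definition tuning_conditions (T : forall m, tuning m) : Prop :=
  [/\ (fun m => yside (ypart (T m))) @ \oo --> 0 /\
        (forall y, \forall m \near \oo,
           hypercube (delta (T m)) y `&` yrest (ypart (T m)) = set0),
      [/\ (fun m => delta (T m)) @ \oo --> 0,
          (fun m => sigma (T m) / delta (T m)) @ \oo --> 0 &
          (fun m => delta (T m) ^+ d.-1 * yside (ypart (T m)) /
                    sigma (T m) ^+ d) @ \oo --> 0] &
      [/\ (fun m => gateR (T m)) @ \oo --> +oo,
          (fun m => xdiag2 (T m)) @ \oo --> 0 &
          (fun m => expR (- (gateR (T m) * xdiag2 (T m))) /
                    xdiag2 (T m) `^ (dx%:R / 2)) @ \oo --> 0]].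

Definition target_conditions (F : probability ('rV[R]_d * 'rV[R]_dx)%type R)
    (f : 'rV[R]_d * 'rV[R]_dx -> R) (r sigma0 : R) : Prop :=
  [/\ (forall p, YX p -> 0 < f p) /\ cont_differentiable f,
      forall k, (\int[F]_(p in YX) (p.1 ord0 k ^+ 2)%:E < +oo)%E,
      (\int[F]_(p in YX) sup_dlog f r r p < +oo)%E &
      forall y : 'rV[R]_d,
        1 > 2^-1 ^+ d.+1 :> R /\
        2^-1 ^+ d.+1 > phi y 0 sigma0 * (r / 2) ^+ d].

(* The set B_delta(A_0) of the pairs (y, x) whose C_delta(y) meets A_0. *)
Definition near_rest m (T : tuning m) : set ('rV[R]_d * 'rV[R]_dx) :=
  YX `&` [set p | hypercube (delta T) p.1 `&` yrest (ypart T) !=set0].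

Definition kl_bound_terms (F : probability ('rV[R]_d * 'rV[R]_dx)%type R)
    (f : 'rV[R]_d * 'rV[R]_dx -> R) (r sigma0 : R) m (T : tuning m) :
    seq (\bar R) :=
  let h := yside (ypart T) in
  let s := xdiag2 T in
  [:: (delta T * (Num.sqrt d%:R / 2) + Num.sqrt s)%:E *
        \int[F]_(p in YX) sup_dlog f (delta T) (Num.sqrt s) p;
      (2 * (3 * d%:R `^ (3 / 2) * delta T ^+ d.-1 * h /
            ((2 * pi) `^ (d%:R / 2) * sigma T ^+ d)))%:E;
      (2 * expR (- ((delta T / sigma T) ^+ 2 / 8)))%:E;
      (r * Num.sqrt d%:R / 2)%:E *
        \int[F]_(p in near_rest T) sup_dlog f r r p;
      \int[F]_(p in near_rest T)
        (dotrV p.1 p.1 / (2 * sigma0 ^+ 2) -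
         ln ((r / 2) ^+ d / (2 * pi * sigma0 ^+ 2) `^ (d%:R / 2)))%:E;
      (- ln (1 - dx%:R `^ (dx%:R / 2) *
               (expR (- (gateR T * s)) / s `^ (dx%:R / 2))))%:E]%E.

Definition kl_rate (q eps : R) m (T : tuning m) : R :=
  (m * ncells T)%:R `^
    (- (dx%:R + d%:R * (2 + (q - 2)^-1 + eps))^-1).

End conditional_density_model.

(* Main.v *)
Require Import Defs.
From HB Require Import structures.
From mathcomp Require Import all_boot all_order all_algebra.
From mathcomp Require Import all_classical all_reals all_analysis.
From mathcomp Require Import measurable_realfun ring lra zify.

(** The Kullback-Leibler divergence is bounded by integrating a pointwise bound
    on ln (f / p), where p is the mixture density.

    The mixture at (y, x) is a convex combination, with the gates as weights, of
    the mixtures [component] attached to the centers t of the cells of X. It is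
    thus enough to bound f(y|x) / component from above when t is close to x, and
    to show that the gates of the centers far from x have a small total weight
    eta, which costs - ln (1 - eta) ([ln_ratio_le]).

    Three positions of y are distinguished. If C_delta(y) avoids A_0, then f(.|t)
    on this cube is at least exp(- S (delta d^(1/2) / 2 + |x - t|)) f(y|x), with S
    the supremum of the gradient of ln f, by the mean value inequality on the
    convex set R^d x X; what remains is a Riemann sum of the normal density over
    the cells in the cube, whose defect in each coordinate is a multiple of
    h / sigma plus two normal tails ([two_sided_cells], [component_interior]). If
    C_delta(y) meets A_0 while y is within one side of the block of cells, one
    orthant of the cube still consists of cells; this loses the factor 2^(d+1),
    and the assumption 2^-(d+1) > phi(y, 0, sigma_0) (r/2)^d says exactly that this
    loss is smaller than the bracket integrated over B_delta(A_0) ([component_block], [rest_cost_ge]). If y is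
    farther away, a cube of side rho / 2 with corner y, rho <= r, lies in A_0, and
    the normal density with standard deviation sigma_0 gives the bracket itself
    plus the variation of ln f over this cube ([component_outside]).

    The gates are proportional to exp(- R |x - x_i|^2), so that a center whose
    squared distance to x exceeds that of the center of the cell of x by D has
    weight at most exp(- R D). The bound claims a total far weight N exp(- R s)
    together with a distance s^(1/2) only. On a line this is true because
    centers that are not neighbours are two sides apart ([gate_mass_line]).
    In higher dimension the far centers are cut at 9/10 of the diagonal instead:
    all but boundedly many of them have weight far below exp(- R s), and the
    bounded number that remains has a weight of smaller order than s^(1/2)
    ([gate_mass_local], [gate_mass_small]). That weight is paid for by the
    remaining tenth of s^(1/2) in front of the integral of S, which is bounded
    away from zero: a density on R^d cannot be constant, so that ln f has a nonzero
    gradient on a set of positive probability ([integral_gradn_gt0]). The terms of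
    the bound tend to zero by dominated convergence, as every point leaves
    the sets B_delta(A_0) for good.

    For the rate, everything is expressed by one accuracy tau: delta = tau,
    h = tau^(2 + eps), sigma = tau^(1 + eps / d), about 1 / tau cells per edge of
    X, and a block of cells of half side of order tau^(-1/(q - 2)). The first
    three terms are then O(tau). A point y beyond the block satisfies
    tau |y|^q >= c |y|^2, so that costs quadratic in y are O(tau |y|^q); the only
    other cost there is the variation S rho of ln f, which the choice
    rho = r / (1 + r S) reduces to a constant, while - ln rho grows only like
    ln (1 + r S) <= - ln tau + tau (1 + r S) ([far_cost_le]). Altogether
    ln (f / p) <= C tau (1 + S + sum_a |y_a|^q) ([near_ln_ratio]), and counting
    components, m N <= C tau^(- (d_x + d (2 + 1/(q - 2) + eps)))
    ([tau_le_rate]). *)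

Set Implicit Arguments.
Unset Strict Implicit.
Unset Printing Implicit Defensive.

Import Order.TTheory GRing.Theory Num.Theory.
Import numFieldNormedType.Exports.

Local Open Scope classical_set_scope.
Local Open Scope ring_scope.

(** * Measurability and monotonicity of integrals *)

Section integral_mono.
Local Open Scope ereal_scope.
Context dd (T : measurableType dd) (R : realType).
Variable mu : {measure set T -> \bar R}.

Import HBNNSimple.

(** The integral of a function without sign is that of its positive part minus
    something nonnegative, and monotonicity for nonnegative functions holds for
    the integral as a supremum over simple functions. In this form it applies
    directly to ln (f / p). *)
Lemma le_integral_upper (D : set T) (f1 f2 : T -> \bar R) :
  (forall x, D x -> 0 <= f2 x) -> (forall x, D x -> f1 x <= f2 x) ->
  \int[mu]_(x in D) f1 x <= \int[mu]_(x in D) f2 x.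
Proof.
move=> f20 f12; rewrite integralE.
apply: (@le_trans _ _ (\int[mu]_(x in D) f1^\+ x)).
  by apply: geeDl; rewrite oppe_le0; apply: integral_ge0.
rewrite ge0_integralE// [leRHS]ge0_integralE//; apply: ereal_sup_le.
move=> _ [h hf <-]; exists h => // x.
apply: le_trans (hf x) _; rewrite !patchE; case: ifPn => // /set_mem Dx.
by rewrite funeposE ge_max f12//= f20.
Qed.

End integral_mono.

Section borel_product.
Context (R : realType) (m n : nat).
Implicit Types p : 'rV[R]_m * 'rV[R]_n.

Definition rat_box k (a b : 'rV[rat]_k) : set 'rV[R]_k :=
  [set v | forall i, v ord0 i \in `](ratr (a ord0 i)), (ratr (b ord0 i))[].

Lemma measurable_rat_box k (a b : 'rV[rat]_k) : measurable (rat_box a b).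
Proof.
rewrite (_ : rat_box _ _ = \bigcap_(i in [set: 'I_k])
    ((fun v : 'rV[R]_k => v ord0 i) @^-1`
       [set` `](ratr (a ord0 i)), (ratr (b ord0 i))[])).
  apply: fin_bigcap_measurable => // i _.
  by rewrite -[X in measurable X]setTI; exact: measurable_coord.
by apply/seteqP; split=> [v vab i _|v vab i]; exact: vab.
Qed.

Lemma rat_box_ball k (v : 'rV[R]_k) (e : R) : 0 < e ->
  exists a b, rat_box a b v /\ rat_box a b `<=` ball v e.
Proof.
move=> e0.
have /choice[a aP] : forall i, exists q : rat,
    ratr q \in `](v ord0 i - e), (v ord0 i)[.
  by move=> i; apply: rat_in_itvoo; lra.
have /choice[b bP] : forall i, exists q : rat,
    ratr q \in `](v ord0 i), (v ord0 i + e)[.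
  by move=> i; apply: rat_in_itvoo; lra.
exists (\row_i a i), (\row_i b i); split => [i|w wab]; last split=> // i j.
  have := aP i; have := bP i; rewrite !mxE !in_itv/=.
  by move=> /andP[-> _] /andP[_ ->].
rewrite (ord1 i) /ball/=.
have := aP j; have := bP j; have := wab j; rewrite !mxE !in_itv/= ltr_norml.
by move=> /andP[? ?] /andP[? ?] /andP[? ?]; apply/andP; split; lra.
Qed.

(** Boxes with rational corners form a countable base of the topology. *)
Lemma measurable_open (U : set ('rV[R]_m * 'rV[R]_n)) :
  open U -> measurable U.
Proof.
move=> oU.
pose I := ('rV[rat]_m * 'rV[rat]_m * ('rV[rat]_n * 'rV[rat]_n))%type.
pose B (i : I) := rat_box i.1.1 i.1.2 `*` rat_box i.2.1 i.2.2.
rewrite (_ : U = \bigcup_(i in [set i | B i `<=` U]) B i).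
  rewrite bigcup_mkcond; apply: countable_bigcupT_measurable => [|i].
    exact: countableP.
  case: ifP => _ //; apply: measurableX; exact: measurable_rat_box.
apply/seteqP; split => [[y x] Up|p [i iU]]; last exact: iU.
have /nbhs_ballP[e /= e0 eU] := oU _ Up.
have [a [b [aby abe]]] := rat_box_ball y e0.
have [a' [b' [abx abe']]] := rat_box_ball x e0.
exists ((a, b), (a', b')) => // -[y' x'] [/= /abe h /abe' h']; exact: eU.
Qed.

End borel_product.

(** * Euclidean geometry and gradients on a convex set *)

Section euclidean.
Context (R : realType) (n : nat).
Implicit Types (u v w : 'rV[R]_n) (a : R).

Lemma dotrVC u v : dotrV u v = dotrV v u.
Proof. by apply: eq_bigr => i _; rewrite mulrC. Qed.

Lemma dotrVDl u v w : dotrV (u + v) w = dotrV u w + dotrV v w.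
Proof. by rewrite -big_split; apply: eq_bigr => i _; rewrite !mxE mulrDl. Qed.

Lemma dotrVZl a u v : dotrV (a *: u) v = a * dotrV u v.
Proof. by rewrite mulr_sumr; apply: eq_bigr => i _; rewrite !mxE mulrA. Qed.

Lemma dotrVBl u v w : dotrV (u - v) w = dotrV u w - dotrV v w.
Proof. by rewrite dotrVDl -scaleN1r dotrVZl mulN1r. Qed.

Lemma dotrVDr u v w : dotrV w (u + v) = dotrV w u + dotrV w v.
Proof. by rewrite dotrVC dotrVDl !(dotrVC _ w). Qed.

Lemma dotrVZr a u v : dotrV v (a *: u) = a * dotrV v u.
Proof. by rewrite dotrVC dotrVZl dotrVC. Qed.

Lemma dotrVBr u v w : dotrV w (u - v) = dotrV w u - dotrV w v.
Proof. by rewrite dotrVC dotrVBl !(dotrVC _ w). Qed.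

Lemma dotrV_ge0 u : 0 <= dotrV u u.
Proof. by apply: sumr_ge0 => i _; rewrite -expr2 sqr_ge0. Qed.

Lemma enorm_ge0 u : 0 <= enorm u. Proof. exact: sqrtr_ge0. Qed.

Lemma enorm_sqr u : enorm u ^+ 2 = dotrV u u.
Proof. by rewrite sqr_sqrtr// dotrV_ge0. Qed.

Lemma enormZ a u : enorm (a *: u) = `|a| * enorm u.
Proof.
by rewrite /enorm dotrVZl dotrVZr mulrA -expr2 sqrtrM ?sqr_ge0// sqrtr_sqr.
Qed.

Lemma enorm0 : enorm (0 : 'rV[R]_n) = 0.
Proof. by rewrite -(scale0r (0 : 'rV[R]_n)) enormZ normr0 mul0r. Qed.

Lemma enormN u : enorm (- u) = enorm u.
Proof. by rewrite -scaleN1r enormZ normrN1 mul1r. Qed.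

Lemma enormB u v : enorm (u - v) = enorm (v - u).
Proof. by rewrite -opprB enormN. Qed.

Lemma enorm_eq0 u : enorm u = 0 -> u = 0.
Proof.
move=> u0; have : dotrV u u = 0 by rewrite -enorm_sqr u0 expr0n.
move=> /psumr_eq0P ui; apply/rowP => i; rewrite mxE.
have /eqP := ui (fun i _ => sqr_ge0 (u ord0 i)) i isT.
by rewrite mulf_eq0 orbb => /eqP.
Qed.

Lemma coord_enorm u i : `|u ord0 i| <= enorm u.
Proof.
rewrite -sqrtr_sqr ler_wsqrtr// /dotrV (bigD1 i)//= -expr2 lerDl.
by apply: sumr_ge0 => j _; rewrite -expr2 sqr_ge0.
Qed.

Lemma Cauchy_Schwarz u v : `|dotrV u v| <= enorm u * enorm v.
Proof.
have [v0|v0] := eqVneq (enorm v) 0.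
  rewrite v0 mulr0 (enorm_eq0 v0) /dotrV big1 ?normr0// => i _.
  by rewrite mxE mulr0.
have vgt0 : 0 < enorm v by rewrite lt_neqAle eq_sym v0 enorm_ge0.
rewrite -(@ler_pXn2r _ 2%N)// ?nnegrE ?mulr_ge0 ?enorm_ge0//.
rewrite real_normK ?num_real// exprMn !enorm_sqr.
have := dotrV_ge0 (dotrV v v *: u - dotrV u v *: v).
rewrite dotrVBl !dotrVBr !dotrVZl !dotrVZr (dotrVC v u).
have vv : 0 < dotrV v v by rewrite -enorm_sqr exprn_gt0.
rewrite (_ : _ - _ = dotrV v v * (dotrV u u * dotrV v v - dotrV u v ^+ 2)).
  by rewrite pmulr_rge0// subr_ge0.
by ring.
Qed.

Lemma enormD u v : enorm (u + v) <= enorm u + enorm v.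
Proof.
rewrite -(@ler_pXn2r _ 2%N)// ?nnegrE ?addr_ge0 ?enorm_ge0//.
rewrite sqrrD !enorm_sqr dotrVDl !dotrVDr (dotrVC v u).
have := le_trans (ler_norm _) (Cauchy_Schwarz u v).
by lra.
Qed.

Lemma enorm_dist u v w : enorm (u - w) <= enorm (u - v) + enorm (v - w).
Proof. by apply: le_trans (enormD _ _); rewrite addrA subrK. Qed.

Lemma enorm_dist_norm u v : `|enorm u - enorm v| <= enorm (u - v).
Proof.
have le1 w w' : enorm w - enorm w' <= enorm (w - w').
  by rewrite lerBlDr; apply: le_trans (enormD _ _); rewrite subrK.
by rewrite ler_norml le1 andbT lerNl opprB enormB le1.
Qed.

Lemma enorm_le_coord u a : 0 <= a -> (forall i, `|u ord0 i| <= a) ->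
  enorm u <= Num.sqrt n%:R * a.
Proof.
move=> a0 ua; rewrite -[a in leRHS]ger0_norm// -sqrtr_sqr -sqrtrM ?ler0n//.
apply: ler_wsqrtr; rewrite mulr_natl -[n in _ *+ n]card_ord -sumr_const.
apply: ler_sum => i _; rewrite -expr2 -(@real_normK _ (u ord0 i)) ?num_real//.
by rewrite ler_pXn2r// nnegrE.
Qed.

End euclidean.

Section segments.
Context (R : realType) (d dx : nat).
Local Notation YX := ([set: 'rV[R]_d] `*` @ucube R dx).
Implicit Types (p q : 'rV[R]_d * 'rV[R]_dx) (t : R).

Lemma dotrV_row_mx (a a' : 'rV[R]_d) (b b' : 'rV[R]_dx) :
  dotrV (row_mx a b) (row_mx a' b') = dotrV a a' + dotrV b b'.
Proof.
rewrite /dotrV big_split_ord/=; congr (_ + _); apply: eq_bigr => i _.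
  by rewrite !row_mxEl.
by rewrite !row_mxEr.
Qed.

Lemma enorm_incr q p :
  enorm (incr q p) <= enorm (q.1 - p.1) + enorm (q.2 - p.2).
Proof.
rewrite -(@ler_pXn2r _ 2%N)// ?nnegrE ?addr_ge0 ?enorm_ge0//.
rewrite enorm_sqr dotrV_row_mx sqrrD !enorm_sqr.
rewrite addrAC lerDl mulrn_wge0// mulr_ge0 ?enorm_ge0//.
Qed.

Definition seg p q t : 'rV[R]_d * 'rV[R]_dx :=
  (p.1 + t *: (q.1 - p.1), p.2 + t *: (q.2 - p.2)).

Lemma seg0 p q : seg p q 0 = p.
Proof. by case: p => y x; rewrite /seg/= !scale0r !addr0. Qed.

Lemma seg1 p q : seg p q 1 = q.
Proof. by case: q => y x; rewrite /seg/= !scale1r !(addrC _ (_ - _)) !subrK. Qed.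

Lemma incr_seg p q t s : incr (seg p q t) (seg p q s) = (t - s) *: incr q p.
Proof.
rewrite /incr /seg/= scale_row_mx; congr row_mx; rewrite scalerBl.
  by rewrite opprD addrACA subrr add0r.
by rewrite opprD addrACA subrr add0r.
Qed.

Lemma seg_YX p q t : YX p -> YX q -> 0 <= t <= 1 -> YX (seg p q t).
Proof.
move=> [_ xp] [_ xq] /andP[t0 t1]; split => // k /=.
have := xp k; have := xq k; rewrite !in_itv/= !mxE.
move: (p.2 _ _) (q.2 _ _) => a b /andP[b0 b1] /andP[a0 a1].
by apply/andP; split; nra.
Qed.

(** The distance between pairs of row vectors is the largest coordinate of their
    increment, which is equivalent to the Euclidean norm. *)
Lemma near_incrP p (P : 'rV[R]_d * 'rV[R]_dx -> Prop) :
  (\forall q \near p, P q) <->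
  exists2 e : R, 0 < e & forall q, enorm (incr q p) < e -> P q.
Proof.
split=> [/nbhs_ballP[e /= e0 eP]|[e e0 eP]].
  exists e => // q qe; apply: eP; split; split => // i j; rewrite (ord1 i) /ball/=.
    rewrite distrC; apply: le_lt_trans qe.
    have := coord_enorm (incr q p) (lshift _ j).
    by rewrite /incr row_mxEl !mxE.
  rewrite distrC; apply: le_lt_trans qe.
  have := coord_enorm (incr q p) (rshift _ j).
  by rewrite /incr row_mxEr !mxE.
apply/nbhs_ballP; pose c := Num.sqrt (d + dx)%:R + 1 :> R.
have c0 : 0 < c by rewrite /c ltr_wpDl// sqrtr_ge0.
exists (e / (2 * c)) => /= [|q [[_ q1] [_ q2]]].
  by rewrite divr_gt0// mulr_gt0.
apply: eP; apply: le_lt_trans (_ : Num.sqrt (d + dx)%:R * (e / (2 * c)) < e).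
  apply: enorm_le_coord => [|i].
    by rewrite divr_ge0 ?mulr_ge0// ltW.
  rewrite /incr mxE; case: splitP => j _; rewrite !mxE distrC.
    exact: ltW (q1 ord0 j).
  exact: ltW (q2 ord0 j).
rewrite mulrA ltr_pdivrMr ?mulr_gt0// mulrC ltr_pM2l//.
by rewrite /c; have := sqrtr_ge0 ((d + dx)%:R : R); lra.
Qed.

Lemma within_incrP p (V : pseudoMetricType R)
    (h : 'rV[R]_d * 'rV[R]_dx -> V) : {within YX, continuous h} -> YX p ->
  forall e : R, 0 < e -> exists2 eta, 0 < eta &
    forall q, YX q -> enorm (incr q p) < eta -> ball (h p) e (h q).
Proof.
move=> /subspace_continuousP hc YXp e e0.
have /hc/cvg_ballP/(_ _ e0) := YXp.
by move=> /near_incrP[eta eta0 H]; exists eta => // q *; exact: H.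
Qed.

Lemma within_incr_dist p (h : 'rV[R]_d * 'rV[R]_dx -> R) :
  {within YX, continuous h} -> YX p ->
  forall e : R, 0 < e -> exists2 eta, 0 < eta &
    forall q, YX q -> enorm (incr q p) < eta -> `|h p - h q| < e.
Proof. exact: within_incrP. Qed.

Lemma incr_withinP (h : 'rV[R]_d * 'rV[R]_dx -> R) :
  (forall p, YX p -> forall e : R, 0 < e -> exists2 eta, 0 < eta &
     forall q, YX q -> enorm (incr q p) < eta -> `|h p - h q| < e) ->
  {within YX, continuous h}.
Proof.
move=> H; apply/subspace_continuousP => p YXp; apply/cvg_ballP => e e0.
have [eta eta0 eP] := H p YXp e e0; apply/near_incrP; exists eta => // q qp YXq.
exact: eP.
Qed.

End segments.

Section gradient.
Context (R : realType) (d dx : nat).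
Local Notation YX := ([set: 'rV[R]_d] `*` @ucube R dx).
Implicit Types (p q : 'rV[R]_d * 'rV[R]_dx) (g h : 'rV[R]_d * 'rV[R]_dx -> R).
Implicit Types u v : 'rV[R]_(d + dx).

Lemma is_gradP g p u : is_grad g p u <-> forall e : R, 0 < e ->
  exists2 eta, 0 < eta & forall q, enorm (incr q p) < eta -> YX q ->
    `|g q - g p - dotrV u (incr q p)| <= e * enorm (incr q p).
Proof.
by split=> H e e0; [have /near_incrP := H e e0|apply/near_incrP; exact: H].
Qed.

(** A gradient tested only along increments that stay in the set is still
    determined: each coordinate direction contains such an increment, which at a
    boundary point of the cube is directed inwards. *)
Lemma direction_YX p (i : 'I_(d + dx)) : YX p -> exists q, [/\ YX q,
  incr q p != 0 & forall u, dotrV u (incr q p) = 0 -> u ord0 i = 0].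
Proof.
move=> YXp.
suff [q [c [YXq c0 qE]]] : exists q c, [/\ YX q, c != 0 &
    incr q p = c *: delta_mx ord0 i].
  exists q; split=> // [|u].
    apply: contra c0 => /eqP/rowP/(_ i).
    by rewrite qE !mxE !eqxx mulr1 => ->.
  rewrite qE dotrVZr /dotrV (bigD1 i)//= mxE !eqxx mulr1 big1 => [|j ji].
    by rewrite addr0 => /eqP; rewrite mulf_eq0 (negPf c0) => /eqP.
  by rewrite mxE (negPf ji) andbF mulr0.
have rowE k (j k' : 'I_k) : (delta_mx ord0 j : 'rV[R]_k) ord0 k' = (k' == j)%:R.
  by rewrite mxE eqxx.
case: (splitP i) => j ij.
  exists (p.1 + delta_mx ord0 j, p.2), 1; split=> //.
  rewrite /incr/= scale1r addrAC subrr add0r subrr; apply/rowP => k.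
  rewrite rowE mxE; case: splitP => l kl; rewrite ?rowE ?mxE -?val_eqE/= kl ij//.
  by rewrite gtn_eqF// (leq_trans (ltn_ord j))// leq_addr.
have YXpj := YXp.2 j; rewrite in_itv/= in YXpj.
pose c : R := if p.2 ord0 j <= 2^-1 then 2^-1 else - 2^-1.
exists (p.1, p.2 + c *: delta_mx ord0 j), c; split.
- split=> //= k; rewrite in_itv/= !mxE eqxx/=.
  have := YXp.2 k; rewrite in_itv/=; have [->|kj] := eqVneq k j.
    by rewrite /c mulr1; case: ifPn; rewrite -?ltNge; lra.
  by rewrite mulr0 addr0.
- by rewrite /c; case: ifP => _; rewrite ?oppr_eq0 invr_neq0.
rewrite /incr/= subrr addrAC subrr add0r; apply/rowP => k.
rewrite mxE [RHS]mxE rowE; case: splitP => l kl; rewrite ?mxE -?val_eqE/= kl ij.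
  by rewrite ltn_eqF ?mulr0// (leq_trans (ltn_ord l))// leq_addr.
by rewrite eqn_add2l.
Qed.

Lemma is_grad_unique g p u v : YX p -> is_grad g p u -> is_grad g p v -> u = v.
Proof.
move=> YXp /is_gradP gu /is_gradP gv; apply/rowP => i; apply/eqP.
have [q [YXq qp0 qi]] := direction_YX i YXp.
suff /qi/eqP : dotrV (u - v) (incr q p) = 0 by rewrite !mxE subr_eq0.
have n0 : 0 < enorm (incr q p).
  rewrite lt_neqAle enorm_ge0 andbT eq_sym; apply: contra qp0 => /eqP.
  by move/enorm_eq0 => ->.
apply/eqP; rewrite -normr_le0; apply/ler_addgt0Pr => e e0; rewrite add0r.
have e'0 : 0 < e / (2 * enorm (incr q p)) by rewrite divr_gt0// mulr_gt0.
have [a a0 ua] := gu _ e'0; have [b b0 vb] := gv _ e'0.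
pose c := Num.min a b / (2 * (enorm (incr q p) + Num.min a b)).
have m0 : 0 < Num.min a b by rewrite lt_min a0.
have ma : Num.min a b <= a by rewrite ge_min lexx.
have mb : Num.min a b <= b by rewrite ge_min lexx orbT.
have c0 : 0 < c by rewrite divr_gt0// mulr_gt0// addr_gt0.
have c1 : c <= 1.
  by rewrite ler_pdivrMr ?mul1r ?mulr_gt0 ?addr_gt0//; lra.
have YXs : YX (seg p q c) by apply: seg_YX => //; rewrite c1 ltW.
have sE : incr (seg p q c) p = c *: incr q p.
  by rewrite -{2}(seg0 p q) incr_seg subr0.
have nE : enorm (incr (seg p q c) p) < Num.min a b.
  rewrite sE enormZ (gtr0_norm c0) /c mulrAC ltr_pdivrMr ?mulr_gt0 ?addr_gt0//.
  by rewrite ltr_pM2l//; lra.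
have := ua _ (lt_le_trans nE ma) YXs.
have := vb _ (lt_le_trans nE mb) YXs.
rewrite sE !dotrVZr enormZ (gtr0_norm c0) dotrVBl.
set X := dotrV u _; set Y := dotrV v _; set D := g _ - g _.
rewrite (_ : e / _ * _ = e * c / 2); last by field; rewrite gt_eqF.
rewrite !ler_norml => /andP[h1 h2] /andP[h3 h4].
have : - (e * c) <= c * (X - Y) <= e * c by apply/andP; split; lra.
rewrite [e * c]mulrC -mulrN !ler_pM2l//.
Qed.

Lemma grad_unique g p u : YX p -> is_grad g p u -> grad g p = u.
Proof.
move=> YXp gu; apply: (is_grad_unique YXp _ gu).
by rewrite /grad; apply: (@xgetPex _ 0 [set u | is_grad g p u]); exists u.
Qed.

End gradient.

(** * The gradient of the log density *)

Section log_gradient.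
Context (R : realType) (d dx : nat).
Local Notation YX := ([set: 'rV[R]_d] `*` @ucube R dx).
Implicit Types (p q : 'rV[R]_d * 'rV[R]_dx) (g f : 'rV[R]_d * 'rV[R]_dx -> R).
Implicit Types u v : 'rV[R]_(d + dx).

Lemma is_grad_lipschitz g p u : is_grad g p u ->
  exists2 eta, 0 < eta & forall q, enorm (incr q p) < eta -> YX q ->
    `|g q - g p| <= (enorm u + 1) * enorm (incr q p).
Proof.
move=> /is_gradP/(_ _ ltr01)[eta eta0 H]; exists eta => // q qp YXq.
have := H _ qp YXq; have := Cauchy_Schwarz u (incr q p).
rewrite mulrDl mul1r; set X := dotrV _ _; set D := g q - g p.
move: (enorm (incr q p)) (enorm u * _) => B A.
rewrite !ler_norml => /andP[? ?] /andP[? ?]; apply/andP; split; lra.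
Qed.

Lemma is_grad_continuous g :
  (forall p, YX p -> exists u, is_grad g p u) -> {within YX, continuous g}.
Proof.
move=> gd; apply: incr_withinP => p YXp e e0.
have [u /is_grad_lipschitz[eta eta0 H]] := gd _ YXp.
have u0 : 0 < enorm u + 1 by rewrite ltr_wpDl// enorm_ge0.
exists (Num.min eta (e / (enorm u + 1))) => [|q YXq].
  by rewrite lt_min eta0 divr_gt0.
rewrite lt_min => /andP[qp1 qp2]; rewrite distrC; apply: le_lt_trans (H _ qp1 YXq) _.
by rewrite mulrC -ltr_pdivlMr.
Qed.

(** Both sides of the expansion follow from ln u <= u - 1, applied to b / a and
    to a / b. *)
Lemma ln_taylor (a b : R) : 0 < a -> 0 < b ->
  `|ln b - ln a - (b - a) / a| <= (b - a) ^+ 2 / (a * b).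
Proof.
move=> a0 b0.
have ub (x y : R) : 0 < x -> 0 < y -> ln y - ln x <= (y - x) / x.
  move=> x0 y0; rewrite -ln_div ?posrE//.
  have -> : y / x = 1 + (y - x) / x by field; rewrite gt_eqF.
  apply: le_ln1Dx; rewrite ltr_pdivlMr//; lra.
rewrite ler_norml; apply/andP; split; last first.
  by rewrite (@le_trans _ _ 0) ?subr_le0 ?ub// divr_ge0 ?sqr_ge0// mulr_ge0 ?ltW.
have -> : - ((b - a) ^+ 2 / (a * b)) = - ((a - b) / b) - (b - a) / a.
  by field; rewrite !gt_eqF.
by rewrite lerD2r lerNl opprB ub.
Qed.

Lemma is_grad_ln f p u : (forall q, YX q -> 0 < f q) -> YX p ->
  is_grad f p u -> is_grad (fun q => ln (f q)) p ((f p)^-1 *: u).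
Proof.
move=> f0 YXp fu; apply/is_gradP => e e0.
have a0 := f0 _ YXp; set a := f p in a0 *.
have [n1 n10 L] := is_grad_lipschitz fu.
have ea0 : 0 < a * e / 2 by rewrite divr_gt0// mulr_gt0.
have [n2 n20 H] := (is_gradP _ _ _).1 fu _ ea0.
set K := enorm u + 1 in L.
have K0 : 0 < K by rewrite /K ltr_wpDl// enorm_ge0.
have n30 : 0 < a / (2 * K) by rewrite divr_gt0// mulr_gt0.
have n40 : 0 < e * a ^+ 2 / (4 * K ^+ 2).
  by rewrite divr_gt0// mulr_gt0// exprn_gt0.
exists (Num.min (Num.min n1 n2) (Num.min (a / (2 * K)) (e * a ^+ 2 / (4 * K ^+ 2)))).
  by rewrite !lt_min n10 n20 n30.
move=> q; rewrite !lt_min => /andP[/andP[q1 q2] /andP[q3 q4]] YXq.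
have b0 := f0 _ YXq.
have {L}l1 := L _ q1 YXq; have {H}l2 := H _ q2 YXq.
have l3 := ln_taylor a0 b0.
rewrite dotrVZl; rewrite -/a in l1 l2 *.
set b := f q in b0 l1 l2 l3 *; set N := enorm (incr q p) in l1 l2 q3 q4 *.
have N0 : 0 <= N by exact: enorm_ge0.
set X := dotrV u _ in l2 *.
have KN : K * N <= a / 2.
  rewrite (_ : a / 2 = K * (a / (2 * K))); last by field; rewrite gt_eqF.
  by rewrite ler_pM2l// ltW.
have ba : a / 2 <= b by move: l1; rewrite ler_norml => /andP[? ?]; lra.
have sq : (b - a) ^+ 2 <= (K * N) ^+ 2.
  rewrite -(@real_normK _ (b - a)) ?num_real// ler_pXn2r// ?nnegrE//.
  by rewrite mulr_ge0// ltW.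
have t1 : (b - a) ^+ 2 / (a * b) <= e / 2 * N.
  rewrite ler_pdivrMr ?mulr_gt0//; apply: le_trans sq _.
  apply: (@le_trans _ _ (e / 2 * N * (a * (a / 2)))); last first.
    by rewrite ler_wpM2l ?mulr_ge0 ?divr_ge0 ?(ltW e0)// ler_wpM2l// ltW.
  have : N * (4 * K ^+ 2) <= e * a ^+ 2.
    by rewrite -ler_pdivlMr ?ltW// mulr_gt0// exprn_gt0.
  move=> /(ler_wpM2l N0); rewrite exprMn; lra.
have t2 : `|(b - a) / a - a^-1 * X| <= e / 2 * N.
  have -> : (b - a) / a - a^-1 * X = (b - a - X) / a by ring.
  rewrite normrM [`|a^-1|]gtr0_norm ?invr_gt0// ler_pdivrMr//.
  by apply: le_trans l2 _; rewrite le_eqVlt; apply/orP; left; apply/eqP; ring.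
rewrite (_ : _ - _ = (ln b - ln a - (b - a) / a) + ((b - a) / a - a^-1 * X)); last by ring.
by apply: le_trans (ler_normD _ _) _; lra.
Qed.

(** The mean value theorem along the segment; at its interior points increments
    of both signs stay in the set, so that the relative gradient yields an ordinary
    derivative. *)
Lemma is_grad_segment g p q :
  (forall q, YX q -> exists u, is_grad g q u) -> YX p -> YX q ->
  forall M : R, (forall t, 0 <= t <= 1 -> enorm (grad g (seg p q t)) <= M) ->
    `|g q - g p| <= M * enorm (incr q p).
Proof.
move=> gd YXp YXq M GM.
have gg r : YX r -> is_grad g r (grad g r).
  by move=> YXr; have [u gu] := gd _ YXr; rewrite (grad_unique YXr gu).
pose phi (t : R) := g (seg p q t).
pose dphi t := dotrV (grad g (seg p q t)) (incr q p).
have n0 := enorm_ge0 (incr q p).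
have der t : t \in `]0, 1[ -> is_derive (t : R) 1 phi (dphi t).
  rewrite in_itv/= => /andP[t0 t1].
  have YXt : YX (seg p q t) by apply: seg_YX => //; rewrite !ltW.
  suff cvgphi : h^-1 *: ((phi \o shift t) (h *: (1 : R)) - phi t) @[h --> 0^']
      --> dphi t.
    by apply: DeriveDef; [apply/cvg_ex; exists (dphi t)|apply/cvg_lim].
  apply/cvgrPdist_le => e e0.
  have e'0 : 0 < e / (enorm (incr q p) + 1) by rewrite divr_gt0// ltr_wpDl.
  have [eta eta0 H] := (is_gradP _ _ _).1 (gg _ YXt) _ e'0.
  near=> h.
  have h0 : h != 0 by near: h; exact: nbhs_dnbhs_neq.
  have hn : `|h| < Num.min (Num.min t (1 - t)) (eta / (enorm (incr q p) + 1)).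
    near: h; apply: dnbhs0_lt; rewrite !lt_min t0 subr_gt0 t1/=.
    by rewrite divr_gt0// ltr_wpDl.
  move: hn; rewrite !lt_min => /andP[/andP[ht h1t] heta].
  have YXh : YX (seg p q (h + t)).
    apply: seg_YX => //; move: ht h1t; rewrite !ltr_norml.
    by move=> /andP[? ?] /andP[? ?]; apply/andP; split; lra.
  have := H (seg p q (h + t)); rewrite incr_seg addrK enormZ dotrVZr => H'.
  rewrite /= /phi /dphi /shift/= [h *: 1]mulr1.
  have {}H' := H' _ YXh.
  set D := g _ - g _ in H' *; set X := dotrV _ _ in H' *.
  rewrite distrC -(ler_pM2l (_ : 0 < `|h|)) ?normr_gt0// -normrM.
  rewrite mulrBr [h * _]scalerA mulfV// scale1r.
  apply: le_trans (H' _) _.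
    apply: le_lt_trans (_ : `|h| * (enorm (incr q p) + 1) < eta).
      by rewrite ler_wpM2l// lerDl.
    by rewrite -ltr_pdivlMr// ltr_wpDl.
  rewrite mulrCA ler_wpM2l// mulrAC ler_pdivrMr ?ltr_wpDl//.
  by rewrite ler_wpM2l ?(ltW e0)// lerDl.
have cphi : {within `[0, 1], continuous phi}.
  apply/subspace_continuousP => t /=; rewrite in_itv/= => t01.
  apply/cvgrPdist_lt => e e0.
  have YXt := seg_YX YXp YXq t01.
  have [eta eta0 H] := is_grad_lipschitz (gg _ YXt).
  set K := enorm _ + 1 in H.
  have K0 : 0 < K by rewrite /K ltr_wpDl// enorm_ge0.
  have n10 : 0 < enorm (incr q p) + 1 by rewrite ltr_wpDl.
  apply/nbhs_ballP; exists (Num.min eta (e / K) / (enorm (incr q p) + 1)).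
    by rewrite /= divr_gt0// lt_min eta0 divr_gt0.
  move=> s; rewrite /ball/= ltr_pdivlMr// => ts; rewrite in_itv/= => s01.
  have YXs := seg_YX YXp YXq s01.
  have : `|t - s| * enorm (incr q p) < Num.min eta (e / K).
    by apply: le_lt_trans ts; rewrite ler_wpM2l// lerDl.
  rewrite lt_min => /andP[l1 l2].
  have stE : enorm (incr (seg p q s) (seg p q t)) = `|t - s| * enorm (incr q p).
    by rewrite incr_seg enormZ distrC.
  have := H (seg p q s); rewrite stE => /(_ l1 YXs) gst.
  rewrite distrC; apply: le_lt_trans gst _.
  by rewrite mulrC -ltr_pdivlMr.
have [c /=] := MVT ltr01 der cphi.
rewrite in_itv/= /phi seg0 seg1 subr0 mulr1 => /andP[c0 c1] ->.
apply: le_trans (Cauchy_Schwarz _ _) _.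
by rewrite ler_wpM2r// GM// !ltW.
Unshelve. all: by end_near. Qed.

Definition gradn f p : R := enorm (grad (fun q => ln (f q)) p).

Lemma grad_ln f p : (forall q, YX q -> 0 < f q) ->
  (forall q, YX q -> exists u, is_grad f q u) -> YX p ->
  grad (fun q => ln (f q)) p = (f p)^-1 *: grad f p.
Proof.
move=> f0 fd YXp; have [u fu] := fd _ YXp.
by rewrite (grad_unique YXp fu); exact/grad_unique/is_grad_ln.
Qed.

Lemma gradn_continuous f : (forall q, YX q -> 0 < f q) ->
  cont_differentiable f -> {within YX, continuous (gradn f)}.
Proof.
move=> f0 [fd gc]; have fc := is_grad_continuous fd.
pose h q := enorm (grad f q).
suff hc : {within YX, continuous h}.
  pose k q := (f q)^-1 * h q.
  have kc : {within YX, continuous k}.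
    apply/subspace_continuousP => p YXp; apply: cvgM.
      apply: cvgV; first by rewrite gt_eqF ?f0.
      by move/subspace_continuousP : fc; exact.
    by move/subspace_continuousP : hc; exact.
  have gk q : YX q -> gradn f q = k q.
    move=> YXq; rewrite /gradn grad_ln// enormZ ger0_norm// invr_ge0.
    by rewrite ltW ?f0.
  apply: incr_withinP => p YXp e e0.
  have [eta eta0 H] := within_incr_dist kc YXp e0.
  by exists eta => // q YXq qp; rewrite !gk//; exact: H.
apply: incr_withinP => p YXp e e0.
pose c := Num.sqrt (d + dx)%:R + 1 : R.
have c0 : 0 < c by rewrite ltr_wpDl// sqrtr_ge0.
have e'0 : 0 < e / c by rewrite divr_gt0.
have [eta eta0 H] := within_incrP gc YXp e'0.
exists eta => // q YXq /(H _ YXq) [_ B].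
have : enorm (grad f p - grad f q) < e.
  apply: le_lt_trans (enorm_le_coord (ltW e'0) _) _.
    by move=> i; rewrite !mxE; exact: ltW (B ord0 i).
  rewrite mulrA ltr_pdivrMr// mulrC ltr_pM2l// /c; lra.
by apply: le_lt_trans; exact: enorm_dist_norm.
Qed.

End log_gradient.

(** * Local suprema of the gradient *)

Section sup_dlog_theory.
Context (R : realType) (d dx : nat).
Local Notation YX := ([set: 'rV[R]_d] `*` @ucube R dx).
Implicit Types (p q : 'rV[R]_d * 'rV[R]_dx) (f : 'rV[R]_d * 'rV[R]_dx -> R).

Lemma measurable_ucube n : measurable (@ucube R n).
Proof.
rewrite (_ : @ucube R n = \bigcap_(i in [set: 'I_n])
    ((fun v : 'rV[R]_n => v ord0 i) @^-1` [set` `[0, 1] ])).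
  apply: fin_bigcap_measurable => // i _.
  by rewrite -[X in measurable X]setTI; exact: measurable_coord.
by apply/seteqP; split=> [v vab i _|v vab i]; exact: vab.
Qed.

Lemma measurable_YX : measurable YX.
Proof. by apply: measurableX => //; exact: measurable_ucube. Qed.

Lemma within_continuous_measurable (h : 'rV[R]_d * 'rV[R]_dx -> R) :
  {within YX, continuous h} -> measurable_fun YX (h : _ -> measurableTypeR R).
Proof.
move=> /continuousP hc; apply: (measurability _ (RGenOInfty.measurableE R)).
move=> _ [_ [c ->] <-].
have /hc/open_subspaceP[V oV VE] : open `]c, +oo[%classic.
  exact: interval_open.
by rewrite setIC -VE; apply: measurableI; [exact: measurable_open|exact: measurable_YX].
Qed.

Lemma sup_dlog_ub f (a b : R) p q :
  hypercube a p.1 q.1 -> ucube q.2 -> enorm (p.2 - q.2) <= b ->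
  ((gradn f q)%:E <= sup_dlog f a b p)%E.
Proof. by move=> h1 h2 h3; apply: ereal_sup_ubound; exists q. Qed.

Lemma gradn_le_sup_dlog f (a b : R) p : YX p -> 0 <= a -> 0 <= b ->
  ((gradn f p)%:E <= sup_dlog f a b p)%E.
Proof.
move=> [_ xp] a0 b0; apply: sup_dlog_ub => //.
  by move=> k; rewrite subrr normr0 divr_ge0.
by rewrite subrr enorm0.
Qed.

Lemma sup_dlog_ge0 f (a b : R) p : YX p -> 0 <= a -> 0 <= b ->
  (0 <= sup_dlog f a b p)%E.
Proof.
move=> YXp a0 b0; apply: le_trans (gradn_le_sup_dlog f YXp a0 b0).
by rewrite lee_fin enorm_ge0.
Qed.

Lemma le_sup_dlog f (a b a' b' : R) p : a <= a' -> b <= b' ->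
  (sup_dlog f a b p <= sup_dlog f a' b' p)%E.
Proof.
move=> aa bb; apply: ereal_sup_le => _ [q [h1 h2 h3] <-].
exists q => //; split=> // [k|].
  by apply: le_trans (h1 k) _; lra.
exact: le_trans bb.
Qed.

(** Moving q slightly towards p makes the constraints strict without losing the
    strict inequality c < |grad ln f (q)|: the supremum is lower semicontinuous in
    p, and in particular measurable. *)
Lemma sup_dlog_open f (a b c : R) : {within YX, continuous (gradn f)} ->
  0 < a -> 0 < b -> exists2 U : set ('rV[R]_d * 'rV[R]_dx), open U &
    forall p, YX p -> U p <-> (c%:E < sup_dlog f a b p)%E.
Proof.
move=> gc a0 b0.
pose I := [set q | YX q /\ c < gradn f q].
pose V q : set ('rV[R]_d * 'rV[R]_dx) :=
  [set p : 'rV[R]_d * 'rV[R]_dx | (forall k, `|q.1 ord0 k - p.1 ord0 k| < a / 2) /\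
           enorm (p.2 - q.2) < b].
exists (\bigcup_(q in I) V q).
  apply: bigcup_open => q Iq; rewrite openE => p [pq1 pq2].
  apply/near_incrP.
  have /choice[e eP] : forall k, exists e : R, 0 < e /\
      `|q.1 ord0 k - p.1 ord0 k| + e <= a / 2.
    move=> k.
    exists (a / 2 - `|q.1 ord0 k - p.1 ord0 k|).
    by rewrite subr_gt0; split; [exact: pq1|rewrite addrC subrK].
  pose e1 := \big[Num.min/b - enorm (p.2 - q.2)]_k e k.
  have e10 : 0 < e1.
    rewrite /e1; elim/big_ind : _ => [|x y|k _]; first by rewrite subr_gt0.
      by rewrite lt_min => -> ->.
    by have [] := eP k.
  exists e1 => // r rp.
  have r2 : enorm (r.2 - p.2) <= enorm (incr r p).
    rewrite ler_wsqrtr// /incr dotrV_row_mx lerDr; exact: dotrV_ge0.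
  split=> [k|].
    have [_] := eP k; apply: lt_le_trans.
    rewrite -[_ - r.1 _ _](@subrKA _ (p.1 ord0 k)).
    apply: le_lt_trans (ler_normD _ _) _; rewrite ltrD2l.
    have : e1 <= e k by rewrite /e1; apply: bigmin_le_cond.
    apply: lt_le_trans; apply: le_lt_trans rp; rewrite distrC.
    have := coord_enorm (incr r p) (lshift _ k).
    by rewrite /incr row_mxEl !mxE.
  have e1b : e1 <= b - enorm (p.2 - q.2) by exact: bigmin_le_id.
  apply: le_lt_trans (enorm_dist _ p.2 _) _.
  by rewrite -ltrBrDr; apply: le_lt_trans r2 _; apply: lt_le_trans rp _.
move=> p YXp; split=> [[q [YXq cq] [pq1 pq2]]|/ereal_sup_gt[_ [q [q1 q2 q3] <-]]].
  apply: lt_le_trans (sup_dlog_ub _ _ YXq.2 (ltW pq2)); first by rewrite lte_fin.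
  by move=> k; exact/ltW/pq1.
rewrite lte_fin => cq.
have YXq : YX q by [].
have H : exists2 eta : R, 0 < eta & forall r, YX r -> enorm (incr r q) < eta ->
    c < gradn f r.
  have gc0 : 0 < gradn f q - c by rewrite subr_gt0.
  have [e e0 eP] := within_incr_dist gc YXq gc0.
  exists e; first exact: e0.
  move=> r YXr rq; have := eP r YXr rq; rewrite ltr_norml => /andP[_].
  by move: (gradn f q) (gradn f r) => x y; lra.
case: H => e e0 eP.
pose t := Num.min 1 (e / (2 * (enorm (incr p q) + 1))).
have n1 : 0 < enorm (incr p q) + 1 by rewrite ltr_wpDl// enorm_ge0.
have t0 : 0 < t by rewrite lt_min ltr01/= divr_gt0// mulr_gt0.
have t1 : t <= 1 by rewrite ge_min lexx.
have te : t * enorm (incr p q) < e.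
  apply: (@le_lt_trans _ _ (e / (2 * (enorm (incr p q) + 1)) * enorm (incr p q))).
    by rewrite ler_wpM2r ?enorm_ge0// ge_min lexx orbT.
  rewrite mulrAC ltr_pdivrMr ?mulr_gt0// ltr_pM2l//.
  by have := enorm_ge0 (incr p q); lra.
exists (seg q p t).
  have YXs : YX (seg q p t) by apply: seg_YX => //; rewrite t1 ltW.
  split; first exact: YXs.
  apply: eP; first exact: YXs.
  have -> : incr (seg q p t) q = t *: incr p q.
    by rewrite -{2}(seg0 q p) incr_seg subr0.
  by rewrite enormZ (gtr0_norm t0).
split=> [k|] /=.
  rewrite !mxE (_ : _ - _ = (1 - t) * (q.1 ord0 k - p.1 ord0 k)); last by ring.
  rewrite normrM ger0_norm ?subr_ge0//.
  have := q1 k; have := normr_ge0 (q.1 ord0 k - p.1 ord0 k).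
  by move: (`|_|) => x; nra.
rewrite (_ : _ - _ = (1 - t) *: (p.2 - q.2)).
  rewrite enormZ ger0_norm ?subr_ge0//.
  by move: q3 (enorm_ge0 (p.2 - q.2)); move: (enorm _) => x; nra.
by rewrite scalerBl scale1r opprD addrA.
Qed.

Lemma measurable_sup_dlog f (a b : R) : {within YX, continuous (gradn f)} ->
  0 < a -> 0 < b -> measurable_fun YX (sup_dlog f a b).
Proof.
move=> gc a0 b0; apply: (measurability _ (ErealGenOInfty.measurableE R)).
move=> _ [_ [c ->] <-].
have [U oU UP] := sup_dlog_open c gc a0 b0.
rewrite (_ : _ `&` _ = YX `&` U).
  by apply: measurableI; [exact: measurable_YX|exact: measurable_open].
apply/seteqP; split=> p [YXp pU]; split=> //.
  by apply/UP => //; move: pU; rewrite /= in_itv/= andbT.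
by rewrite /= in_itv/= andbT; exact/UP.
Qed.

End sup_dlog_theory.

(** * Cells of a cubic grid *)

Section grid.
Context (R : realType) (d : nat).
Implicit Types (o y z : 'rV[R]_d) (h : R) (k : 'rV[int]_d).

(** The whole grid, of which the cells A_1, ..., A_m are a part: each point has
    exactly one index, and it lies in A_0 when no cell A_j has this index. *)
Definition grid_cell o h k : set 'rV[R]_d :=
  [set y | forall a, y ord0 a \in
    `[o ord0 a + h * (k ord0 a)%:~R, o ord0 a + h * ((k ord0 a)%:~R + 1)[].

Definition grid_index o h y : 'rV[int]_d :=
  \row_a Num.floor ((y ord0 a - o ord0 a) / h).

Lemma grid_cellP o h k y : 0 < h -> grid_cell o h k y <-> k = grid_index o h y.
Proof.
move=> h0; split=> [yk|->].
  apply/rowP => a; rewrite mxE; apply/esym/floor_def.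
  have := yk a; rewrite in_itv/= => /andP[y1 y2].
  by rewrite ler_pdivlMr// ltr_pdivrMr// intrD; apply/andP; split; lra.
move=> a; rewrite in_itv/= mxE.
have /andP[] := floor_itv ((y ord0 a - o ord0 a) / h).
by rewrite intrD ler_pdivlMr// ltr_pdivrMr// => ? ?; apply/andP; split; lra.
Qed.

Lemma yrestP m (P : ypartition R d m) y : yrest P y <->
  forall j, yindex P j <> grid_index (yorigin P) (yside P) y.
Proof.
split=> [yP j jE|H [j _] /grid_cellP -/(_ (yside_gt0 P))]; last exact: H.
by apply: yP; exists j => //; apply/grid_cellP => //; exact: yside_gt0.
Qed.

End grid.

Section near_rest_measurable.
Context (R : realType) (d dx : nat).

(** C_delta(y) meets A_0 when it meets one of the countably many cells of the
    grid outside the partition, and the set of such y is a box for each cell. *)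
Lemma measurable_near_rest m (T : tuning R d dx m) : measurable (near_rest T).
Proof.
apply: measurableI; first exact: measurable_YX.
set P := ypart T; set h := yside P; set o := yorigin P; set del := delta T.
have h0 : 0 < h := yside_gt0 P; have del0 : 0 < del := delta_gt0 T.
pose B (k : 'rV[int]_d) : set ('rV[R]_d * 'rV[R]_dx) :=
  \bigcap_(a in [set: 'I_d]) ((fun p : 'rV[R]_d * 'rV[R]_dx => p.1 ord0 a : measurableTypeR R) @^-1`
    [set` `[o ord0 a + h * (k ord0 a)%:~R - del / 2,
            o ord0 a + h * ((k ord0 a)%:~R + 1) + del / 2[ ]).
rewrite (_ : [set _ | _] = \bigcup_(k in [set k | forall j, yindex P j <> k]) B k).
  rewrite bigcup_mkcond; apply: countable_bigcupT_measurable => [|k].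
    exact: countableP.
  case: ifP => _ //; apply: fin_bigcap_measurable => // a _.
  rewrite -[X in measurable X]setTI.
  exact: (measurableT_comp (measurable_coord a) measurable_fst).
apply/seteqP; split=> [p [z [zp /yrestP zP]]|p [k kP pk]].
  exists (grid_index o h z) => // a _ /=.
  have /(_ a) := (grid_cellP o (grid_index o h z) z h0).2 erefl.
  have := zp a; rewrite !in_itv/= ler_norml => /andP[? ?] /andP[? ?].
  by apply/andP; split; lra.
pose z : 'rV[R]_d := \row_a Num.max (p.1 ord0 a - del / 2)
  (o ord0 a + h * (k ord0 a)%:~R).
exists z; split=> [a|].
  have := pk a Logic.I; rewrite /= in_itv/= => /andP[? ?].
  rewrite mxE -/del.
  by case: (leP (p.1 ord0 a - _)) => ?; rewrite ler_norml; apply/andP; split; lra.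
apply/yrestP; suff <- : k = grid_index o h z by exact: kP.
apply/grid_cellP => // a; have := pk a Logic.I; rewrite /= !in_itv/= mxE.
by move=> /andP[? ?]; case: (leP (p.1 ord0 a - _)) => ?; apply/andP; split; lra.
Qed.

End near_rest_measurable.

(** * Riemann sums of the normal density *)

Section gauss_tail.
Context (R : realType).
Implicit Types (a b t v w h x y : R).

Local Notation J := (@gauss_integral_proof.integral0_gauss R).

Lemma gauss_J_derive x : 0 < x -> is_derive (x : R) 1 J (gauss_fun x).
Proof.
move=> x0; have [] := @continuous_FTC1 R (@gauss_fun R) (BLeft 0) x (x + 1).
- by rewrite ltrDl.
- apply: continuous_compact_integrable => //; first exact: segment_compact.
  by apply: continuous_subspaceT; exact: continuous_gauss_fun.
- by rewrite /= lte_fin.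
- exact: continuous_gauss_fun.
by move=> dJ; rewrite derive1E => J'; exact: DeriveDef.
Qed.

Lemma gauss_J_continuous a b : 0 <= a -> a <= b ->
  {within `[a, b], continuous J}.
Proof.
move=> a0 ab; apply: continuous_subspaceW (_ : {within `[0, b], continuous J}).
  by move=> x /=; rewrite !in_itv/= => /andP[/(le_trans a0) -> ->].
apply: parameterized_integral_continuous => //=; first exact: le_trans ab.
apply: continuous_compact_integrable => //; first exact: segment_compact.
by apply: continuous_subspaceT; exact: continuous_gauss_fun.
Qed.

Lemma gauss_J_MVT a b : 0 <= a -> a < b ->
  exists2 c, a < c < b & J b - J a = gauss_fun c * (b - a).
Proof.
move=> a0 ab.
have [||c] := @MVT R J (@gauss_fun R) a b ab; last by rewrite in_itv/=; exists c.
  move=> x; rewrite in_itv/= => /andP[ax _]; apply: gauss_J_derive.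
  exact: le_lt_trans ax.
exact: gauss_J_continuous (ltW ab).
Qed.

Lemma gauss_J0 : J 0 = 0.
Proof. by rewrite /gauss_integral_proof.integral0_gauss set_itv1 Rintegral_set1. Qed.

Lemma gauss_J_cvg : J x @[x --> +oo] --> Num.sqrt pi / 2.
Proof.
have : Num.sqrt (J x ^+ 2) @[x --> +oo] --> Num.sqrt (pi / 4 : R).
  apply: continuous_cvg => //; first exact: sqrt_continuous.
  exact: gauss_integral_proof.cvg_integral0_gauss_sqr.
rewrite sqrtrM ?pi_ge0// sqrtrV// (_ : 4 = 2 ^+ 2); last by rewrite expr2 -natrM.
rewrite sqrtr_sqr ger0_norm// (_ : (fun _ => Num.sqrt _) = J)//.
apply/funext => r; rewrite sqrtr_sqr ger0_norm//.
exact: gauss_integral_proof.integral0_gauss_ge0.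
Qed.

Lemma gauss_fun_mono a b : 0 <= a -> a <= b -> gauss_fun b <= gauss_fun a.
Proof.
move=> a0 ab; rewrite ler_expR lerN2 ler_pXn2r// nnegrE//.
exact: le_trans ab.
Qed.

Lemma gauss_J_le t : 0 <= t -> J t <= t.
Proof.
rewrite le_eqVlt => /predU1P[<-|t0]; first by rewrite gauss_J0.
have [c _] := gauss_J_MVT (lexx 0) t0.
by rewrite gauss_J0 !subr0 => ->; rewrite ler_piMl ?gauss_fun_le1// ltW.
Qed.

(** The density is decreasing away from its mode, so a cell placed before the
    interval [t, t + h] carries more mass than this interval. *)
Lemma gauss_J_step v t h : 0 <= v -> v <= t -> 0 < h ->
  J (t + h) - J t <= h * gauss_fun v.
Proof.
move=> v0 vt h0; have t0 := le_trans v0 vt.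
have [|c /andP[tc _] ->] := @gauss_J_MVT t (t + h) t0; first by rewrite ltrDl.
rewrite addrAC subrr add0r mulrC ler_wpM2l ?(ltW h0)//.
by apply: gauss_fun_mono => //; exact: le_trans (ltW tc).
Qed.

(** The function J y + gauss_fun y / (2 b) is nonincreasing on [b, +oo[ since its
    derivative is gauss_fun y (1 - y / b); its limit at infinity is
    sqrt pi / 2. *)
Lemma gauss_J_tail b : 0 < b -> Num.sqrt pi / 2 - gauss_fun b / (2 * b) <= J b.
Proof.
move=> b0; rewrite lerBlDr.
suff H x : b < x -> J x <= J b + gauss_fun b / (2 * b).
  rewrite -(cvg_lim _ gauss_J_cvg)//; apply: limr_le.
    by apply/cvg_ex; exists (Num.sqrt pi / 2); exact: gauss_J_cvg.
  near=> x; apply: H; near: x; apply: nbhs_pinfty_gt; exact: num_real.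
move=> bx.
have dg y : is_derive (y : R) 1 (@gauss_fun R) (- (2 * y) * gauss_fun y).
  have -> : @gauss_fun R = expR \o (fun z => - z ^+ 2) by apply/funext.
  apply: is_derive_eq; rewrite /gauss_fun/= [y%:A]mulr1; ring.
pose K y := J y + (2 * b)^-1 * gauss_fun y.
have dK y : 0 < y -> is_derive (y : R) 1 K (gauss_fun y - y * gauss_fun y / b).
  move=> y0; have dJ := gauss_J_derive y0.
  apply: is_derive_eq; rewrite /GRing.scale/=.
  by field; rewrite gt_eqF.
have cK : {within `[b, x], continuous K}.
  apply: derivable_within_continuous => y; rewrite in_itv/= => /andP[by_ _].
  by have [] := dK y (lt_le_trans b0 by_).
have dK' y : y \in `]b, x[ -> is_derive (y : R) 1 K (gauss_fun y - y * gauss_fun y / b).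
  by rewrite in_itv/= => /andP[by_ _]; apply: dK; exact: lt_trans by_.
have [c] := MVT bx dK' cK.
rewrite in_itv/= => /andP[bc _] E.
have : K x - K b <= 0.
  rewrite E mulr_le0_ge0// ?subr_ge0 ?(ltW bx)// subr_le0 ler_pdivlMr// mulrC.
  by rewrite ler_wpM2r ?gauss_fun_ge0// ltW.
rewrite /K subr_le0 [_^-1 * gauss_fun b]mulrC; apply: le_trans.
by rewrite lerDl mulr_ge0 ?gauss_fun_ge0// invr_ge0 mulr_ge0// ltW.
Unshelve. all: by end_near. Qed.

End gauss_tail.

Section grid_sum.
Context (R : realType).
Implicit Types (a b t u v w h y o sigma : R).

(** The density phi is the product of these densities over the coordinates. *)
Definition gauss1 sigma u : R :=
  expR (- (u ^+ 2 / (2 * sigma ^+ 2))) / (Num.sqrt (2 * pi) * sigma).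

Lemma gauss1_ge0 sigma u : 0 < sigma -> 0 <= gauss1 sigma u.
Proof.
by move=> s0; rewrite divr_ge0 ?expR_ge0// mulr_ge0 ?sqrtr_ge0// ltW.
Qed.

Lemma gauss1N sigma u : gauss1 sigma (- u) = gauss1 sigma u.
Proof. by rewrite /gauss1 sqrrN. Qed.

(** The classical upper bound for the probability that a centered normal variable
    with standard deviation sigma exceeds w. *)
Definition gauss_tail sigma w : R := sigma ^+ 2 / w * gauss1 sigma w.

Lemma sqrt2pi_gt0 : 0 < Num.sqrt (2 * pi) :> R.
Proof. by rewrite sqrtr_gt0 mulr_gt0// pi_gt0. Qed.

Lemma gauss1_fun sigma u : 0 < sigma ->
  gauss1 sigma u =
  gauss_fun (u / (Num.sqrt 2 * sigma)) / (Num.sqrt pi * (Num.sqrt 2 * sigma)).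
Proof.
move=> s0; rewrite /gauss1 /gauss_fun sqrtrM// expr_div_n exprMn sqr_sqrtr//.
by rewrite mulrA [Num.sqrt pi * _]mulrC.
Qed.

(** Each cell is compared with the integral over the next interval of length h,
    so that the sum dominates the integral from e + h to w; the interval [0, e + h]
    that is lost has mass at most its length times the maximum of the density, and
    the tail beyond w is bounded separately. *)
Lemma one_sided_sum sigma h e w (K : nat) : 0 < sigma -> 0 < h -> 0 <= e ->
  0 < w -> w <= e + h * K.+1%:R ->
  2^-1 - (e + h) / (Num.sqrt (2 * pi) * sigma) - gauss_tail sigma w <=
  \sum_(i < K) h * gauss1 sigma (e + h * (i%:R + 2^-1)).
Proof.
move=> s0 h0 e0 w0 wK; pose c := Num.sqrt 2 * sigma : R.
have sq2 : 0 < Num.sqrt 2 :> R by rewrite sqrtr_gt0.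
have c0 : 0 < c by rewrite mulr_gt0.
have sp : 0 < Num.sqrt pi :> R by rewrite sqrtr_gt0 pi_gt0.
pose J := @gauss_integral_proof.integral0_gauss R.
have step n : J ((e + h * n.+1%:R) / c) - J ((e + h) / c) <=
    \sum_(i < n) h / c * gauss_fun ((e + h * (i%:R + 2^-1)) / c).
  elim: n => [|n IHn]; first by rewrite mulr1 subrr big_ord0.
  rewrite big_ord_recr/=.
  have -> : (e + h * n.+2%:R) / c = (e + h * n.+1%:R) / c + h / c.
    by rewrite -[n.+2%:R]natr1; field; rewrite gt_eqF.
  have v0 : 0 <= (e + h * (n%:R + 2^-1)) / c.
    by rewrite divr_ge0 ?(ltW c0)// addr_ge0// mulr_ge0 ?(ltW h0)// addr_ge0.
  have vt : (e + h * (n%:R + 2^-1)) / c <= (e + h * n.+1%:R) / c.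
    rewrite ler_pM2r ?invr_gt0// lerD2l ler_pM2l//.
    by rewrite -[n.+1%:R]natr1; lra.
  have := gauss_J_step v0 vt (divr_gt0 h0 c0).
  by move: IHn; rewrite -/J; lra.
have sumE : \sum_(i < K) h * gauss1 sigma (e + h * (i%:R + 2^-1)) =
    (\sum_(i < K) h / c * gauss_fun ((e + h * (i%:R + 2^-1)) / c)) / Num.sqrt pi.
  rewrite mulr_suml; apply: eq_bigr => i _; rewrite gauss1_fun// -/c.
  by field; rewrite !gt_eqF.
rewrite sumE ler_pdivlMr//; apply: le_trans (step K).
have Jw : J (w / c) <= J ((e + h * K.+1%:R) / c).
  have : w / c <= (e + h * K.+1%:R) / c by rewrite ler_pM2r// invr_gt0.
  rewrite le_eqVlt => /predU1P[->//|].
  move=> /(gauss_J_MVT (ltW (divr_gt0 w0 c0)))[x _ E]; rewrite -subr_ge0.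
  rewrite /J E mulr_ge0 ?gauss_fun_ge0// subr_ge0 ler_pM2r// invr_gt0//.
have Je : J ((e + h) / c) <= (e + h) / c.
  by apply: gauss_J_le; rewrite divr_ge0 ?addr_ge0// ltW.
have Jt := gauss_J_tail (divr_gt0 w0 c0).
have -> : gauss_tail sigma w = gauss_fun (w / c) / (2 * (w / c)) / Num.sqrt pi.
  rewrite /gauss_tail gauss1_fun// -/c.
  rewrite (_ : sigma ^+ 2 = c ^+ 2 / 2); last first.
    by rewrite exprMn sqr_sqrtr//; field.
  by field; rewrite !gt_eqF.
rewrite (_ : Num.sqrt (2 * pi) * sigma = c * Num.sqrt pi); last first.
  by rewrite sqrtrM// /c; ring.
rewrite (_ : _ * Num.sqrt pi = Num.sqrt pi / 2 - (e + h) / c -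
    gauss_fun (w / c) / (2 * (w / c))); last by field; rewrite !gt_eqF.
rewrite -/J in Jt; lra.
Qed.

(** The cells between y + b and y + w start within one side h of y + b. *)
Lemma right_cells sigma o h y b w : 0 < sigma -> 0 < h -> 0 <= b -> 0 < w ->
  exists s : seq int, [/\ uniq s,
    forall k, k \in s -> y + b <= o + h * k%:~R /\ o + h * (k%:~R + 1) <= y + w &
    2^-1 - (b + 2 * h) / (Num.sqrt (2 * pi) * sigma) - gauss_tail sigma w <=
    \sum_(k <- s) h * gauss1 sigma (y - (o + h * (k%:~R + 2^-1)))].
Proof.
move=> s0 h0 b0 w0.
pose k0 := Num.ceil ((y + b - o) / h); pose e := o + h * k0%:~R - y.
have /andP[k1 k2] := ceil_itv ((y + b - o) / h).
have be : b <= e by move: k2; rewrite -/k0 ler_pdivrMr// /e; lra.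
have eb : e < b + h.
  by move: k1; rewrite -/k0 ltr_pdivlMr// /e intrB; lra.
have e0 : 0 <= e by exact: le_trans be.
have [K [K1 K2]] : exists K : nat, (K = 0 \/ e + h * K%:R <= w) /\ w <= e + h * K.+1%:R.
  have [we|ew] := ltP w e.
    by exists 0; split; [left|rewrite mulr1; lra].
  have we0 : 0 <= (w - e) / h by rewrite divr_ge0 ?subr_ge0// ltW.
  exists (Num.truncn ((w - e) / h)); have /andP[] := truncn_itv we0.
  by rewrite ler_pdivlMr// ltr_pdivrMr// => ? ?; split; [right|]; lra.
exists [seq k0 + i%:Z | i <- iota 0 K]; split.
- by rewrite map_inj_uniq ?iota_uniq// => i j /addrI[].
- move=> k /mapP[i]; rewrite mem_iota add0n => /andP[_ iK] ->.
  have -> : (k0 + i%:Z)%:~R = k0%:~R + i%:R :> R by rewrite intrD.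
  have i0 : 0 <= h * i%:R by rewrite mulr_ge0// ltW.
  split; first by move: be; rewrite /e; lra.
  case: K1 => [K0|]; first by rewrite K0 in iK.
  have : h * i.+1%:R <= h * K%:R by rewrite ler_pM2l// ler_nat.
  by rewrite -natr1 /e; lra.
rewrite big_map -[X in iota _ X](subn0 K) big_mkord.
have -> : \sum_(i < K) h * gauss1 sigma (y - (o + h * ((k0 + i%:Z)%:~R + 2^-1))) =
    \sum_(i < K) h * gauss1 sigma (e + h * (i%:R + 2^-1)).
  apply: eq_bigr => i _; rewrite -gauss1N; congr (_ * gauss1 _ _).
  by rewrite intrD /e /=; ring.
apply: le_trans (one_sided_sum s0 h0 e0 w0 K2).
rewrite lerD2r lerD2l lerN2 ler_pM2r; first by lra.
by rewrite invr_gt0 mulr_gt0// sqrt2pi_gt0.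
Qed.

(** The reflection of the cells on the right. *)
Lemma left_cells sigma o h y b w : 0 < sigma -> 0 < h -> 0 <= b -> 0 < w ->
  exists s : seq int, [/\ uniq s,
    forall k, k \in s -> y - w <= o + h * k%:~R /\ o + h * (k%:~R + 1) <= y - b &
    2^-1 - (b + 2 * h) / (Num.sqrt (2 * pi) * sigma) - gauss_tail sigma w <=
    \sum_(k <- s) h * gauss1 sigma (y - (o + h * (k%:~R + 2^-1)))].
Proof.
move=> s0 h0 b0 w0.
have [s [us sP sS]] := right_cells (- o) (- y) s0 h0 b0 w0.
exists [seq - k - 1 | k <- s]; split.
- by rewrite map_inj_uniq// => i j /addIr/oppr_inj.
- move=> k /mapP[k' /sP[H1 H2] ->].
  by rewrite intrB intrN; split; lra.
apply: le_trans sS _; rewrite big_map le_eqVlt; apply/orP; left; apply/eqP.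
apply: eq_bigr => k _; rewrite -gauss1N; congr (_ * gauss1 _ _).
by rewrite intrB intrN; field.
Qed.

Lemma two_sided_cells sigma o h y w : 0 < sigma -> 0 < h -> 0 < w ->
  exists s : seq int, [/\ uniq s,
    forall k, k \in s -> y - w <= o + h * k%:~R /\ o + h * (k%:~R + 1) <= y + w &
    1 - 4 * h / (Num.sqrt (2 * pi) * sigma) - 2 * gauss_tail sigma w <=
    \sum_(k <- s) h * gauss1 sigma (y - (o + h * (k%:~R + 2^-1)))].
Proof.
move=> s0 h0 w0.
have [s [us sP sS]] := right_cells o y s0 h0 (lexx 0) w0.
have [t [ut tP tS]] := left_cells o y s0 h0 (lexx 0) w0.
exists (s ++ t); split.
- rewrite cat_uniq us ut andbT; apply/hasPn => k /tP[_ k1].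
  by apply/negP => /sP[k2 _]; lra.
- move=> k; rewrite mem_cat => /orP[/sP[]|/tP[]] => ? ?.
    by split=> //; lra.
  by split=> //; lra.
rewrite big_cat/=; apply: le_trans (lerD sS tS).
by rewrite add0r le_eqVlt; apply/orP; left; apply/eqP; field;
   rewrite !gt_eqF// sqrt2pi_gt0.
Qed.

End grid_sum.

(** * Lower bounds for the mixture over the cells of Y *)

Section grid_product.
Context (R : realType) (d : nat).
Implicit Types (y mu : 'rV[R]_d) (sigma : R).

Lemma phi_prod y mu sigma : 0 < sigma ->
  phi y mu sigma = \prod_(a < d) gauss1 sigma (y ord0 a - mu ord0 a).
Proof.
move=> s0; rewrite /gauss1 big_split/= -expR_sum; congr (expR _ * _).
  rewrite /dotrV mulr_suml -sumrN; apply: eq_bigr => a _.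
  by rewrite !mxE expr2.
rewrite prodr_const card_ord exprVn; congr (_^-1).
rewrite [d%:R / 2]mulrC powRrM powR_mulrn ?powR_ge0//; congr (_ ^+ _).
have p0 : 0 <= 2 * pi :> R by rewrite mulr_ge0 ?pi_ge0.
rewrite powR12_sqrt; last by rewrite mulr_ge0 ?sqr_ge0.
by rewrite sqrtrM// sqrtr_sqr gtr0_norm.
Qed.

Lemma phi_ge0 y mu sigma : 0 <= phi y mu sigma.
Proof. by rewrite divr_ge0 ?expR_ge0// powR_ge0. Qed.

(** Distributing the product of sums enumerates the cells whose index lies in
    the product of the lists s a. *)
Lemma prod_sum_cells m (s : 'I_d -> seq int) (x : 'I_m -> 'rV[int]_d)
    (G : 'I_d -> int -> R) :
  (forall a, uniq (s a)) -> (forall a v, 0 <= G a v) ->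
  (forall k : 'rV[int]_d, (forall a, k ord0 a \in s a) -> exists j, x j = k) ->
  \prod_(a < d) \sum_(v <- s a) G a v <=
  \sum_(j < m | [forall a, x j ord0 a \in s a]) \prod_(a < d) G a (x j ord0 a).
Proof.
move=> us G0 sx.
pose n := \max_(a < d) size (s a).
have sn a : (size (s a) <= n.+1)%N by exact: leqW (leq_bigmax _).
pose H a (i : 'I_n.+1) := G a (nth 0 (s a) i).
pose Q a (i : 'I_n.+1) := (i < size (s a))%N.
have E a : \sum_(v <- s a) G a v = \sum_(i < n.+1 | Q a i) H a i.
  by rewrite /Q (big_ord_narrow (sn a)) (big_nth 0) big_mkord.
rewrite (eq_bigr _ (fun a _ => E a)) bigA_distr_big_dep.
pose k (p : {ffun 'I_d -> 'I_n.+1}) : 'rV[int]_d := \row_a nth 0 (s a) (p a).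
pose u (j : 'I_m) := [ffun a => inord (index (x j ord0 a) (s a)) : 'I_n.+1].
rewrite [leRHS](partition_big u predT)//=.
rewrite [leRHS](bigID [in family Q])/= ler_wpDr//.
  by apply: sumr_ge0 => p _; apply: sumr_ge0 => j _; exact: prodr_ge0.
apply: ler_sum => p pQ.
have pQa a : (p a < size (s a))%N by move/familyP : pQ => /(_ a).
have [j jk] : exists j, x j = k p by apply: sx => a; rewrite mxE mem_nth.
rewrite (bigD1 j) /=; last first.
  apply/andP; split; first by apply/forallP => a; rewrite jk mxE mem_nth.
  apply/eqP/ffunP => a; apply/val_inj.
  by rewrite ffunE jk mxE index_uniq//= inordK// ltnS ltnW// (leq_trans (pQa a)).
have -> : \prod_(a < d) G a (x j ord0 a) = \prod_(a < d) H a (p a).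
  by apply: eq_bigr => a _; rewrite jk mxE.
rewrite lerDl.
by apply: sumr_ge0 => i _; exact: prodr_ge0.
Qed.

End grid_product.

Section cell_probability.
Context (R : realType) (d dx : nat).
Variables (F : probability ('rV[R]_d * 'rV[R]_dx)%type R)
  (nu : {measure set 'rV[R]_dx -> \bar R})
  (f : 'rV[R]_d * 'rV[R]_dx -> R) (g : 'rV[R]_dx -> R).
Hypothesis Fdens : has_densities F nu f g.
Local Notation YX := ([set: 'rV[R]_d] `*` @ucube R dx).

Let f0 y x : ucube x -> 0 <= f (y, x).
Proof. by move=> xX; have [[_ H] _ _ _] := Fdens; exact: H. Qed.

Let f1 x : ucube x -> (\int[leb R d]_y (f (y, x))%:E = 1)%E.
Proof. by have [_ H _ _] := Fdens; exact: H. Qed.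

Lemma cprob_ge0 (A : set 'rV[R]_d) x : ucube x -> 0 <= cprob f A x.
Proof. by move=> xX; apply/fine_ge0/integral_ge0 => y _; rewrite lee_fin f0. Qed.

Lemma cprob_box (A : set 'rV[R]_d) x (a b : 'rV[R]_d) c : ucube x -> 0 <= c ->
  (forall i, a ord0 i <= b ord0 i) ->
  (forall z : 'rV[R]_d, (forall i, z ord0 i \in `[a ord0 i, b ord0 i[) -> A z /\ c <= f (z, x)) ->
  c * \prod_(i < d) (b ord0 i - a ord0 i) <= cprob f A x.
Proof.
move=> xX c0 ab AB.
have A1 : (\int[leb R d]_(y in A) (f (y, x))%:E <= 1)%E.
  rewrite -(f1 xX) integral_mkcond; apply: le_integral_upper => y _.
    by rewrite lee_fin f0.
  by rewrite patchE; case: ifPn => // _; rewrite lee_fin f0.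
have A0 : (0 <= \int[leb R d]_(y in A) (f (y, x))%:E)%E.
  by apply: integral_ge0 => y _; rewrite lee_fin f0.
have fin : (\int[leb R d]_(y in A) (f (y, x))%:E)%E \is a fin_num.
  by rewrite ge0_fin_numE// (le_lt_trans A1)// ltry.
rewrite -lee_fin /cprob (fineK fin) EFinM -leb_box//.
pose B : set 'rV[R]_d := [set v | forall i, v ord0 i \in `[a ord0 i, b ord0 i[].
have mB : measurable B by exact: measurable_box.
rewrite -/B -(integral_cst _ mB) integral_mkcond [leRHS]integral_mkcond.
apply: le_integral_upper => y _; rewrite !patchE.
  by case: ifPn => // _; rewrite lee_fin f0.
case: ifPn => [/set_mem /AB[Ay cf]|_]; first by rewrite mem_set.
by case: ifPn => // _; rewrite lee_fin f0.
Qed.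

(** The mixture over the cells of Y that serves as conditional density when x
    falls on the center t of a cell of X. *)
Definition component m (P : ypartition R d m) (sigma sigma0 : R)
    (y : 'rV[R]_d) (t : 'rV[R]_dx) : R :=
  \sum_(j < m) cprob f (ycell P j) t * phi y (ycenter P j) sigma +
  cprob f (yrest P) t * phi y 0 sigma0.

Lemma component_ge0 m (P : ypartition R d m) sigma sigma0 y t : ucube t ->
  0 <= component P sigma sigma0 y t.
Proof.
move=> tX; apply: addr_ge0.
  by apply: sumr_ge0 => j _; apply: mulr_ge0; [exact: cprob_ge0|exact: phi_ge0].
by apply: mulr_ge0; [exact: cprob_ge0|exact: phi_ge0].
Qed.

(** The probability of a cell is at least c times its volume, and the normal
    density factors over the coordinates, so that the sum over a product of lists
    of cells is c times a product of one-dimensional Riemann sums. *)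
Lemma component_cells m (P : ypartition R d m) sigma sigma0 (y : 'rV[R]_d) t c
    (s : 'I_d -> seq int) (l : 'I_d -> R) :
  0 < sigma -> ucube t -> 0 <= c -> (forall a, uniq (s a)) ->
  (forall k : 'rV[int]_d, (forall a, k ord0 a \in s a) -> exists j, yindex P j = k) ->
  (forall z : 'rV[R]_d, (forall a, exists2 k, k \in s a &
     yorigin P ord0 a + yside P * k%:~R <= z ord0 a <=
     yorigin P ord0 a + yside P * (k%:~R + 1)) -> c <= f (z, t)) ->
  (forall a, 0 <= l a <= \sum_(k <- s a) yside P *
     gauss1 sigma (y ord0 a - (yorigin P ord0 a + yside P * (k%:~R + 2^-1)))) ->
  c * \prod_(a < d) l a <= component P sigma sigma0 y t.
Proof.
move=> s0 tX c0 us sP cf sl; have h0 := yside_gt0 P.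
apply: ler_wpDr; first by apply: mulr_ge0; [exact: cprob_ge0|exact: phi_ge0].
set G := fun a (k : int) => yside P *
  gauss1 sigma (y ord0 a - (yorigin P ord0 a + yside P * (k%:~R + 2^-1))).
apply: (@le_trans _ _ (c * \prod_(a < d) \sum_(k <- s a) G a k)).
  by rewrite ler_wpM2l//; apply: ler_prod => a _; exact: sl.
have G0 a k : 0 <= G a k by rewrite mulr_ge0 ?gauss1_ge0// ltW.
apply: le_trans (ler_wpM2l c0 (prod_sum_cells us G0 sP)) _.
rewrite [leRHS](bigID (fun j => [forall a, yindex P j ord0 a \in s a]))/= ler_wpDr//.
  by apply: sumr_ge0 => j _; apply: mulr_ge0; [exact: cprob_ge0|exact: phi_ge0].
rewrite mulr_sumr; apply: ler_sum => j /forallP js.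
rewrite big_split/= mulrA phi_prod//.
have -> : \prod_(a < d) gauss1 sigma (y ord0 a - ycenter P j ord0 a) =
    \prod_(a < d) gauss1 sigma (y ord0 a -
      (yorigin P ord0 a + yside P * ((yindex P j ord0 a)%:~R + 2^-1))).
  by apply: eq_bigr => a _; rewrite mxE.
rewrite ler_wpM2r//; first by apply: prodr_ge0 => a _; exact: gauss1_ge0.
pose lo : 'rV[R]_d := \row_a (yorigin P ord0 a + yside P * (yindex P j ord0 a)%:~R).
pose hi : 'rV[R]_d := \row_a (yorigin P ord0 a + yside P * ((yindex P j ord0 a)%:~R + 1)).
have -> : \prod_(a < d) yside P = \prod_(a < d) (hi ord0 a - lo ord0 a).
  by apply: eq_bigr => a _; rewrite !mxE; ring.
apply: cprob_box => // [a|z zj]; first by rewrite !mxE lerD2l ler_pM2l// lerDl.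
split; first by move=> a; have := zj a; rewrite !mxE.
apply: cf => a; exists (yindex P j ord0 a); first exact: js.
by have := zj a; rewrite !mxE in_itv/= => /andP[-> /ltW ->].
Qed.

Lemma component_rest m (P : ypartition R d m) sigma sigma0 y t c rho
    (a b : 'rV[R]_d) : ucube t -> 0 <= c -> 0 <= rho ->
  (forall i, b ord0 i - a ord0 i = rho) ->
  (forall z : 'rV[R]_d, (forall i, z ord0 i \in `[a ord0 i, b ord0 i[) ->
     yrest P z /\ c <= f (z, t)) ->
  c * (rho ^+ d * phi y 0 sigma0) <= component P sigma sigma0 y t.
Proof.
move=> tX c0 rho0 ab H; apply: ler_wpDl.
  by apply: sumr_ge0 => j _; apply: mulr_ge0; [exact: cprob_ge0|exact: phi_ge0].
rewrite mulrA ler_wpM2r ?phi_ge0//.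
have <- : \prod_(i < d) (b ord0 i - a ord0 i) = rho ^+ d.
  by rewrite (eq_bigr (fun=> rho))// prodr_const card_ord.
by apply: cprob_box => // i; rewrite -subr_ge0 ab.
Qed.

End cell_probability.

Section local_bounds.
Context (R : realType) (d dx : nat).
Variables (F : probability ('rV[R]_d * 'rV[R]_dx)%type R)
  (nu : {measure set 'rV[R]_dx -> \bar R})
  (f : 'rV[R]_d * 'rV[R]_dx -> R) (g : 'rV[R]_dx -> R).
Local Notation YX := ([set: 'rV[R]_d] `*` @ucube R dx).
Hypothesis Fdens : has_densities F nu f g.
Hypothesis f_gt0 : forall p, YX p -> 0 < f p.
Hypothesis fC1 : cont_differentiable f.
Implicit Types (p q : 'rV[R]_d * 'rV[R]_dx) (y z : 'rV[R]_d) (x t : 'rV[R]_dx).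

Lemma density_segment p q (M D : R) : YX p -> YX q ->
  (forall t : R, 0 <= t <= 1 -> gradn f (seg p q t) <= M) ->
  enorm (incr q p) <= D -> f p * expR (- (M * D)) <= f q.
Proof.
move=> YXp YXq GM pqD.
have M0 : 0 <= M.
  by apply: le_trans (GM 0 _); rewrite ?lexx ?ler01//; exact: enorm_ge0.
have lnd r : YX r -> exists u, is_grad (fun q => ln (f q)) r u.
  move=> YXr; have [u fu] := fC1.1 _ YXr.
  by exists ((f r)^-1 *: u); exact: is_grad_ln.
have := is_grad_segment lnd YXp YXq GM.
rewrite ler_norml => /andP[H _].
rewrite -[leRHS]lnK ?posrE ?f_gt0// -{1}[f p]lnK ?posrE ?f_gt0// -expRD ler_expR.
by have := ler_wpM2l M0 pqD; lra.
Qed.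

Lemma hypercube_seg (a t : R) (y z : 'rV[R]_d) : hypercube a y z -> 0 <= t <= 1 ->
  hypercube a y (y + t *: (z - y)).
Proof.
move=> yz /andP[t0 t1] k; rewrite !mxE addrAC subrr add0r normrM ger0_norm//.
by have := yz k; have := normr_ge0 (z ord0 k - y ord0 k); move: (`|_|) => x; nra.
Qed.

Lemma hypercube_enorm (a : R) (y z : 'rV[R]_d) : 0 <= a -> hypercube a y z ->
  enorm (z - y) <= a * (Num.sqrt d%:R / 2).
Proof.
move=> a0 yz; rewrite mulrCA; apply: enorm_le_coord => [|i].
  by rewrite divr_ge0.
by rewrite !mxE.
Qed.

Lemma density_near (a b kap S : R) y x z t : 0 <= a -> kap <= b ->
  ucube x -> ucube t -> hypercube a y z -> enorm (x - t) <= kap ->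
  (sup_dlog f a b (y, x) <= S%:E)%E ->
  f (y, x) * expR (- (S * (a * (Num.sqrt d%:R / 2) + kap))) <= f (z, t).
Proof.
move=> a0 kb xX tX yz xt Sf.
apply: density_segment => // [u u01|]; last first.
  apply: le_trans (enorm_incr _ _) _; apply: lerD; first exact: hypercube_enorm.
  by rewrite enormB.
rewrite -lee_fin; apply: le_trans Sf; apply: sup_dlog_ub => /=.
- exact: hypercube_seg.
- exact: (seg_YX (p := (y, x)) (q := (z, t)) _ _ u01).2.
have /andP[u0 u1] := u01.
rewrite opprD addrA subrr add0r enormN enormZ ger0_norm// enormB.
by apply: le_trans kb; apply: le_trans xt; rewrite ler_piMl ?enorm_ge0.
Qed.

(** Moving first in x and then in y separates the contributions of the two
    suprema: only the second one needs the large cube. *)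
Lemma density_far (a b r rho kap S S' : R) y x z t : 0 <= a -> 0 <= rho ->
  rho <= r -> kap <= b -> kap <= r ->
  ucube x -> ucube t -> hypercube rho y z -> enorm (x - t) <= kap ->
  (sup_dlog f a b (y, x) <= S%:E)%E -> (sup_dlog f r r (y, x) <= S'%:E)%E ->
  f (y, x) * expR (- (S * kap + S' * (rho * (Num.sqrt d%:R / 2)))) <= f (z, t).
Proof.
move=> a0 rho0 rhor kb kr xX tX yz xt Sf Sf'.
rewrite opprD expRD mulrA.
apply: (@le_trans _ _ (f (y, t) * expR (- (S' * (rho * (Num.sqrt d%:R / 2)))))).
  rewrite ler_wpM2r ?expR_ge0//.
  apply: density_segment => // [u u01|]; last first.
    by apply: le_trans (enorm_incr _ _) _; rewrite /= subrr enorm0 add0r enormB.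
  rewrite -lee_fin; apply: le_trans Sf; apply: sup_dlog_ub => /=.
  - by apply: hypercube_seg => // k; rewrite subrr normr0 divr_ge0.
  - exact: (seg_YX (p := (y, x)) (q := (y, t)) _ _ u01).2.
  have /andP[u0 u1] := u01.
  rewrite opprD addrA subrr add0r enormN enormZ ger0_norm// enormB.
  by apply: le_trans kb; apply: le_trans xt; rewrite ler_piMl ?enorm_ge0.
apply: density_segment => // [u u01|]; last first.
  apply: le_trans (enorm_incr _ _) _; rewrite /= subrr enorm0 addr0.
  exact: hypercube_enorm.
rewrite -lee_fin; apply: le_trans Sf'; apply: sup_dlog_ub => /=.
- by move=> k; apply: le_trans (hypercube_seg yz u01 k) _; lra.
- by rewrite subrr scaler0 addr0.
by rewrite subrr scaler0 addr0; exact: le_trans kr.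
Qed.

Section one_tuning.
Variables (m : nat) (T : tuning R d dx m) (sigma0 : R).
Local Notation P := (ypart T).
Local Notation h := (yside P).
Local Notation o := (yorigin P).
Local Notation del := (delta T).
Local Notation sig := (sigma T).

(** Relative errors, per coordinate, of the Riemann sums of the normal density
    over all the cells of C_delta(y), and over those in one orthant. *)
Definition err2 : R :=
  4 * h / (Num.sqrt (2 * pi) * sig) + 2 * gauss_tail sig (del / 2).
Definition err1 : R :=
  3 * h / (Num.sqrt (2 * pi) * sig) + gauss_tail sig (del / 2).

(** All the grid cells inside C_delta(y) belong to the partition, as this cube
    avoids A_0. *)
Lemma component_interior (b kap S : R) y x t : err2 <= 1 -> kap <= b ->
  ucube x -> ucube t -> enorm (x - t) <= kap ->
  (sup_dlog f del b (y, x) <= S%:E)%E ->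
  hypercube del y `&` yrest P = set0 ->
  f (y, x) * expR (- (S * (del * (Num.sqrt d%:R / 2) + kap))) * (1 - err2) ^+ d <=
  component f P sig sigma0 y t.
Proof.
move=> e1 kb xX tX xt Sf yP.
have h0 := yside_gt0 P; have s0 := sigma_gt0 T; have d0 := delta_gt0 T.
have d20 : 0 < del / 2 by rewrite divr_gt0.
have /choice[s sP] := fun a => two_sided_cells (o ord0 a) (y ord0 a) s0 h0 d20.
have cube (z : 'rV[R]_d) : (forall a, exists2 k, k \in s a & o ord0 a + h * k%:~R <=
    z ord0 a <= o ord0 a + h * (k%:~R + 1)) -> hypercube del y z.
  move=> zs a; have [k ks /andP[z1 z2]] := zs a.
  by have [_ /(_ k ks)[? ?] _] := sP a; rewrite ler_norml; apply/andP; split; lra.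
have <- : \prod_(a < d) (1 - err2) = (1 - err2) ^+ d by rewrite prodr_const card_ord.
apply: (component_cells Fdens sigma0 (s := s)) => //.
- by rewrite mulr_ge0 ?expR_ge0// ltW// f_gt0.
- by move=> a; have [] := sP a.
- move=> k ks; pose z : 'rV[R]_d := \row_a (o ord0 a + h * (k ord0 a)%:~R).
  have zk : k = grid_index o h z.
    apply/grid_cellP => // a; rewrite in_itv/= mxE lexx/= ltrD2l ltr_pM2l//.
    by rewrite ltrDl.
  have zC : hypercube del y z.
    apply: cube => a; exists (k ord0 a); first exact: ks.
    by rewrite mxE lexx/= lerD2l ler_pM2l// lerDl.
  apply: contrapT => kP; suff : set0 z by [].
  rewrite -yP; split=> //; apply/yrestP => j jz; apply: kP; exists j.
  by rewrite jz -zk.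
- move=> z /cube zC; apply: density_near xt Sf => //; exact: ltW.
- move=> a; rewrite subr_ge0 e1/=; have [_ _] := sP a; apply: le_trans.
  by rewrite /err2 opprD addrA.
Qed.

(** In each coordinate the block is wider than delta, so that on one of the two
    sides of y the cells between y and y +- delta / 2, or from within one side of
    y, belong to the block: half of the normal mass is kept. *)
Lemma component_block (lo hi : 'rV[int]_d) (b kap S : R) y x t :
  (forall k : 'rV[int]_d, (forall a, lo ord0 a <= k ord0 a < hi ord0 a) ->
     exists j, yindex P j = k) ->
  (forall a, del <= h * ((hi ord0 a)%:~R - (lo ord0 a)%:~R)) ->
  (forall a, o ord0 a + h * (lo ord0 a)%:~R - h <= y ord0 a <=
             o ord0 a + h * (hi ord0 a)%:~R + h) ->
  err1 <= 2^-1 -> kap <= b ->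
  ucube x -> ucube t -> enorm (x - t) <= kap ->
  (sup_dlog f del b (y, x) <= S%:E)%E ->
  f (y, x) * expR (- (S * (del * (Num.sqrt d%:R / 2) + kap))) * (2^-1 - err1) ^+ d <=
  component f P sig sigma0 y t.
Proof.
move=> full wide yB e1 kb xX tX xt Sf.
have h0 := yside_gt0 P; have s0 := sigma_gt0 T; have d0 := delta_gt0 T.
have d20 : 0 < del / 2 by rewrite divr_gt0.
have E : 2^-1 - err1 = 2^-1 - (h + 2 * h) / (Num.sqrt (2 * pi) * sig) -
    gauss_tail sig (del / 2).
  by rewrite /err1; set c := _ * sig; rewrite opprD addrA; congr (_ - _ / c - _); ring.
have /choice[s sP] : forall a, exists s : seq int, [/\ uniq s,
    forall k, k \in s -> [/\ y ord0 a - del / 2 <= o ord0 a + h * k%:~R,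
      o ord0 a + h * (k%:~R + 1) <= y ord0 a + del / 2,
      lo ord0 a <= k & k < hi ord0 a] &
    2^-1 - err1 <=
    \sum_(k <- s) h * gauss1 sig (y ord0 a - (o ord0 a + h * (k%:~R + 2^-1)))].
  move=> a; rewrite E; have /andP[y1 y2] := yB a; have w := wide a.
  have conv k : o ord0 a + h * (lo ord0 a)%:~R <= o ord0 a + h * k%:~R ->
      o ord0 a + h * (k%:~R + 1) <= o ord0 a + h * (hi ord0 a)%:~R ->
      lo ord0 a <= k /\ k < hi ord0 a.
    rewrite !lerD2l !ler_pM2l// ler_int => -> H; split=> //.
    by rewrite -lezD1 -(ler_int R) intrD.
  have [ym|ym] := leP (y ord0 a)
      (o ord0 a + h * ((hi ord0 a)%:~R + (lo ord0 a)%:~R) / 2).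
    have [s [us sP sS]] := right_cells (o ord0 a) (y ord0 a) s0 h0 (ltW h0) d20.
    exists s; split=> // k /sP[k1 k2].
    have [||k3 k4] := conv k; [lra|lra|].
    by split=> //; lra.
  have [s [us sP sS]] := left_cells (o ord0 a) (y ord0 a) s0 h0 (ltW h0) d20.
  exists s; split=> // k /sP[k1 k2].
  have [||k3 k4] := conv k; [lra|lra|].
  by split=> //; lra.
have cube (z : 'rV[R]_d) : (forall a, exists2 k, k \in s a & o ord0 a + h * k%:~R <=
    z ord0 a <= o ord0 a + h * (k%:~R + 1)) -> hypercube del y z.
  move=> zs a; have [k ks /andP[z1 z2]] := zs a.
  by have [_ /(_ k ks)[? ? _ _] _] := sP a; rewrite ler_norml; apply/andP; split; lra.
have <- : \prod_(a < d) (2^-1 - err1) = (2^-1 - err1) ^+ d.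
  by rewrite prodr_const card_ord.
apply: (component_cells Fdens sigma0 (s := s)) => //.
- by rewrite mulr_ge0 ?expR_ge0// ltW// f_gt0.
- by move=> a; have [] := sP a.
- move=> k ks; apply: full => a.
  by have [_ /(_ _ (ks a))[_ _ -> ->] _] := sP a.
- move=> z /cube zC; apply: density_near xt Sf => //; exact: ltW.
- by move=> a; rewrite subr_ge0 e1/=; have [] := sP a.
Qed.

(** Beyond the block and its incomplete layer in the direction of one coordinate,
    the cube of side rho / 2 that has y as a corner and points away from the block
    is contained in A_0. *)
Lemma component_outside (lo hi : 'rV[int]_d) (b r rho kap S S' : R) y x t a :
  (forall j a, lo ord0 a - 1 <= yindex P j ord0 a < hi ord0 a + 1) ->
  (y ord0 a < o ord0 a + h * (lo ord0 a)%:~R - h \/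
   o ord0 a + h * (hi ord0 a)%:~R + h < y ord0 a) ->
  0 < rho -> rho <= r -> kap <= b -> kap <= r ->
  ucube x -> ucube t -> enorm (x - t) <= kap ->
  (sup_dlog f del b (y, x) <= S%:E)%E -> (sup_dlog f r r (y, x) <= S'%:E)%E ->
  f (y, x) * expR (- (S * kap + S' * (rho * (Num.sqrt d%:R / 2)))) *
    ((rho / 2) ^+ d * phi y 0 sigma0) <= component f P sig sigma0 y t.
Proof.
move=> idx yout rho0 rhor kb kr xX tX xt Sf Sf'.
have h0 := yside_gt0 P; have d0 := delta_gt0 T.
have gi z : (z ord0 a < o ord0 a + h * (lo ord0 a)%:~R - h \/
    o ord0 a + h * (hi ord0 a)%:~R + h <= z ord0 a) -> yrest P z.
  move=> zout; apply/yrestP => j /esym/esym/(grid_cellP _ _ _ h0)/(_ a).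
  rewrite in_itv/= => /andP[z1 z2]; have /andP[j1 j2] := idx j a.
  have : (lo ord0 a)%:~R - 1 <= (yindex P j ord0 a)%:~R :> R.
    by rewrite -[1]/(1%:~R) -intrB ler_int.
  have : (yindex P j ord0 a)%:~R <= (hi ord0 a)%:~R :> R.
    by rewrite ler_int -ltzD1.
  move=> /(ler_wpM2l (ltW h0)) ? /(ler_wpM2l (ltW h0)) ?.
  by case: zout => ?; lra.
have zf z : hypercube rho y z ->
    f (y, x) * expR (- (S * kap + S' * (rho * (Num.sqrt d%:R / 2)))) <= f (z, t).
  by move=> yz; apply: density_far yz xt Sf Sf' => //; exact: ltW.
have c0 : 0 <= f (y, x) * expR (- (S * kap + S' * (rho * (Num.sqrt d%:R / 2)))).
  by rewrite mulr_ge0 ?expR_ge0// ltW// f_gt0.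
have r20 : 0 <= rho / 2 by rewrite divr_ge0// ltW.
case: yout => [ylo|yhi].
  apply: (component_rest Fdens sig sigma0 y (a := y - const_mx (rho / 2)) (b := y)) => //.
    by move=> i; rewrite !mxE; lra.
  move=> z yz; split.
    by apply: gi; left; have := yz a; rewrite in_itv/= !mxE => /andP[_ ?]; lra.
  apply: zf => i; have := yz i; rewrite in_itv/= !mxE => /andP[? ?].
  by rewrite ler_norml; apply/andP; split; lra.
apply: (component_rest Fdens sig sigma0 y (a := y) (b := y + const_mx (rho / 2))) => //.
  by move=> i; rewrite !mxE; lra.
move=> z yz; split.
  by apply: gi; right; have := yz a; rewrite in_itv/= !mxE => /andP[? _]; lra.
apply: zf => i; have := yz i; rewrite in_itv/= !mxE => /andP[? ?].
by rewrite ler_norml; apply/andP; split; lra.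
Qed.

End one_tuning.
End local_bounds.

(** * Cells of the covariate space and gates *)

Section covariate_cells.
Context (R : realType) (dx N : nat) (X : xpartition R dx N).
Local Notation l := (xside X).
Local Notation c := (xcenter X).
Implicit Types (x : 'rV[R]_dx) (i j k : 'I_N).

Lemma xcell_ucube i x : xcell l (c i) x -> ucube x.
Proof. by move=> xi; rewrite -(xcells_cover X); exists i. Qed.

Lemma xcenter_xcell i : xcell l (c i) (c i).
Proof. by have l0 := xside_gt0 X; move=> a; split; [lra|left; lra]. Qed.

Lemma xcenter_ucube i : ucube (c i).
Proof. exact/xcell_ucube/xcenter_xcell. Qed.

Lemma ucube_xcell x : ucube x -> exists i, xcell l (c i) x.
Proof. by rewrite -(xcells_cover X) => -[i _ xi]; exists i. Qed.

Lemma ncells_gt0 : (0 < N)%N.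
Proof.
have X0 : ucube (0 : 'rV[R]_dx) by move=> a; rewrite mxE in_itv/= lexx ler01.
by have [i _] := ucube_xcell X0; exact: leq_ltn_trans (ltn_ord i).
Qed.

Lemma xcell_dist i x : xcell l (c i) x -> enorm (x - c i) <= Num.sqrt dx%:R * (l / 2).
Proof.
have l0 := xside_gt0 X; move=> xi; apply: enorm_le_coord => [|a]; first by rewrite divr_ge0// ltW.
have [x1 x2] := xi a; rewrite !mxE ler_norml; apply/andP; split; first lra.
by case: x2 => [|[]]; lra.
Qed.

Lemma xcenter_separated i j :
  (forall a, `|c i ord0 a - c j ord0 a| < l) -> i = j.
Proof.
have l0 := xside_gt0 X; move=> ij; apply: (@xcells_disjoint _ _ _ X i j) => //.
exists (\row_a (Num.max (c i ord0 a) (c j ord0 a) - l / 2)).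
by split=> a; rewrite mxE; have := ij a; rewrite ltr_norml => /andP[? ?];
   case: (leP (c i ord0 a)) => ?; split; try left; lra.
Qed.

(** The cells without the faces on the upper boundary of the cube: boxes whose
    Lebesgue measure is known. *)
Definition half_open_cell i : set 'rV[R]_dx :=
  [set v | forall a, v ord0 a \in
    `[(c i - const_mx (l / 2)) ord0 a, (c i + const_mx (l / 2)) ord0 a[].

Lemma half_open_cellE i v : half_open_cell i v <->
  forall a, c i ord0 a - l / 2 <= v ord0 a < c i ord0 a + l / 2.
Proof. by split=> H a; have := H a; rewrite in_itv/= !mxE. Qed.

Lemma bigcup_half_open_cell : \bigcup_i half_open_cell i =
  [set v | forall a, v ord0 a \in
    `[(0 : 'rV[R]_dx) ord0 a, (const_mx 1 : 'rV[R]_dx) ord0 a[].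
Proof.
have l0 := xside_gt0 X.
apply/seteqP; split=> [v [i _ /half_open_cellE vi] a|v v01].
  have sub w : half_open_cell i w -> ucube w.
    move=> /half_open_cellE wi; apply: (@xcell_ucube i) => b.
    by have /andP[w1 w2] := wi b; split=> //; left.
  have va := vi a; rewrite in_itv/= !mxE.
  pose w : 'rV[R]_dx := \row_b
    (if b == a then (v ord0 b + c i ord0 b + l / 2) / 2 else v ord0 b).
  have /sub/(_ a) : half_open_cell i w.
    apply/half_open_cellE => b; rewrite mxE; have /andP[? ?] := vi b.
    by case: ifP => _; apply/andP; split; lra.
  have /sub/(_ a) : half_open_cell i v by apply/half_open_cellE.
  rewrite !in_itv/= mxE eqxx => /andP[? ?] /andP[? ?].
  by have /andP[? ?] := va; apply/andP; split; lra.
have vX : ucube v.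
  move=> a; have := v01 a; rewrite !in_itv/= !mxE => /andP[? ?].
  by apply/andP; split; lra.
have [i vi] := ucube_xcell vX; exists i => //; apply/half_open_cellE => a.
have := v01 a; rewrite in_itv/= !mxE => /andP[_ ?]; have [-> [//|[_ ?]]] := vi a.
lra.
Qed.

Lemma trivIset_half_open_cell : trivIset [set: 'I_N] half_open_cell.
Proof.
move=> i j _ _ [v [/half_open_cellE vi /half_open_cellE vj]].
by apply: (@xcells_disjoint _ _ _ X i j) => //; exists v; split=> a;
   [have /andP[] := vi a|have /andP[] := vj a] => ? ?; split=> //; left.
Qed.

(** The half-open cells are disjoint and fill the half-open unit cube. *)
Lemma ncells_side : N%:R * l ^+ dx = 1.
Proof.
have l0 := xside_gt0 X; apply: EFin_inj.
transitivity (leb R dx (\bigcup_i half_open_cell i)); last first.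
  rewrite bigcup_half_open_cell leb_box => [|a]; last by rewrite !mxE.
  by rewrite big1// => a _; rewrite !mxE subr0.
have -> : \bigcup_i half_open_cell i = \big[setU/set0]_(i < N) half_open_cell i.
  rewrite -bigcup_seq; congr (bigcup _ _); apply/seteqP; split=> // i _ /=.
  exact: mem_index_enum.
have mB i : leb R dx (half_open_cell i) = (l ^+ dx)%:E.
  rewrite /half_open_cell leb_box => [|a]; last by rewrite !mxE; lra.
  congr EFin; rewrite (eq_bigr (fun=> l)) ?prodr_const ?card_ord// => a _.
  by rewrite !mxE; lra.
rewrite measure_bigsetU_ord; last exact: trivIset_half_open_cell.
  rewrite (eq_bigr (fun=> (l ^+ dx)%:E)) => [|i _]; last exact: mB.
  by rewrite sumEFin sumr_const card_ord mulr_natl.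
by move=> i; exact: measurable_box.
Qed.

(** On a line, the cell just above that of the lower center separates the two
    centers. *)
Lemma xcenter_gap (a : 'I_dx) i j : (forall b, b = a) ->
  l < c i ord0 a - c j ord0 a -> 2 * l <= c i ord0 a - c j ord0 a.
Proof.
have l0 := xside_gt0 X; move=> da ij.
have sep (k k' : 'I_N) : c k ord0 a < c k' ord0 a -> l <= c k' ord0 a - c k ord0 a.
  move=> kk; rewrite leNgt; apply/negP => kk'.
  suff E : k = k' by rewrite E ltxx in kk.
  apply: xcenter_separated => b; rewrite (da b) ltr_norml; apply/andP; split; lra.
pose p : 'rV[R]_dx := const_mx (c j ord0 a + l / 2).
have := xcenter_ucube i a; rewrite in_itv/= => /andP[_ i1].
have := xcenter_ucube j a; rewrite in_itv/= => /andP[j0 _].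
have [k pk] : exists k, xcell l (c k) p.
  by apply: ucube_xcell => b; rewrite in_itv/= mxE; apply/andP; split; lra.
have := pk a; rewrite mxE => -[k1 k2].
have {}k2 : c j ord0 a < c k ord0 a by case: k2 => [|[]]; lra.
have ? := sep _ _ k2.
have ki : c k ord0 a < c i ord0 a by lra.
by have := sep _ _ ki; lra.
Qed.

Definition near_centers x (M : nat) : pred 'I_N :=
  fun i => [forall a, `|c i ord0 a - x ord0 a| <= M%:R * l].

(** Centers near a point are counted by the integer parts of their relative
    positions, which are distinct. *)
Lemma card_near_centers x (M : nat) :
  (#|near_centers x M| <= M.*2.+1 ^ dx)%N.
Proof.
have l0 := xside_gt0 X.
rewrite (_ : (M.*2.+1 ^ dx)%N = #|{: {ffun 'I_dx -> 'I_(M.*2.+1)}}|); last first.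
  by rewrite card_ffun !card_ord.
pose z i a := Num.floor ((c i ord0 a - x ord0 a) / l).
pose q i : {ffun 'I_dx -> 'I_(M.*2.+1)} := [ffun a => inord (absz (z i a + M%:Z)%R)].
rewrite -(@card_in_imset _ _ q) ?max_card// => i j.
have zb i' a : i' \in near_centers x M ->
    0 <= z i' a + M%:Z /\ z i' a + M%:Z < (M.*2.+1)%:Z.
  move=> /forallP/(_ a); rewrite ler_norml => /andP[m1 m2].
  have z1 : - M%:Z <= z i' a.
    by rewrite /z floor_ge_int_tmp mulrNz ler_pdivlMr//; rewrite -mulNr in m1.
  have z2 : z i' a <= M%:Z.
    rewrite -(ler_int R); apply: (le_trans (floor_le_tmp _)).
    by rewrite ler_pdivrMr.
  split; first by lia.
  by rewrite -addnn -addn1 !PoszD; lia.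
move=> iA jA /ffunP qij; apply: xcenter_separated => a.
have [i1 i2] := zb _ a iA; have [j1 j2] := zb _ a jA.
have zij : z i a = z j a.
  have /(congr1 val) := qij a; rewrite !ffunE /= !inordK; last 2 first.
  - by rewrite -ltz_nat gez0_abs.
  - by rewrite -ltz_nat gez0_abs.
  by move=> /(congr1 Posz); rewrite !gez0_abs// => /addIr.
have /andP[] := floor_itv ((c i ord0 a - x ord0 a) / l).
have /andP[] := floor_itv ((c j ord0 a - x ord0 a) / l).
rewrite -!/(z _ _) zij !intrD !ler_pdivlMr// !ltr_pdivrMr// => ? ? ? ?.
by rewrite ltr_norml; apply/andP; split; lra.
Qed.

End covariate_cells.

Section gates.
Context (R : realType) (d dx m : nat) (T : tuning R d dx m).
Hypothesis dx_gt0 : (0 < dx)%N.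
Local Notation X := (xpart T).
Local Notation l := (xside X).
Local Notation c := (xcenter X).
Local Notation N := (ncells T).
Local Notation s := (xdiag2 T).
Local Notation gR := (gateR T).
Implicit Types (x : 'rV[R]_dx) (i j k : 'I_(ncells T)).

Lemma xdiag2E : s = dx%:R * l ^+ 2.
Proof.
have l0 := xside_gt0 X; have dxn0 : dx%:R != 0 :> R by rewrite pnatr_eq0 -lt0n.
congr (_ * _); have NE := ncells_side X.
have -> : N%:R^-1 = l `^ dx%:R.
  rewrite powR_mulrn ?ltW//; have N0 : N%:R != 0 :> R by rewrite pnatr_eq0 -lt0n (ncells_gt0 X).
  by apply: (mulfI N0); rewrite NE divff.
rewrite -powRrM mulrCA divff// mulr1 powR_mulrn// ltW//.
Qed.

Lemma xdiag2_gt0 : 0 < s.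
Proof.
by rewrite xdiag2E mulr_gt0 ?ltr0n// exprn_gt0// xside_gt0.
Qed.

Lemma sqrt_xdiag2 : Num.sqrt s = Num.sqrt dx%:R * l.
Proof. by rewrite xdiag2E sqrtrM ?ler0n// sqrtr_sqr gtr0_norm// xside_gt0. Qed.

(** As s = dx N^(-2/dx), the quantity subtracted from one in the last term of the
    bound is N exp(- R s). *)
Lemma ncellsE (e : R) :
  dx%:R `^ (dx%:R / 2) * (e / s `^ (dx%:R / 2)) = N%:R * e.
Proof.
have l0 := xside_gt0 X; have NE := ncells_side X.
have ld : (l ^+ 2) `^ (dx%:R / 2) = l ^+ dx.
  rewrite -[l ^+ 2]powR_mulrn ?ltW// -powRrM mulrCA divff// mulr1.
  by rewrite powR_mulrn// ltW.
rewrite xdiag2E powRM ?ler0n ?sqr_ge0// ld.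
have p0 : dx%:R `^ (dx%:R / 2) != 0 :> R by rewrite gt_eqF// powR_gt0// ltr0n.
have l1 : l ^+ dx != 0 by rewrite gt_eqF// exprn_gt0.
rewrite -[RHS](mulfK l1) [N%:R * e * _]mulrAC NE; field.
by rewrite p0 l1.
Qed.

(** Completing the square multiplies all the exponentials by the same factor. *)
Lemma gateE i x : gate i x = expR (- (gR * enorm (x - c i) ^+ 2)) /
  \sum_(k < N) expR (- (gR * enorm (x - c k) ^+ 2)).
Proof.
have E k : expR (- (gR * (dotrV (c k) (c k) - 2 * dotrV (c k) x))) =
    expR (gR * dotrV x x) * expR (- (gR * enorm (x - c k) ^+ 2)).
  rewrite -expRD enorm_sqr dotrVBl !dotrVBr (dotrVC x (c k)); congr expR; ring.
rewrite /gate E (eq_bigr _ (fun k _ => E k)) -mulr_sumr invfM mulrACA divff ?mul1r//.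
by rewrite gt_eqF// expR_gt0.
Qed.

Lemma gate_denom_gt0 k x : 0 < \sum_(j < N) expR (- (gR * enorm (x - c j) ^+ 2)).
Proof.
rewrite (bigD1 k)//= ltr_pwDl ?expR_gt0//.
by apply: sumr_ge0 => i _; exact: expR_ge0.
Qed.

Lemma gate_ge0 i x : 0 <= gate i x.
Proof. by rewrite gateE divr_ge0 ?expR_ge0// sumr_ge0// => k _; exact: expR_ge0. Qed.

Lemma gate_sum1 x : \sum_(i < N) gate i x = 1.
Proof.
rewrite (eq_bigr _ (fun i _ => gateE i x)) -mulr_suml divff//.
by rewrite gt_eqF// (gate_denom_gt0 (Ordinal (ncells_gt0 X))).
Qed.

Lemma gate_le i k x :
  gate i x <= expR (- (gR * (enorm (x - c i) ^+ 2 - enorm (x - c k) ^+ 2))).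
Proof.
rewrite gateE ler_pdivrMr ?(gate_denom_gt0 k)//.
apply: (@le_trans _ _ (expR (- (gR * (enorm (x - c i) ^+ 2 - enorm (x - c k) ^+ 2))) *
    expR (- (gR * enorm (x - c k) ^+ 2)))).
  by rewrite -expRD le_eqVlt; apply/orP; left; apply/eqP; congr expR; ring.
rewrite ler_wpM2l ?expR_ge0// (bigD1 k)//= lerDl.
by apply: sumr_ge0 => j _; exact: expR_ge0.
Qed.

Definition gate_mass theta eta : Prop := forall x, ucube x ->
  1 - eta <= \sum_(i < N | enorm (x - c i) <= theta * Num.sqrt s) gate i x.

Lemma gate_massW theta eta eta' : eta <= eta' -> gate_mass theta eta ->
  gate_mass theta eta'.
Proof. by move=> ee H x /H; apply: le_trans; lra. Qed.

Lemma gate_massP theta eta : (forall x k, ucube x ->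
    enorm (x - c k) ^+ 2 <= s / 4 -> xcell l (c k) x ->
    \sum_(i < N | theta * Num.sqrt s < enorm (x - c i)) gate i x <= eta) ->
  gate_mass theta eta.
Proof.
move=> H x xX; have [k xk] := ucube_xcell X xX.
have {}H : enorm (x - c k) ^+ 2 <= s / 4 ->
    \sum_(i < N | theta * Num.sqrt s < enorm (x - c i)) gate i x <= eta.
  by move=> xk4; exact: H xk.
rewrite -(gate_sum1 x) (bigID (fun i => enorm (x - c i) <= theta * Num.sqrt s))/=.
rewrite lerBlDr lerD2l (eq_bigl (fun i => theta * Num.sqrt s < enorm (x - c i))).
  apply: H => //; have l0 := xside_gt0 X.
  have -> : s / 4 = (Num.sqrt dx%:R * (l / 2)) ^+ 2.
    by rewrite exprMn sqr_sqrtr ?ler0n// xdiag2E; field.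
  rewrite ler_pXn2r ?nnegrE ?enorm_ge0 ?mulr_ge0 ?sqrtr_ge0 ?divr_ge0 ?(ltW l0)//.
  exact: xcell_dist.
by move=> i; rewrite -ltNge.
Qed.

(** If x_k is the center of the cell of x and x_i a center farther than l from x,
    then |x - x_i|^2 - |x - x_k|^2 factors as (x_i - x_k) (x_i - x_k - 2 (x - x_k)),
    where |x - x_k| <= l / 2. Both factors are at least l in absolute value: the
    first because centers are separated by a side, the second because the gap is l
    or at least 2 l. *)
Lemma gate_mass_line : dx = 1%N -> gate_mass 1 (N%:R * expR (- (gR * s))).
Proof.
move=> dx1; have s0 := xdiag2_gt0; have r0 := gateR_gt0 T; have l0 := xside_gt0 X.
have a : 'I_dx by rewrite dx1; exact: ord0.
have da b : b = a.
  have all1 n : n = 1%N -> forall i j : 'I_n, i = j.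
    by move=> -> i j; rewrite (ord1 i) (ord1 j).
  exact: all1.
have dxR : dx%:R = 1 :> R by rewrite dx1.
have sl : Num.sqrt s = l by rewrite sqrt_xdiag2 dxR sqrtr1 mul1r.
have nE (u : 'rV[R]_dx) : enorm u = `|u ord0 a|.
  rewrite /enorm /dotrV (bigD1 a)//= big1 ?addr0 -?expr2 ?sqrtr_sqr// => b.
  by rewrite (da b) eqxx.
apply: gate_massP => x k xX _ xk; rewrite mul1r sl mulr_natl.
rewrite -[N in leRHS]card_ord -sumr_const.
apply: (@le_trans _ _ (\sum_(i < N | l < enorm (x - c i))
    expR (- (gR * s)))); last first.
  rewrite [leRHS](bigID (fun i => l < enorm (x - c i)))/= lerDl.
  by apply: sumr_ge0 => i _; exact: expR_ge0.
apply: ler_sum => i xi; apply: le_trans (gate_le i k x) _.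
rewrite ler_expR lerN2 ler_wpM2l ?(ltW r0)//.
have -> : s = l ^+ 2 by rewrite -sl sqr_sqrtr// ltW.
move: xi; rewrite !nE !real_normK ?num_real// !mxE.
have [k1 k2] := xk a.
have {}k2 : x ord0 a <= c k ord0 a + l / 2 by case: k2 => [/ltW|[->]].
have g1 := @xcenter_gap R dx N X a i k da.
have g2 := @xcenter_gap R dx N X a k i da.
have sep : i != k -> l <= `|c i ord0 a - c k ord0 a|.
  move=> ik; rewrite leNgt; apply: contra ik => ik; apply/eqP.
  by apply: (@xcenter_separated _ _ _ X) => b; rewrite (da b).
have [->|ik] := eqVneq i k.
  by rewrite ltr_normr => /orP[]; lra.
have {ik} := sep ik; move: g1 g2 k1 k2.
move: (x ord0 a) (c i ord0 a) (c k ord0 a) => v b e.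
move=> g1 g2 k1 k2; rewrite ler_normr ltr_normr.
have {}g1 : b - e <= l \/ 2 * l <= b - e by case: (ltP l (b - e)) => [/g1|]; [right|left].
have {}g2 : e - b <= l \/ 2 * l <= e - b by case: (ltP l (e - b)) => [/g2|]; [right|left].
have -> : (v - b) ^+ 2 - (v - e) ^+ 2 = (b - e) * ((b - e) - 2 * (v - e)) by ring.
rewrite expr2; move=> /orP[ik|ik] /orP[vb|vb].
- by apply: ler_pM; lra.
- by case: g1 => g1; apply: ler_pM; lra.
- by rewrite -[leRHS]mulrNN; case: g2 => g2; apply: ler_pM; lra.
- by rewrite -[leRHS]mulrNN; apply: ler_pM; lra.
Qed.

(** The center of the cell of x is at squared distance at most s / 4. A center
    beyond 9/10 of the diagonal has squared distance at least 81/100 s, hence an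
    excess of 14/25 s; one beyond squared distance 2 s has an excess of 7/4 s. Only
    the first kind can be close to x, and there are boundedly many of them. *)
Lemma gate_mass_local :
  gate_mass (9 / 10) ((dx.*2.*2.+1 ^ dx)%:R * expR (- (14 / 25 * (gR * s))) +
                      N%:R * expR (- (7 / 4 * (gR * s)))).
Proof.
have s0 := xdiag2_gt0; have r0 := gateR_gt0 T; have l0 := xside_gt0 X.
apply: gate_massP => x k xX xk _.
pose far := fun i => 2 * s < enorm (x - c i) ^+ 2.
rewrite (bigID far)/= addrC; apply: lerD.
  apply: (@le_trans _ _ (\sum_(i < N | near_centers X x dx.*2 i)
      expR (- (14 / 25 * (gR * s))))).
    apply: (@le_trans _ _ (\sum_(i < N | (9 / 10 * Num.sqrt s < enorm (x - c i)) && ~~ far i)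
        expR (- (14 / 25 * (gR * s))))).
      apply: ler_sum => i /andP[xi _]; apply: le_trans (gate_le i k x) _.
      rewrite ler_expR lerN2 mulrCA ler_wpM2l ?(ltW r0)//.
      have : 81 / 100 * s <= enorm (x - c i) ^+ 2.
        rewrite -[s]sqr_sqrtr ?(ltW s0)// (_ : 81 / 100 = (9 / 10) ^+ 2); last by field.
        by rewrite -exprMn ler_pXn2r ?nnegrE ?mulr_ge0 ?sqrtr_ge0 ?enorm_ge0// ltW.
      lra.
    rewrite big_mkcond [leRHS]big_mkcond/=; apply: ler_sum => i _.
    have [xi|_] := boolP (~~ far i); last by rewrite andbF; case: ifP => _ //; exact: expR_ge0.
    rewrite (_ : near_centers X x dx.*2 i = true).
      by case: ifP => _ //; exact: expR_ge0.
    apply/forallP => a; have := coord_enorm (x - c i) a; rewrite !mxE distrC.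
    move=> /le_trans; apply.
    rewrite -(@ler_pXn2r _ 2%N)// ?nnegrE ?enorm_ge0 ?mulr_ge0 ?(ltW l0)//.
    move: xi; rewrite /far -leNgt => /le_trans; apply.
    rewrite xdiag2E exprMn mulrA ler_wpM2r ?sqr_ge0// -natrM -natrX ler_nat.
    by rewrite -muln2 mulnC; nia.
  rewrite sumr_const -[leLHS]mulr_natl ler_wpM2r ?expR_ge0// ler_nat.
  exact: card_near_centers.
have -> : N%:R * expR (- (7 / 4 * (gR * s))) = \sum_(i < N) expR (- (7 / 4 * (gR * s))).
  by rewrite sumr_const card_ord -[RHS]mulr_natl.
apply: (@le_trans _ _ (\sum_(i < N | (9 / 10 * Num.sqrt s < enorm (x - c i)) && far i)
    expR (- (7 / 4 * (gR * s))))); last first.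
  rewrite [leRHS](bigID (fun i => (9 / 10 * Num.sqrt s < enorm (x - c i)) && far i))/= lerDl.
  by apply: sumr_ge0 => i _; exact: expR_ge0.
apply: ler_sum => i /andP[_ xi]; apply: le_trans (gate_le i k x) _.
rewrite ler_expR lerN2 mulrCA ler_wpM2l ?(ltW r0)//.
by rewrite /far in xi; lra.
Qed.

End gates.

(** * The pointwise bound *)

Section pointwise.
Context (R : realType) (d dx : nat).
Variables (F : probability ('rV[R]_d * 'rV[R]_dx)%type R)
  (nu : {measure set 'rV[R]_dx -> \bar R})
  (f : 'rV[R]_d * 'rV[R]_dx -> R) (g : 'rV[R]_dx -> R).
Local Notation YX := ([set: 'rV[R]_d] `*` @ucube R dx).
Hypothesis Fdens : has_densities F nu f g.
Hypothesis f_gt0 : forall p, YX p -> 0 < f p.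
Hypothesis fC1 : cont_differentiable f.
Variables (r sigma0 : R) (m : nat) (T : tuning R d dx m).
Hypotheses (r_gt0 : 0 < r) (sigma0_gt0 : 0 < sigma0).
Implicit Types (y : 'rV[R]_d) (x : 'rV[R]_dx).
Local Notation sq := (Num.sqrt (xdiag2 T)).

Lemma model3E y x : model3 f sigma0 T (y, x) = \sum_(i < ncells T)
  gate i x * component f (ypart T) (sigma T) sigma0 y (xcenter (xpart T) i).
Proof.
apply: eq_bigr => i _; rewrite mulrDr mulr_sumr; congr (_ + _).
  by apply: eq_bigr => j _; rewrite /alpha /= mulrAC mulrC mulrA.
by rewrite /alpha /= mulrAC mulrC mulrA.
Qed.

(** The centers within distance theta s^(1/2) carry the weight 1 - eta, and each
    of their components is at least f exp(- B) E. *)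
Lemma ln_ratio_le y x theta eta B E : ucube x -> 0 < E -> eta < 1 ->
  gate_mass T theta eta ->
  (forall i, enorm (x - xcenter (xpart T) i) <= theta * sq ->
     f (y, x) * expR (- B) * E <=
     component f (ypart T) (sigma T) sigma0 y (xcenter (xpart T) i)) ->
  ln (f (y, x) / model3 f sigma0 T (y, x)) <= B - ln E - ln (1 - eta).
Proof.
move=> xX E0 eta1 mass comp.
have f0 : 0 < f (y, x) by exact: f_gt0.
set c := f (y, x) * expR (- B) * E in comp.
have c0 : 0 < c by rewrite !mulr_gt0 ?expR_gt0.
have e0 : 0 < 1 - eta by rewrite subr_gt0.
have pc : (1 - eta) * c <= model3 f sigma0 T (y, x).
  rewrite model3E (bigID (fun i => enorm (x - xcenter (xpart T) i) <= theta * sq))/=.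
  apply: ler_wpDr.
    apply: sumr_ge0 => i _; apply: mulr_ge0; first exact: gate_ge0.
    exact/(component_ge0 Fdens)/xcenter_ucube.
  apply: le_trans (ler_wpM2r (ltW c0) (mass _ xX)) _.
  rewrite mulr_suml; apply: ler_sum => i xi.
  by rewrite ler_wpM2l ?gate_ge0// comp.
have p0 : 0 < model3 f sigma0 T (y, x) by apply: lt_le_trans pc; rewrite mulr_gt0.
rewrite ln_div ?posrE//.
have : ln ((1 - eta) * c) <= ln (model3 f sigma0 T (y, x)).
  by rewrite ler_ln ?posrE// mulr_gt0.
rewrite /c !lnM ?posrE ?mulr_gt0 ?expR_gt0// expRK; lra.
Qed.

(** The block of cells required of the partition, with edges longer than delta. *)
Definition full_block : Prop := exists lo hi : 'rV[int]_d,
  [/\ (forall k : 'rV[int]_d, (forall a, lo ord0 a <= k ord0 a < hi ord0 a) ->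
         exists j, yindex (ypart T) j = k),
      (forall j a, lo ord0 a - 1 <= yindex (ypart T) j ord0 a < hi ord0 a + 1) &
      (forall a, delta T <=
         yside (ypart T) * ((hi ord0 a)%:~R - (lo ord0 a)%:~R))].

(** What the tuning conditions are used for: these properties hold for all large
    m, and the pointwise bound needs nothing else about the tuning. *)
Definition admissible theta eta : Prop :=
  [/\ theta <= 1 /\ sq <= r, eta < 1 /\ gate_mass T theta eta,
      err2 T <= 3^-1, err1 T <= 2^-1 /\ 2^-1 ^+ d.+1 <= (2^-1 - err1 T) ^+ d &
      full_block].

(** For rho = r this is the bracket integrated over B_delta(A_0). A smaller rho is
    used for the rate. *)
Definition rest_cost rho y : R := dotrV y y / (2 * sigma0 ^+ 2) -
  ln ((rho / 2) ^+ d / (2 * pi * sigma0 ^+ 2) `^ (d%:R / 2)).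

Lemma rest_costE rho y : 0 < rho ->
  rest_cost rho y = - ln ((rho / 2) ^+ d * phi y 0 sigma0).
Proof.
move=> rho0; have r20 : 0 < (rho / 2) ^+ d by rewrite exprn_gt0// divr_gt0.
have c0 : 0 < (2 * pi * sigma0 ^+ 2) `^ (d%:R / 2).
  by rewrite powR_gt0// !mulr_gt0 ?pi_gt0 ?exprn_gt0.
have -> : (rho / 2) ^+ d * phi y 0 sigma0 =
    expR (- (dotrV y y / (2 * sigma0 ^+ 2))) *
    ((rho / 2) ^+ d / (2 * pi * sigma0 ^+ 2) `^ (d%:R / 2)).
  by rewrite /phi subr0 [LHS]mulrCA.
have q0 : 0 < (rho / 2) ^+ d / (2 * pi * sigma0 ^+ 2) `^ (d%:R / 2).
  by rewrite divr_gt0.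
by rewrite lnM ?posrE ?expR_gt0// expRK opprD opprK.
Qed.

Lemma err2_ge0 : 0 <= err2 T.
Proof.
have s0 := sigma_gt0 T; have h0 := yside_gt0 (ypart T); have d0 := delta_gt0 T.
apply: addr_ge0.
  by rewrite divr_ge0 ?mulr_ge0 ?sqrtr_ge0// ltW.
rewrite mulr_ge0// mulr_ge0 ?gauss1_ge0// divr_ge0 ?sqr_ge0//.
by rewrite divr_ge0// ltW.
Qed.

(** The three positions of y: C_delta(y) avoids A_0; y is within one side of the
    block; y is farther away. The radius rho in the last case is free, and the
    bound S' is assumed there only, since the supremum over the large cube may be
    infinite. *)
Lemma ln_ratio_cases theta eta y x (S S' rho : R) : admissible theta eta ->
  0 < rho -> rho <= r -> ucube x ->
  (sup_dlog f (delta T) sq (y, x) <= S%:E)%E ->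
  let A := S * (delta T * (Num.sqrt d%:R / 2) + theta * sq) - ln (1 - eta) in
  let L := ln (f (y, x) / model3 f sigma0 T (y, x)) in
  (L <= A + 3 / 2 * d%:R * err2 T) \/
  (near_rest T (y, x) /\
    (L <= A + d.+1%:R * ln 2 \/
     ((sup_dlog f r r (y, x) <= S'%:E)%E ->
      L <= A + S' * (rho * (Num.sqrt d%:R / 2)) + rest_cost rho y))).
Proof.
move=> [[th1 sr] [eta1 mass] e2 [e1 e1d] [lo [hi [full idx wide]]]] rho0 rhor xX Sf.
move=> A L; have d0 := delta_gt0 T.
have sq0 : 0 <= sq by exact: sqrtr_ge0.
have kb : theta * sq <= sq by rewrite ler_piMl.
have S0 : 0 <= S.
  by rewrite -lee_fin; apply: le_trans Sf; apply: sup_dlog_ge0 => //; exact: ltW.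
have [yP|/set0P yP] := eqVneq (hypercube (delta T) y `&` yrest (ypart T)) set0.
  left; have e20 : 0 < 1 - err2 T by lra.
  have : L <= S * (delta T * (Num.sqrt d%:R / 2) + theta * sq) -
      ln ((1 - err2 T) ^+ d) - ln (1 - eta).
    apply: ln_ratio_le mass _ => //; first exact: exprn_gt0.
    move=> i xi; apply: (component_interior Fdens f_gt0 fC1 _ _ kb) => //; first by lra.
    exact: xcenter_ucube.
  rewrite lnXn// -[ln _ *+ d]mulr_natl.
  have : - ln (1 - err2 T) <= 3 / 2 * err2 T.
    rewrite -lnV ?posrE//.
    have -> : (1 - err2 T)^-1 = 1 + err2 T / (1 - err2 T) by field; rewrite gt_eqF.
    apply: le_trans (le_ln1Dx _) _.
      by apply: (@lt_le_trans _ _ 0) => //; rewrite divr_ge0 ?err2_ge0// ltW.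
    by have := err2_ge0; rewrite ler_pdivrMr//; nra.
  by move=> /(ler_wpM2l (ler0n R d)); rewrite /A; lra.
right; split; first by split.
have [yin|] := pselect (forall a, yorigin (ypart T) ord0 a +
    yside (ypart T) * (lo ord0 a)%:~R - yside (ypart T) <= y ord0 a <=
    yorigin (ypart T) ord0 a + yside (ypart T) * (hi ord0 a)%:~R + yside (ypart T)).
  left.
  have : L <= S * (delta T * (Num.sqrt d%:R / 2) + theta * sq) -
      ln (2^-1 ^+ d.+1) - ln (1 - eta).
    apply: ln_ratio_le mass _ => // i xi.
    apply: le_trans (component_block Fdens f_gt0 fC1 sigma0 full wide yin e1 kb
      xX (xcenter_ucube _ i) xi Sf).
    by rewrite ler_wpM2l// mulr_ge0 ?expR_ge0// ltW// f_gt0.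
  by rewrite lnXn ?invr_gt0// lnV ?posrE// mulNrn opprK /A mulr_natl; lra.
move=> /existsNP[a /negP]; rewrite negb_and -!ltNge => /orP yout; right=> Sf'.
have : L <= S * (theta * sq) + S' * (rho * (Num.sqrt d%:R / 2)) -
    ln ((rho / 2) ^+ d * phi y 0 sigma0) - ln (1 - eta).
  apply: ln_ratio_le mass _ => // [|i xi].
    rewrite mulr_gt0 ?exprn_gt0 ?divr_gt0 ?expR_gt0// powR_gt0//.
    by rewrite !mulr_gt0 ?pi_gt0 ?exprn_gt0.
  apply: (component_outside Fdens f_gt0 fC1 sigma0 idx yout rho0 rhor kb) => //.
    exact: le_trans sr.
  exact: xcenter_ucube.
rewrite -rest_costE// /A; have : 0 <= S * (delta T * (Num.sqrt d%:R / 2)).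
  by rewrite mulr_ge0// mulr_ge0 ?divr_ge0 ?sqrtr_ge0// ltW.
lra.
Qed.

End pointwise.

(** * The mean gradient is positive *)

Section positive_gradient.
Context (R : realType) (d dx : nat).
Variables (F : probability ('rV[R]_d * 'rV[R]_dx)%type R)
  (nu : {measure set 'rV[R]_dx -> \bar R})
  (f : 'rV[R]_d * 'rV[R]_dx -> R) (g : 'rV[R]_dx -> R).
Local Notation YX := ([set: 'rV[R]_d] `*` @ucube R dx).
Hypothesis d_gt0 : (0 < d)%N.
Hypothesis Fdens : has_densities F nu f g.
Hypothesis f_gt0 : forall p, YX p -> 0 < f p.
Hypothesis fC1 : cont_differentiable f.

(** A density that is constant in y would have infinite mass. *)
Lemma gradn_nonzero x : ucube x -> exists y, 0 < gradn f (y, x).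
Proof.
move=> xX; apply: contrapT => /forallNP H.
have G0 y : gradn f (y, x) <= 0 by rewrite leNgt; apply/negP/H.
have fcst y : f (0, x) <= f (y, x).
  have := @density_segment R d dx f f_gt0 fC1 (0, x) (y, x) 0
    (enorm (incr (y, x) (0, x))) _ _ _ (lexx _).
  rewrite mul0r oppr0 expR0 mulr1; apply=> // t _.
  by rewrite /seg/= subrr scaler0 addr0; exact: G0.
have f0 : 0 < f (0, x) by exact: f_gt0.
(* A box of volume L^d >= L already has mass greater than one. *)
pose L := (f (0, x))^-1 + 1.
have L1 : 1 <= L by rewrite /L lerDr invr_ge0 ltW.
have L0 : 0 < L by exact: lt_le_trans L1.
have := cprob_box Fdens (A := setT) (a := 0) (b := const_mx L) (c := f (0, x)) xX (ltW f0).
rewrite /cprob; have [_ -> //= _ _] := Fdens => /(_ _ _)H1.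
have : f (0, x) * \prod_(i < d) ((const_mx L : 'rV[R]_d) ord0 i - (0 : 'rV[R]_d) ord0 i) <= 1.
  by apply: H1 => [i|z _]; [rewrite !mxE ltW|split].
rewrite (eq_bigr (fun=> L)) => [|i _]; last by rewrite !mxE subr0.
rewrite prodr_const card_ord => H2.
have : f (0, x) * L <= 1.
  apply: le_trans H2; rewrite ler_pM2l//.
  exact: ler_eXnr.
by rewrite /L mulrDr mulfV ?gt_eqF// mulr1; lra.
Qed.

Definition nonflat : set ('rV[R]_d * 'rV[R]_dx) := YX `&` [set p | 0 < gradn f p].

Lemma measurable_nonflat : measurable nonflat.
Proof.
have := within_continuous_measurable (gradn_continuous f_gt0 fC1) (@measurable_YX R d dx).
move=> /(_ `]0, +oo[%classic); rewrite (_ : [set` _] = [set t | 0 < t]).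
  by apply; rewrite -set_itvoy; exact: measurable_itv.
by apply/seteqP; split=> t /=; rewrite in_itv/= andbT.
Qed.

(** Both f and the gradient stay away from zero on a small box. *)
Lemma nonflat_section x : ucube x ->
  (0 < \int[leb R d]_(y in ysection nonflat x) (f (y, x))%:E)%E.
Proof.
move=> xX; have [y0 y0G] := gradn_nonzero xX.
have f0 : 0 < f (y0, x) by exact: f_gt0.
have [e1 e10 H1] := within_incr_dist (gradn_continuous f_gt0 fC1)
  (conj Logic.I xX : YX (y0, x)) y0G.
have f20 : 0 < f (y0, x) / 2 by rewrite divr_gt0.
have [e2 e20 H2] := within_incr_dist (is_grad_continuous fC1.1)
  (conj Logic.I xX : YX (y0, x)) f20.
pose e := Num.min e1 e2.
have e0 : 0 < e by rewrite lt_min e10.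
have ea : e <= e1 by rewrite ge_min lexx.
have eb : e <= e2 by rewrite ge_min lexx orbT.
pose w := e / (2 * (Num.sqrt d%:R + 1)).
have sd : 0 <= Num.sqrt d%:R :> R by exact: sqrtr_ge0.
have w0 : 0 < w by rewrite divr_gt0// mulr_gt0//; lra.
have box (z : 'rV[R]_d) : (forall i, z ord0 i \in `[y0 ord0 i, (y0 + const_mx w) ord0 i[) ->
    ysection nonflat x z /\ f (y0, x) / 2 <= f (z, x).
  move=> zb; have zn : enorm (incr (z, x) (y0, x)) < e.
    apply: le_lt_trans (enorm_incr _ _) _; rewrite /= subrr enorm0 addr0.
    apply: (@le_lt_trans _ _ (Num.sqrt d%:R * w)).
      apply: enorm_le_coord => [|i]; first exact: ltW.
      have := zb i; rewrite in_itv/= !mxE => /andP[? ?].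
      by rewrite ler_norml; apply/andP; split; lra.
    rewrite /w mulrA ltr_pdivrMr; last by rewrite mulr_gt0//; lra.
    rewrite mulrC ltr_pM2l//; lra.
  have YXz : YX (z, x) by [].
  have h1 := H1 _ YXz (lt_le_trans zn ea).
  have h2 := H2 _ YXz (lt_le_trans zn eb).
  have close (u v : R) : `|u - v| < u -> 0 < v.
    by rewrite ltr_norml => /andP[_ ?]; lra.
  have half (u v : R) : `|u - v| < u / 2 -> u / 2 <= v.
    by rewrite ltr_norml => /andP[_ ?]; lra.
  split; last exact: half h2.
  by rewrite /ysection/= inE; split; [exact: YXz|exact: close h1].
have := cprob_box Fdens (A := ysection nonflat x) (a := y0) (b := y0 + const_mx w)
  xX (ltW f20).
move=> /(_ _ box); rewrite (eq_bigr (fun=> w)) => [|i _]; last by rewrite !mxE; ring.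
rewrite prodr_const card_ord => H.
have {}H : 0 < cprob f (ysection nonflat x) x.
  apply: (@lt_le_trans _ _ (f (y0, x) / 2 * w ^+ d)).
    by rewrite mulr_gt0// exprn_gt0.
  by apply: H => i; rewrite !mxE lerDl ltW.
rewrite lt0e integral_ge0 ?andbT//; last by move=> y _; rewrite lee_fin ltW// f_gt0.
by apply: contraTneq H; rewrite /cprob => ->; rewrite ltxx.
Qed.

Lemma measurable_section_mass (A : set ('rV[R]_d * 'rV[R]_dx)) : measurable A ->
  A `<=` YX ->
  measurable_fun (@ucube R dx) (fun x => \int[leb R d]_(y in ysection A x) (f (y, x))%:E)%E.
Proof.
move=> mA AYX; apply: measurable_funTS.
pose k := (EFin \o f) \_ A.
have mk : measurable_fun setT k.
  apply/(measurable_restrictT _ mA); apply/measurable_EFinP.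
  have [[mf _] _ _ _] := Fdens.
  exact: (measurable_funS (@measurable_YX R d dx) AYX mf).
have k0 p : (0 <= k p)%E.
  by rewrite /k patchE; case: ifPn => // /set_mem/AYX/f_gt0; rewrite lee_fin => /ltW.
have := measurable_fun_fubini_tonelli_G (m1 := leb R d) k mk k0.
congr measurable_fun; apply/funext => x; rewrite /fubini_G/=.
rewrite [RHS]integral_mkcond; apply: eq_integral => y _.
rewrite /k !patchE; have [yA|yA] := boolP ((y, x) \in A).
  by rewrite mem_set//; rewrite /ysection/= .
by rewrite memNset// /ysection/=; apply/negP.
Qed.

(** If the integral vanished, F would not charge the set where the gradient is
    nonzero; as each of its sections has positive conditional mass, the density of
    x would vanish almost everywhere, and F would be zero. *)
Lemma integral_gradn_gt0 : (0 < \int[F]_(p in YX) (gradn f p)%:E)%E.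
Proof.
have mg : measurable_fun YX (EFin \o gradn f).
  apply/measurable_EFinP; apply: within_continuous_measurable.
  exact: gradn_continuous.
have g0 p : YX p -> (0 <= (gradn f p)%:E)%E.
  by move=> _; rewrite lee_fin; exact: enorm_ge0.
rewrite lt0e integral_ge0 ?andbT//; apply/negP => /eqP E.
have mN := measurable_nonflat.
have F0 : F nonflat = 0%E.
  have : ae_eq F YX (EFin \o gradn f) (cst 0%E).
    apply/(ae_eq_integral_abs F (@measurable_YX R d dx) mg).
    by rewrite -[RHS]E; apply: eq_integral => p /set_mem/g0 ?; rewrite gee0_abs.
  move=> [B [mB FB sB]]; apply/eqP; rewrite -measure_le0 -FB.
  apply: le_measure; rewrite ?inE// => p [YXp /= pG]; apply: sB => /=.
  by move=> /(_ YXp) [pG0]; rewrite pG0 ltxx in pG.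
have [_ f1 [mg1 g10] FA] := Fdens.
have := F0; rewrite (FA _ mN) => I0.
have mJ : measurable_fun (@ucube R dx) (fun x => (g x)%:E *
    \int[leb R d]_(y in ysection nonflat x) (f (y, x))%:E)%E.
  apply: emeasurable_funM; first exact/measurable_EFinP.
  by apply: measurable_section_mass => // p [].
have [B [mB nB sB]] : ae_eq nu (@ucube R dx) (fun x => (g x)%:E *
    \int[leb R d]_(y in ysection nonflat x) (f (y, x))%:E)%E (cst 0%E).
  apply/(ae_eq_integral_abs nu (@measurable_ucube R dx) mJ).
  rewrite -[RHS]I0; apply: eq_integral => x /set_mem xX; rewrite gee0_abs//.
  by rewrite mule_ge0 ?lee_fin ?g10// ltW// nonflat_section.
have : F setT = 0%E.
  rewrite (FA _ measurableT); transitivity (\int[nu]_(x in @ucube R dx) (g x)%:E)%E.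
    apply: eq_integral => x /set_mem xX.
    have -> : ysection [set: 'rV[R]_d * 'rV[R]_dx] x = setT.
      by apply/seteqP; split=> // y _; rewrite /ysection/= inE.
    by rewrite f1// mule1.
  rewrite -(integral0 nu (@ucube R dx)).
  apply: ae_eq_integral => //; [exact: measurable_ucube|exact/measurable_EFinP|].
  exists B; split=> // x /= nx; apply: sB => /= H; apply: nx => xX.
  have /eqP := H xX; rewrite mule_eq0 => /orP[/eqP ->//|/eqP J0].
  by have := nonflat_section xX; rewrite J0 ltxx.
by rewrite probability_setT => /eqP; rewrite onee_eq0.
Qed.

End positive_gradient.

(** * Asymptotics of the tuning sequences *)

Section precision.
Context (R : realType) (d dx m : nat) (T : tuning R d dx m).
Hypothesis d_gt0 : (0 < d)%N.

Definition sum_term : R := 2 * (3 * d%:R `^ (3 / 2) * delta T ^+ d.-1 *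
  yside (ypart T) / ((2 * pi) `^ (d%:R / 2) * sigma T ^+ d)).

Definition tail_term : R := 2 * expR (- ((delta T / sigma T) ^+ 2 / 8)).

(** In dimension one 3/2 times the first term of err2 is sum_term; in dimension d
    sum_term has the additional factor (delta / (sigma sqrt(2 pi)))^(d-1), which
    is at least one for large m. The factor d in front of the tail is absorbed in
    the same way by the factor sigma / delta of the tail bound. *)
Lemma err2_bound : Num.sqrt (2 * pi) <= delta T / sigma T ->
  3 * d%:R <= Num.sqrt (2 * pi) * (delta T / sigma T) ->
  3 / 2 * d%:R * err2 T <= sum_term + tail_term.
Proof.
have s0 := sigma_gt0 T; have h0 := yside_gt0 (ypart T); have d0 := delta_gt0 T.
set c := Num.sqrt (2 * pi); have c0 : 0 < c by exact: sqrt2pi_gt0.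
have dn0 : 0 < d%:R :> R by rewrite ltr0n.
move=> cu du; rewrite mulrDr; apply: lerD.
  have -> : sum_term = 6 * d%:R `^ (3 / 2) * (delta T / sigma T / c) ^+ d.-1 *
      (yside (ypart T) / (c * sigma T)).
    have cE : (2 * pi) `^ (d%:R / 2) = c ^+ d.
      by rewrite [d%:R / 2]mulrC powRrM powR12_sqrt ?mulr_ge0 ?pi_ge0// powR_mulrn// ltW.
    rewrite /sum_term cE.
    rewrite -[X in c ^+ X](prednK d_gt0) -[X in sigma T ^+ X](prednK d_gt0).
    rewrite !exprS !expr_div_n; field.
    by rewrite !expf_neq0 ?gt_eqF.
  rewrite (_ : 3 / 2 * _ * _ = 6 * d%:R * (yside (ypart T) / (c * sigma T))); last first.
    by rewrite -/c; field; rewrite !gt_eqF.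
  rewrite ler_pM2r ?divr_gt0 ?mulr_gt0// -mulrA ler_pM2l//.
  rewrite -[leLHS]mulr1; apply: ler_pM => //.
    rewrite -[leLHS]powRr1// ler_powR ?ler1n//; lra.
  by rewrite exprn_ege1// ler_pdivlMr// mul1r.
rewrite /gauss_tail /gauss1 -/c /tail_term.
have -> : (delta T / 2) ^+ 2 / (2 * sigma T ^+ 2) = (delta T / sigma T) ^+ 2 / 8.
  by field; rewrite gt_eqF.
have e0 := expR_gt0 (- ((delta T / sigma T) ^+ 2 / 8)).
set e := expR _ in e0 *.
rewrite (_ : 3 / 2 * _ * _ = e * (6 * d%:R / (c * (delta T / sigma T)))); last first.
  by field; rewrite !gt_eqF.
have u0 : 0 < c * (delta T / sigma T) by rewrite mulr_gt0// divr_gt0.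
by rewrite [leRHS]mulrC ler_pM2l// ler_pdivrMr//; lra.
Qed.

Lemma err1_le_err2 : err1 T <= err2 T.
Proof.
have s0 := sigma_gt0 T; have h0 := yside_gt0 (ypart T); have d0 := delta_gt0 T.
have t0 : 0 <= gauss_tail (sigma T) (delta T / 2).
  rewrite mulr_ge0 ?gauss1_ge0// divr_ge0 ?sqr_ge0//; lra.
rewrite /err1 /err2; apply: lerD; last by lra.
by rewrite ler_pM2r ?invr_gt0 ?mulr_gt0 ?sqrt2pi_gt0//; lra.
Qed.

Lemma err1_ge0 : 0 <= err1 T.
Proof.
have s0 := sigma_gt0 T; have h0 := yside_gt0 (ypart T); have d0 := delta_gt0 T.
rewrite addr_ge0//.
  by rewrite divr_ge0 ?mulr_ge0 ?sqrtr_ge0// ltW.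
rewrite mulr_ge0 ?gauss1_ge0// divr_ge0 ?sqr_ge0//; lra.
Qed.

Lemma Bernoulli_pow (x : R) n : 0 <= x -> x <= 1 -> 1 - n%:R * x <= (1 - x) ^+ n.
Proof.
move=> x0 x1; elim: n => [|n IHn]; first by rewrite mul0r subr0.
rewrite exprS -natr1; have n0 : 0 <= n%:R :> R by [].
have := ler_wpM2l (_ : 0 <= 1 - x) IHn; rewrite subr_ge0 => /(_ x1).
apply: le_trans; rewrite -subr_ge0.
have -> : (1 - x) * (1 - n%:R * x) - (1 - (n%:R + 1) * x) = n%:R * x ^+ 2 by ring.
by rewrite mulr_ge0 ?sqr_ge0.
Qed.

Lemma err1_pow : d%:R * err1 T <= 6^-1 ->
  err1 T <= 2^-1 /\ 2^-1 ^+ d.+1 <= (2^-1 - err1 T) ^+ d.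
Proof.
move=> de; have e0 := err1_ge0.
have e1 : err1 T <= 6^-1.
  by apply: le_trans de; rewrite ler_peMl// ler1n.
split; first by lra.
have -> : 2^-1 - err1 T = 2^-1 * (1 - 2 * err1 T) by field.
rewrite exprMn exprSr ler_pM2l ?exprn_gt0//.
have e20 : 0 <= 2 * err1 T by lra.
have e21 : 2 * err1 T <= 1 by lra.
by apply: le_trans (Bernoulli_pow d e20 e21); rewrite mulrCA; lra.
Qed.

(** The cells that contain the points e_a and - e_a show that the block reaches
    from nearly -1 to nearly 1 in each coordinate, with a loss of one layer on both
    sides. *)
Lemma wide_block : yside (ypart T) <= 2^-1 -> delta T <= 1 ->
  (forall e : R, (e == 1) || (e == -1) ->
     hypercube (delta T) (const_mx e) `&` yrest (ypart T) = set0) ->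
  full_block T.
Proof.
move=> h2 d1 cover; have h0 := yside_gt0 (ypart T); have d0 := delta_gt0 T.
have [lo [hi [full idx]]] := yadjacent (ypart T).
exists lo, hi; split=> // a; set P := ypart T in h0 h2 full idx cover *.
have cell e : (e == 1) || (e == -1) -> exists j : 'I_m,
    yorigin P ord0 a + yside P * (yindex P j ord0 a)%:~R <= e /\
    e < yorigin P ord0 a + yside P * ((yindex P j ord0 a)%:~R + 1).
  move=> /cover ce; have : ~ yrest P (const_mx e).
    move=> eP; suff : set0 (const_mx e : 'rV[R]_d) by [].
    rewrite -ce; split=> // k; rewrite !mxE subrr normr0 divr_ge0// ltW//.
  move=> /contrapT[j _ /(_ a)]; rewrite mxE in_itv/= => /andP[? ?].
  by exists j.
have [|j [_ j1]] := cell 1; first by rewrite eqxx.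
have [|k [k1 _]] := cell (-1); first by rewrite eqxx orbT.
have /andP[_ ] := idx j a; rewrite ltzD1 -(ler_int R) => jh.
have /andP[+ _] := idx k a; rewrite -(ler_int R) intrB => kl.
have := ler_wpM2l (ltW h0) jh; have := ler_wpM2l (ltW h0) kl; lra.
Qed.

End precision.

Section eventually.
Context (R : realType) (d dx : nat) (T : forall m, tuning R d dx m).
Hypotheses (d_gt0 : (0 < d)%N) (dx_gt0 : (0 < dx)%N).
Hypothesis condT : tuning_conditions T.

Lemma near_small (u : nat -> R) (e : R) : u @ \oo --> 0 -> 0 < e ->
  \forall m \near \oo, `|u m| < e.
Proof.
move=> u0 e0; move/cvgrPdist_lt : u0 => /(_ _ e0).
by apply: filterS => m; rewrite sub0r normrN.
Qed.

Lemma near_ratio (K : R) : 0 < K -> \forall m \near \oo, K <= delta (T m) / sigma (T m).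
Proof.
move=> K0; have [_ [_ sd _] _] := condT.
have K'0 : 0 < K^-1 by rewrite invr_gt0.
apply: filterS (near_small sd K'0) => m.
have s0 := sigma_gt0 (T m); have d0 := delta_gt0 (T m).
rewrite gtr0_norm ?divr_gt0// => H.
rewrite -[K]invrK -[leRHS]invrK lef_pV2 ?posrE ?invr_gt0 ?divr_gt0// invf_div.
exact: ltW.
Qed.

Lemma cvg_sum_term : (fun m => sum_term (T m)) @ \oo --> 0.
Proof.
have [_ [_ _ hd] _] := condT.
have -> : (fun m => sum_term (T m)) = (fun m =>
    (2 * (3 * d%:R `^ (3 / 2)) / (2 * pi) `^ (d%:R / 2)) *
    (delta (T m) ^+ d.-1 * yside (ypart (T m)) / sigma (T m) ^+ d)).
  apply/funext => m; rewrite /sum_term invfM; ring.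
by rewrite -[X in _ --> X](mulr0 (2 * (3 * d%:R `^ (3 / 2)) / (2 * pi) `^ (d%:R / 2)));
  apply: cvgMr.
Qed.

Lemma cvg_tail_term : (fun m => tail_term (T m)) @ \oo --> 0.
Proof.
have [_ [_ sd _] _] := condT.
apply: (@squeeze_cvgr _ _ _ _ (cst 0) (fun m => 16 * (sigma (T m) / delta (T m)) ^+ 2)).
- near=> m; have s0 := sigma_gt0 (T m); have d0 := delta_gt0 (T m).
  rewrite mulr_ge0 ?expR_ge0//= /tail_term expRN.
  have u0 : 0 < (delta (T m) / sigma (T m)) ^+ 2 / 8.
    by rewrite divr_gt0// exprn_gt0// divr_gt0.
  have : (expR ((delta (T m) / sigma (T m)) ^+ 2 / 8))^-1 <=
      ((delta (T m) / sigma (T m)) ^+ 2 / 8)^-1.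
    rewrite lef_pV2 ?posrE ?expR_gt0//; apply: le_trans (expR_ge1Dx _); lra.
  rewrite (_ : (_ / 8)^-1 = 8 * (sigma (T m) / delta (T m)) ^+ 2); first by lra.
  by field; rewrite !gt_eqF.
- exact: cvg_cst.
rewrite -[X in _ --> X](_ : 16 * 0 ^+ 2 = 0); last by rewrite expr0n mulr0.
by apply: cvgMr; rewrite expr2; under eq_fun do rewrite expr2; apply: cvgM.
Unshelve. all: by end_near. Qed.

Lemma near_diag_le (e : R) : 0 < e -> \forall m \near \oo, Num.sqrt (xdiag2 (T m)) <= e.
Proof.
move=> e0; have [_ _ [_ sx _]] := condT.
apply: filterS (near_small sx (exprn_gt0 2 e0)) => m.
have x0 := xdiag2_gt0 (T m) dx_gt0.
rewrite gtr0_norm// => xe; rewrite -(@ler_pXn2r _ 2%N)// ?nnegrE ?sqrtr_ge0 ?(ltW e0)//.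
by rewrite sqr_sqrtr ltW.
Qed.

Lemma near_delta_le (e : R) : 0 < e -> \forall m \near \oo, delta (T m) <= e.
Proof.
move=> e0; have [_ [d0 _ _] _] := condT.
apply: filterS (near_small d0 e0) => m.
by rewrite gtr0_norm ?delta_gt0// => /ltW.
Qed.

Lemma near_block : \forall m \near \oo, full_block (T m).
Proof.
have [[h0 cover] _ _] := condT.
have half : 0 < 2^-1 :> R by rewrite invr_gt0.
near=> m; apply: wide_block => //.
- have : `|yside (ypart (T m))| < 2^-1 by near: m; exact: near_small.
  by rewrite gtr0_norm ?yside_gt0// => /ltW.
- by near: m; exact: near_delta_le.
- move=> e /orP[] /eqP ->.
    by near: m; exact: cover.
  by near: m; exact: cover.
Unshelve. all: by end_near. Qed.

Lemma near_precise : \forall m \near \oo,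
  [/\ err2 (T m) <= 3^-1,
      err1 (T m) <= 2^-1 /\ 2^-1 ^+ d.+1 <= (2^-1 - err1 (T m)) ^+ d &
      3 / 2 * d%:R * err2 (T m) <= sum_term (T m) + tail_term (T m)].
Proof.
have dn1 : 1 <= d%:R :> R by rewrite ler1n.
have c0 := sqrt2pi_gt0 R.
have e80 : 0 < 8^-1 :> R by rewrite invr_gt0.
near=> m.
have B : 3 / 2 * d%:R * err2 (T m) <= sum_term (T m) + tail_term (T m).
  apply: err2_bound => //.
    by near: m; exact: near_ratio.
  rewrite [leRHS]mulrC -ler_pdivrMr//; near: m; apply: near_ratio.
  by rewrite divr_gt0// mulr_gt0//; lra.
have t1 : sum_term (T m) <= 8^-1.
  apply: le_trans (ler_norm _) (ltW _); near: m; exact: (near_small cvg_sum_term).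
have t2 : tail_term (T m) <= 8^-1.
  apply: le_trans (ler_norm _) (ltW _); near: m; exact: (near_small cvg_tail_term).
have e2 := err2_ge0 (T m).
have de2 : d%:R * err2 (T m) <= 6^-1 by lra.
split=> //.
  have : err2 (T m) <= d%:R * err2 (T m) by rewrite ler_peMl.
  lra.
apply: err1_pow => //; apply: le_trans de2; rewrite ler_pM2l ?ltr0n//.
exact: err1_le_err2.
Unshelve. all: by end_near. Qed.

End eventually.

Section eventual_gates.
Context (R : realType) (d dx : nat) (T : forall m, tuning R d dx m).
Hypotheses (d_gt0 : (0 < d)%N) (dx_gt0 : (0 < dx)%N).
Hypothesis condT : tuning_conditions T.

Definition gate_term m (U : tuning R d dx m) : R :=
  - ln (1 - dx%:R `^ (dx%:R / 2) *
    (expR (- (gateR U * xdiag2 U)) / xdiag2 U `^ (dx%:R / 2))).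

Lemma gate_termE m (U : tuning R d dx m) :
  gate_term U = - ln (1 - (ncells U)%:R * expR (- (gateR U * xdiag2 U))).
Proof. by rewrite /gate_term ncellsE. Qed.

Lemma cvg_gate_defect :
  (fun m => (ncells (T m))%:R * expR (- (gateR (T m) * xdiag2 (T m)))) @ \oo --> 0.
Proof.
have [_ _ [_ _ gc]] := condT.
have -> : (fun m => (ncells (T m))%:R * expR (- (gateR (T m) * xdiag2 (T m)))) =
    (fun m => dx%:R `^ (dx%:R / 2) * (expR (- (gateR (T m) * xdiag2 (T m))) /
      xdiag2 (T m) `^ (dx%:R / 2))).
  by apply/funext => m; rewrite ncellsE.
rewrite -[X in _ --> X](mulr0 (dx%:R `^ (dx%:R / 2))).
exact: cvgMr.
Qed.

Lemma ln_defect_le (e : R) : 0 <= e -> e <= 2^-1 -> - ln (1 - e) <= 2 * e.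
Proof.
move=> e0 e2; have e1 : 0 < 1 - e by lra.
rewrite -lnV ?posrE//.
have -> : (1 - e)^-1 = 1 + e / (1 - e) by field; rewrite gt_eqF.
apply: le_trans (le_ln1Dx _) _.
  by apply: (@lt_le_trans _ _ 0) => //; rewrite divr_ge0// ltW.
rewrite ler_pdivrMr//; nra.
Qed.

Lemma ln_defect_ge0 (e : R) : 0 <= e -> e < 1 -> 0 <= - ln (1 - e).
Proof. by move=> e0 e1; rewrite oppr_ge0 ln_le0//; lra. Qed.

(** As N l^dx = 1, the inequality N exp(- R s) <= k^2 gives exp(- R s / 2) <= k l
    when dx >= 2; and 14/25 >= 1/2. So the weight of the far gates is negligible
    with respect to the diagonal of the cells. *)
Lemma gate_mass_small m (U : tuning R d dx m) (k : R) : (1 < dx)%N -> 0 < k ->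
  k <= 1 -> Num.sqrt (xdiag2 U) <= 1 ->
  (ncells U)%:R * expR (- (gateR U * xdiag2 U)) <= k ^+ 2 ->
  gate_mass U (9 / 10) (((dx.*2.*2.+1 ^ dx)%:R + 1) * k * Num.sqrt (xdiag2 U)).
Proof.
move=> dx1 k0 k1 s1 e2.
have s0 := xdiag2_gt0 U dx_gt0; have r0 := gateR_gt0 U.
have l0 := xside_gt0 (xpart U); have NE := ncells_side (xpart U).
set N : R := (ncells U)%:R in e2 NE *; set l := xside _ in l0 NE *.
set s := xdiag2 U in s0 s1 e2 *; set w := Num.sqrt s in s1 *.
have N0 : 0 < N by rewrite ltr0n (ncells_gt0 (xpart U)).
have N1 : 1 <= N by rewrite ler1n (ncells_gt0 (xpart U)).
have lw : l <= w.
  rewrite /w sqrt_xdiag2// ler_peMl ?(ltW l0)// -[leLHS]sqrtr1 ler_sqrt ?ler0n//.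
  by rewrite ler1n.
have rs0 : 0 <= gateR U * s by rewrite mulr_ge0 ?ltW.
have half : expR (- (2^-1 * (gateR U * s))) <= k * w.
  rewrite -(@ler_pXn2r _ 2%N)// ?nnegrE ?expR_ge0 ?mulr_ge0 ?sqrtr_ge0 ?(ltW k0)//.
  have -> : expR (- (2^-1 * (gateR U * s))) ^+ 2 = expR (- (gateR U * s)).
    by rewrite expr2 -expRD; congr expR; field.
  apply: (@le_trans _ _ (k ^+ 2 * l ^+ dx)).
    have l1 : l ^+ dx = N^-1 by apply: (mulfI (lt0r_neq0 N0)); rewrite NE divff ?gt_eqF.
    by rewrite l1 ler_pdivlMr// mulrC.
  rewrite exprMn ler_pM2l ?exprn_gt0//.
  apply: (@le_trans _ _ (l ^+ 2)).
    by rewrite ler_wiXn2l// ?(ltW l0)//; exact: le_trans s1.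
  by rewrite ler_pXn2r// nnegrE ?sqrtr_ge0// ltW.
apply: gate_massW (gate_mass_local U dx_gt0).
rewrite -/s -/w [leRHS](_ : _ = (dx.*2.*2.+1 ^ dx)%:R * (k * w) + k * w); last by ring.
apply: lerD.
  rewrite ler_wpM2l//; apply: le_trans half.
  by rewrite ler_expR lerN2 ler_wpM2r//; lra.
have -> : (ncells U)%:R * expR (- (7 / 4 * (gateR U * s))) =
    N * expR (- (gateR U * s)) * expR (- (3 / 4 * (gateR U * s))).
  by rewrite -[RHS]mulrA -[in RHS]expRD; congr (_ * expR _); field.
rewrite -[leRHS]mul1r; apply: ler_pM.
- by rewrite mulr_ge0 ?expR_ge0.
- exact: expR_ge0.
- by apply: le_trans e2 _; rewrite exprn_ile1// ltW.
by apply: le_trans half; rewrite ler_expR lerN2 ler_wpM2r//; lra.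
Qed.

(** The constant c0 is a lower bound for the mean gradient; in dimension at least
    two the weight eta is paid for by the slack (1 - theta) s^(1/2) c0. *)
Lemma near_gate (c0 : R) : 0 < c0 -> \forall m \near \oo, exists theta eta : R,
  [/\ 0 <= theta /\ theta <= 1, 0 <= eta /\ eta < 1, gate_mass (T m) theta eta &
      - ln (1 - eta) <=
      (1 - theta) * Num.sqrt (xdiag2 (T m)) * c0 + gate_term (T m)].
Proof.
move=> c00; pose C : R := (dx.*2.*2.+1 ^ dx)%:R + 1.
have C0 : 0 < C by rewrite ltr_pwDr.
(* With eta = C k s^(1/2), the second bound on k gives eta <= 1/2 and the third
   one 2 eta <= (1 - 9/10) s^(1/2) c0. *)
pose k := Num.min 1 (Num.min (2 * C)^-1 (c0 / (20 * C))).
have k0 : 0 < k by rewrite !lt_min ltr01 invr_gt0 mulr_gt0//= divr_gt0// mulr_gt0.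
have k1 : k <= 1 by rewrite ge_min lexx.
have k2 : k <= (2 * C)^-1 by rewrite !ge_min lexx orbT.
have k3 : k <= c0 / (20 * C) by rewrite !ge_min lexx !orbT.
have k20 : 0 < k ^+ 2 by rewrite exprn_gt0.
near=> m.
have ek : (ncells (T m))%:R * expR (- (gateR (T m) * xdiag2 (T m))) <= k ^+ 2.
  apply: le_trans (ler_norm _) (ltW _); near: m; exact: (near_small cvg_gate_defect).
have e1 : (ncells (T m))%:R * expR (- (gateR (T m) * xdiag2 (T m))) < 1.
  apply: le_lt_trans (ler_norm _) _; near: m; exact: (near_small cvg_gate_defect).
have w1 : Num.sqrt (xdiag2 (T m)) <= 1 by near: m; exact: near_diag_le.
set e := (ncells (T m))%:R * expR (- (gateR (T m) * xdiag2 (T m))) in ek e1.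
have e0 : 0 <= e by rewrite mulr_ge0 ?expR_ge0.
have [dx1|dx1] := leqP dx 1.
  (* On a line the full distance is used, and eta is the mass in gate_term. *)
  exists 1, e; split=> //.
    apply: gate_mass_line => //; apply/eqP; rewrite eqn_leq dx1//.
  by rewrite subrr !mul0r add0r gate_termE.
set w := Num.sqrt (xdiag2 (T m)) in w1 *.
have w0 : 0 <= w by exact: sqrtr_ge0.
exists (9 / 10), (C * k * w).
have Ck : C * k <= 2^-1.
  by rewrite mulrC -ler_pdivlMr// -invfM.
have Ck' : C * k <= c0 / 20.
  rewrite mulrC -ler_pdivlMr//; apply: le_trans k3 _.
  by rewrite invfM mulrA.
have Ck0 : 0 <= C * k by rewrite mulr_ge0 ?(ltW C0) ?(ltW k0).
have eta0 : 0 <= C * k * w by rewrite mulr_ge0.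
have eta1 : C * k * w <= 2^-1.
  by rewrite -[leRHS]mulr1; apply: ler_pM.
split; [lra|split=> //; lra|exact: gate_mass_small|].
apply: le_trans (ln_defect_le eta0 eta1) _.
have t0 : 0 <= gate_term (T m) by rewrite gate_termE ln_defect_ge0.
have := ler_wpM2r w0 Ck'; lra.
Unshelve. all: by end_near. Qed.

Lemma near_admissible (r c0 : R) : 0 < r -> 0 < c0 ->
  \forall m \near \oo, exists theta eta : R,
  [/\ admissible r (T m) theta eta, 0 <= theta, 0 <= eta,
      3 / 2 * d%:R * err2 (T m) <= sum_term (T m) + tail_term (T m) &
      - ln (1 - eta) <=
      (1 - theta) * Num.sqrt (xdiag2 (T m)) * c0 + gate_term (T m)].
Proof.
move=> r0 c00; near=> m.
have [th [eta [[th0 th1] [eta0 eta1] mass ineq]]] : exists theta eta : R,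
  [/\ 0 <= theta /\ theta <= 1, 0 <= eta /\ eta < 1, gate_mass (T m) theta eta &
      - ln (1 - eta) <=
      (1 - theta) * Num.sqrt (xdiag2 (T m)) * c0 + gate_term (T m)].
  by near: m; exact: near_gate.
have [e2 e1 e3] : [/\ err2 (T m) <= 3^-1,
      err1 (T m) <= 2^-1 /\ 2^-1 ^+ d.+1 <= (2^-1 - err1 (T m)) ^+ d &
      3 / 2 * d%:R * err2 (T m) <= sum_term (T m) + tail_term (T m)].
  by near: m; exact: near_precise.
exists th, eta; split=> //; split=> //; last by near: m; exact: near_block.
by split=> //; near: m; exact: near_diag_le.
Unshelve. all: by end_near. Qed.

End eventual_gates.

(** * The integrated bound and the convergence of its terms *)

Section kl_bound.
Context (R : realType) (d dx : nat).
Variables (F : probability ('rV[R]_d * 'rV[R]_dx)%type R)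
  (nu : {measure set 'rV[R]_dx -> \bar R})
  (f : 'rV[R]_d * 'rV[R]_dx -> R) (g : 'rV[R]_dx -> R) (r sigma0 : R).
Local Notation YX := ([set: 'rV[R]_d] `*` @ucube R dx).
Hypotheses (d_gt0 : (0 < d)%N) (dx_gt0 : (0 < dx)%N).
Hypothesis Fdens : has_densities F nu f g.
Hypotheses (r_gt0 : 0 < r) (sigma0_gt0 : 0 < sigma0).
Hypothesis Ftarget : target_conditions F f r sigma0.
Implicit Types (p : 'rV[R]_d * 'rV[R]_dx) (y : 'rV[R]_d).

Lemma target_gt0 p : YX p -> 0 < f p.
Proof. by have [[H _] _ _ _] := Ftarget; exact: H. Qed.

Lemma target_C1 : cont_differentiable f.
Proof. by have [[_ H] _ _ _] := Ftarget. Qed.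

Lemma measurable_target_sup (a b : R) : 0 < a -> 0 < b ->
  measurable_fun YX (sup_dlog f a b).
Proof.
move=> a0 b0; apply: measurable_sup_dlog => //.
exact: gradn_continuous target_gt0 target_C1.
Qed.

(** The logarithm of 2^-(d+1) > phi(y, 0, sigma0) (r/2)^d. *)
Lemma rest_cost_ge y : d.+1%:R * ln 2 <= rest_cost sigma0 r y.
Proof.
have [_ _ _ /(_ y)[_ H]] := Ftarget.
have ph0 : 0 < phi y 0 sigma0.
  rewrite divr_gt0 ?expR_gt0// powR_gt0//.
  by rewrite !mulr_gt0 ?pi_gt0 ?exprn_gt0.
have r20 : 0 < (r / 2) ^+ d by rewrite exprn_gt0// divr_gt0.
rewrite rest_costE// lerNr.
have <- : ln (2^-1 ^+ d.+1) = - (d.+1%:R * ln 2) :> R.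
  by rewrite lnXn ?invr_gt0// lnV ?posrE// mulNrn mulr_natl.
have a0 : 0 < 2^-1 ^+ d.+1 :> R by rewrite exprn_gt0 ?invr_gt0.
have b0 : 0 < (r / 2) ^+ d * phi y 0 sigma0 by exact: mulr_gt0.
by rewrite ler_ln ?posrE// mulrC ltW.
Qed.

Lemma rest_cost_ge0 y : 0 <= rest_cost sigma0 r y.
Proof.
apply: le_trans (rest_cost_ge y); rewrite mulr_ge0// ln_ge0//; lra.
Qed.

Lemma measurable_dotrV_fst :
  measurable_fun setT (fun p : 'rV[R]_d * 'rV[R]_dx => dotrV p.1 p.1 : measurableTypeR R).
Proof.
apply: (@measurable_sum _ _ _ _ _ _ (fun (i : 'I_d) p => p.1 ord0 i * p.1 ord0 i)).
move=> i; apply: measurable_funM;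
  exact: (measurableT_comp (measurable_coord i) measurable_fst).
Qed.

Lemma measurable_rest_cost :
  measurable_fun setT (fun p => (rest_cost sigma0 r p.1)%:E).
Proof.
apply/measurable_EFinP; rewrite /rest_cost; apply: measurable_funB => //.
by apply: measurable_funM => //; exact: measurable_dotrV_fst.
Qed.

Lemma near_rest_YX m (T : tuning R d dx m) : near_rest T `<=` YX.
Proof. exact: subIsetl. Qed.

Local Notation h3 := (fun p => (r * Num.sqrt d%:R / 2)%:E * sup_dlog f r r p)%E.
Local Notation h4 := (fun p => (rest_cost sigma0 r p.1)%:E).

Lemma sqrtd_gt0 : 0 < Num.sqrt d%:R :> R. Proof. by rewrite sqrtr_gt0 ltr0n. Qed.

Lemma slope_gt0 : 0 < r * Num.sqrt d%:R / 2.
Proof. by rewrite divr_gt0// mulr_gt0// sqrtd_gt0. Qed.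

Lemma sup_rr_ge0 p : YX p -> (0 <= sup_dlog f r r p)%E.
Proof. by move=> YXp; apply: sup_dlog_ge0 => //; exact: ltW. Qed.

(** The integrated bound, before its mass defect eta is compared with the slack
    in the first term. The three cases are merged into one sum of nonnegative
    functions, the last two being supported by near_rest. *)
Lemma kl_le_terms m (T : tuning R d dx m) theta eta :
  admissible r T theta eta -> 0 <= theta -> 0 <= eta ->
  3 / 2 * d%:R * err2 T <= sum_term T + tail_term T ->
  (kl F f (model3 f sigma0 T) <=
   (delta T * (Num.sqrt d%:R / 2) + theta * Num.sqrt (xdiag2 T))%:E *
     \int[F]_(p in YX) sup_dlog f (delta T) (Num.sqrt (xdiag2 T)) p +
   ((sum_term T + tail_term T - ln (1 - eta))%:E +
    ((r * Num.sqrt d%:R / 2)%:E * \int[F]_(p in near_rest T) sup_dlog f r r p +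
     \int[F]_(p in near_rest T) (rest_cost sigma0 r p.1)%:E)))%E.
Proof.
move=> adm th0 eta0 e3; have [_ [eta1 _] _ _ _] := adm.
set A := _ + theta * _; set K := _ - ln _.
have d0 := delta_gt0 T; have sd := sqrtd_gt0; have sl := slope_gt0.
have sq0 : 0 < Num.sqrt (xdiag2 T) by rewrite sqrtr_gt0 xdiag2_gt0.
have A0 : 0 < A.
  by rewrite ltr_pwDl ?mulr_ge0 ?sqrtr_ge0// mulr_gt0// divr_gt0.
have e20 := err2_ge0 T.
have l0 : 0 <= - ln (1 - eta) by apply: ln_defect_ge0.
have st0 : 0 <= sum_term T + tail_term T.
  by apply: le_trans e3; rewrite mulr_ge0.
have K0 : 0 <= K by rewrite /K addr_ge0.
pose s1 := sup_dlog f (delta T) (Num.sqrt (xdiag2 T)).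
have s10 p : YX p -> (0 <= s1 p)%E by move=> YXp; apply: sup_dlog_ge0 => //; exact: ltW.
pose h p := (h3 p + h4 p)%E.
have h0 p : YX p -> (0 <= h p)%E.
  move=> YXp; apply: adde_ge0; last by rewrite lee_fin rest_cost_ge0.
  by rewrite mule_ge0 ?lee_fin ?(ltW sl)// sup_rr_ge0.
have mYX := @measurable_YX R d dx.
have mN := measurable_near_rest T.
have NY := @near_rest_YX m T.
have ms1 : measurable_fun YX s1 by exact: measurable_target_sup.
have ms : measurable_fun (near_rest T) (sup_dlog f r r).
  by apply: measurable_funS mYX NY _; exact: measurable_target_sup.
have mh3 : measurable_fun (near_rest T) h3 by exact: measurable_funeM.
have mh4 : measurable_fun (near_rest T) h4.
  by apply: measurable_funTS; exact: measurable_rest_cost.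
have mh : measurable_fun (near_rest T) h by exact: emeasurable_funD.
have h0' p : YX p -> (0 <= (h \_ (near_rest T)) p)%E.
  by move=> YXp; rewrite patchE; case: ifPn => // /set_mem/NY/h0.
have mh' : measurable_fun YX (h \_ (near_rest T)).
  by apply/(measurable_restrict _ mN mYX); rewrite setIidr.
apply: (@le_trans _ _ (\int[F]_(p in YX) (A%:E * s1 p +
    (K%:E + (h \_ (near_rest T)) p)))%E).
  apply: le_integral_upper => -[y x] YXp.
    apply: adde_ge0; first by rewrite mule_ge0 ?lee_fin ?(ltW A0)// s10.
    by apply: adde_ge0; [rewrite lee_fin|exact: h0'].
  have xX : ucube x by case: YXp.
  have [Sfin|] := boolP (s1 (y, x) \is a fin_num); last first.
    rewrite ge0_fin_numE ?s10// -leNgt leye_eq => /eqP ->.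
    have hK : (0 <= K%:E + (h \_ (near_rest T)) (y, x))%E.
      by apply: adde_ge0; [rewrite lee_fin|exact: h0'].
    rewrite gt0_muley ?lte_fin// addye ?leey//.
    by rewrite gt_eqF// (lt_le_trans _ hK)// ltNy0.
  have Sle : (s1 (y, x) <= (fine (s1 (y, x)))%:E)%E by rewrite fineK.
  have := ln_ratio_cases Fdens target_gt0 target_C1 sigma0_gt0
    (fine (sup_dlog f r r (y, x))) adm r_gt0 (lexx r) xX Sle.
  rewrite /= -/A; set L := ln _; set S := fine (s1 _) => cases.
  rewrite (_ : s1 (y, x) = S%:E); last by rewrite /S fineK.
  have hN : (0 <= (h \_ (near_rest T)) (y, x))%E by exact: h0'.
  have [Lle|[nr Lle]] := cases.
    apply: (@le_trans _ _ (A%:E * S%:E + K%:E)%E); last first.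
      by rewrite leeD2l// leeDl.
    by rewrite -EFinM -EFinD lee_fin /K; lra.
  rewrite patchE mem_set//= /h.
  have [Ffin|] := boolP (sup_dlog f r r (y, x) \is a fin_num); last first.
    rewrite ge0_fin_numE ?sup_rr_ge0// -leNgt leye_eq => /eqP ->.
    by rewrite gt0_muley ?lte_fin//= addye ?addey ?leey.
  have Fle : (sup_dlog f r r (y, x) <= (fine (sup_dlog f r r (y, x)))%:E)%E.
    by rewrite fineK.
  have F0 : 0 <= fine (sup_dlog f r r (y, x)) by rewrite fine_ge0// sup_rr_ge0.
  rewrite -(fineK Ffin) -!EFinM -!EFinD lee_fin.
  set S' := fine _ in Lle Fle F0 *.
  have V := rest_cost_ge y; have {}F0 := mulr_ge0 (ltW sl) F0.
  case: Lle => [|/(_ Fle)]; rewrite /K; last by lra.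
  lra.
rewrite ge0_integralD//; last 4 first.
- by move=> p YXp; rewrite mule_ge0 ?lee_fin ?(ltW A0)// s10.
- exact: measurable_funeM.
- by move=> p YXp; apply: adde_ge0; [rewrite lee_fin|exact: h0'].
- by apply: emeasurable_funD.
rewrite ge0_integralZl_EFin ?(ltW A0)// leeD2l// ge0_integralD//.
rewrite integral_cst// -integral_mkcondr setIidr//.
apply: leeD.
  rewrite -[leRHS]mule1; apply: lee_wpmul2l; first by rewrite lee_fin.
  exact: probability_le1.
rewrite ge0_integralD//; last 2 first.
- by move=> p /NY YXp; rewrite mule_ge0 ?lee_fin ?(ltW sl)// sup_rr_ge0.
- by move=> p _; rewrite lee_fin rest_cost_ge0.
by rewrite ge0_integralZl_EFin ?(ltW sl)// => p /NY; exact: sup_rr_ge0.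
Qed.

End kl_bound.

Section part_one.
Context (R : realType) (d dx : nat).
Variables (F : probability ('rV[R]_d * 'rV[R]_dx)%type R)
  (nu : {measure set 'rV[R]_dx -> \bar R})
  (f : 'rV[R]_d * 'rV[R]_dx -> R) (g : 'rV[R]_dx -> R) (r sigma0 : R).
Local Notation YX := ([set: 'rV[R]_d] `*` @ucube R dx).
Hypotheses (d_gt0 : (0 < d)%N) (dx_gt0 : (0 < dx)%N).
Hypothesis Fdens : has_densities F nu f g.
Hypotheses (r_gt0 : 0 < r) (sigma0_gt0 : 0 < sigma0).
Hypothesis Ftarget : target_conditions F f r sigma0.
Variable T : forall m, tuning R d dx m.
Hypothesis condT : tuning_conditions T.
Implicit Types (p : 'rV[R]_d * 'rV[R]_dx) (y : 'rV[R]_d).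

Local Notation I1 m :=
  (\int[F]_(p in YX) sup_dlog f (delta (T m)) (Num.sqrt (xdiag2 (T m))) p)%E.
Local Notation Irr := (\int[F]_(p in YX) sup_dlog f r r p)%E.

Let sq_gt0 m : 0 < Num.sqrt (xdiag2 (T m)).
Proof. by rewrite sqrtr_gt0 xdiag2_gt0. Qed.

Lemma integral_sup_rr_fin : exists2 i : R, 0 <= i & Irr = i%:E.
Proof.
have [_ _ Ifin _] := Ftarget.
have I0 : (0 <= Irr)%E by apply: integral_ge0 => p; exact: sup_rr_ge0.
exists (fine Irr); first exact: fine_ge0.
by rewrite fineK// ge0_fin_numE.
Qed.

(** The supremum dominates the gradient at the center of the cube, whose mean is
    positive and independent of m. *)
Lemma integral_sup_lb : exists2 c0 : R, 0 < c0 & forall m, (c0%:E <= I1 m)%E.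
Proof.
have pos := integral_gradn_gt0 d_gt0 Fdens (target_gt0 Ftarget) (target_C1 Ftarget).
set J := (\int[F]_(p in YX) (gradn f p)%:E)%E in pos.
have JI m : (J <= I1 m)%E.
  apply: le_integral_upper => p YXp.
    by apply: sup_dlog_ge0 => //; apply: ltW => //; exact: delta_gt0.
  by apply: gradn_le_sup_dlog => //; apply: ltW => //; exact: delta_gt0.
have [Jfin|] := boolP (J \is a fin_num).
  exists (fine J) => [|m]; last by rewrite fineK.
  by rewrite fine_gt0// pos ltey_eq Jfin.
rewrite ge0_fin_numE ?ltW// -leNgt leye_eq => /eqP Joo.
by exists 1 => // m; apply: le_trans (JI m); rewrite Joo leey.
Qed.

Lemma near_sup_le : \forall m \near \oo, (I1 m <= Irr)%E.
Proof.
near=> m; apply: le_integral_upper => p YXp; first exact: sup_rr_ge0.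
apply: le_sup_dlog; first by near: m; exact: near_delta_le.
by near: m; exact: near_diag_le.
Unshelve. all: by end_near. Qed.

Lemma kl_bound_eventually : \forall m \near \oo,
  (kl F f (model3 f sigma0 (T m)) <=
   \sum_(t <- kl_bound_terms F f r sigma0 (T m)) t)%E.
Proof.
have [c0 c00 c0I] := integral_sup_lb.
have [irr _ IrrE] := integral_sup_rr_fin.
near=> m.
have I1le : (I1 m <= Irr)%E by near: m; exact: near_sup_le.
have [th [eta [adm th0 eta0 e3 geq]]] : exists theta eta : R,
  [/\ admissible r (T m) theta eta, 0 <= theta, 0 <= eta,
      3 / 2 * d%:R * err2 (T m) <= sum_term (T m) + tail_term (T m) &
      - ln (1 - eta) <=
      (1 - theta) * Num.sqrt (xdiag2 (T m)) * c0 + gate_term (T m)].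
  by near: m; exact: near_admissible.
have th1 : th <= 1 by case: adm => [[]].
apply: le_trans (kl_le_terms d_gt0 dx_gt0 Fdens r_gt0 sigma0_gt0 Ftarget
  adm th0 eta0 e3) _.
have {}c0I := c0I m.
have I1E : I1 m = (fine (I1 m))%:E.
  rewrite fineK// ge0_fin_numE; last by apply: le_trans c0I; rewrite lee_fin ltW.
  by apply: le_lt_trans I1le _; rewrite IrrE ltry.
have c0i : c0 <= fine (I1 m) by rewrite -lee_fin -I1E.
rewrite /kl_bound_terms !big_cons big_nil adde0.
rewrite -/(sum_term (T m)) -/(tail_term (T m)) -/(gate_term (T m)).
set t3 := (_ * \int[F]_(p in near_rest _) _)%E.
rewrite -[X in (_ <= _ + (_ + (_ + (t3 + (X + _)))))%E]/
  (\int[F]_(p in near_rest (T m)) (rest_cost sigma0 r p.1)%:E)%E.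
set t4 := (\int[F]_(p in near_rest _) _)%E.
rewrite I1E; set i := fine _ in c0i *; set A0 := _ + Num.sqrt _; set A := _ + th * _.
set s1 := sum_term _; set s2 := tail_term _; set s5 := gate_term _.
have AC (u v w z : R) (x y : \bar R) : (u%:E + (v%:E + (w%:E + (x + (y + z%:E)))) =
    (u + (v + w + z))%:E + (x + y))%E.
  rewrite !EFinD -!addeA; do 3 (congr (_ + _)%E).
  by rewrite addeA addeC.
rewrite -!EFinM AC addeA -EFinD; apply: leeD2r; rewrite lee_fin.
have w0 : 0 <= (1 - th) * Num.sqrt (xdiag2 (T m)).
  by rewrite mulr_ge0 ?subr_ge0// ltW.
have := ler_wpM2l w0 c0i; rewrite /A0 /A; move: geq; rewrite -/s5 -/s1 -/s2.
lra.
Unshelve. all: by end_near. Qed.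

(** Each point leaves the sets near_rest for good, so that dominated convergence
    applies. *)
Lemma cvg_integral_near_rest (h : 'rV[R]_d * 'rV[R]_dx -> \bar R) :
  measurable_fun YX h -> (forall p, YX p -> 0 <= h p)%E ->
  (\int[F]_(p in YX) h p < +oo)%E ->
  (fun m => \int[F]_(p in near_rest (T m)) h p)%E @ \oo --> 0%E.
Proof.
move=> mh h0 hoo; have mYX := @measurable_YX R d dx.
have hE m : (\int[F]_(p in near_rest (T m)) h p =
    \int[F]_(p in YX) (h \_ (near_rest (T m))) p)%E.
  by rewrite -integral_mkcondr setIidr//; exact: near_rest_YX.
have [[_ cover] _ _] := condT.
have ih : F.-integrable YX h.
  apply/integrableP; split=> //; rewrite (eq_integral h)// => p /set_mem YXp.
  by rewrite gee0_abs// h0.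
have [] := @dominated_convergence _ _ _ F YX mYX
  (fun m => h \_ (near_rest (T m))) (cst 0%E) h.
- move=> m; apply/(measurable_restrict _ (measurable_near_rest (T m)) mYX).
  by apply: measurable_funS mYX _ mh; exact: subIsetl.
- exact: measurable_cst.
- apply: aeW => -[y x] YXp; apply: cvg_near_cst.
  apply: filterS (cover y) => m yE; rewrite patchE memNset//.
  by move=> -[_ /= [z]]; rewrite yE.
- exact: ih.
- apply: aeW => p m YXp; rewrite patchE; case: ifPn => _.
    by rewrite gee0_abs// h0.
  by rewrite abse0 h0.
move=> _ _; rewrite integral0.
by under [in X in X -> _]eq_fun do rewrite -hE.
Qed.

Lemma integral_rest_cost_lt : (\int[F]_(p in YX) (rest_cost sigma0 r p.1)%:E < +oo)%E.
Proof.
have [_ mom _ _] := Ftarget.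
have mYX := @measurable_YX R d dx.
pose c := `|ln ((r / 2) ^+ d / (2 * pi * sigma0 ^+ 2) `^ (d%:R / 2))|.
have c0 : 0 <= c by exact: normr_ge0.
pose b := (2 * sigma0 ^+ 2)^-1.
have b0 : 0 <= b by rewrite invr_ge0 mulr_ge0 ?sqr_ge0.
apply: (@le_lt_trans _ _ (\int[F]_(p in YX)
    (b%:E * (\sum_(k < d) (p.1 ord0 k ^+ 2)%:E) + c%:E))%E).
  apply: le_integral_upper => p YXp.
    apply: adde_ge0; last by rewrite lee_fin.
    by rewrite mule_ge0 ?lee_fin// sume_ge0// => k _; rewrite lee_fin sqr_ge0.
  rewrite sumEFin -EFinM -EFinD lee_fin /rest_cost.
  have -> : dotrV p.1 p.1 = \sum_(k < d) p.1 ord0 k ^+ 2.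
    by apply: eq_bigr => k _; rewrite expr2.
  rewrite [_ / (2 * _)]mulrC; apply: lerD => //.
  by rewrite /c -normrN ler_norm.
have msq k : measurable_fun YX (fun p => (p.1 ord0 k ^+ 2)%:E).
  apply/measurable_EFinP; apply: measurable_funTS; apply: measurable_funX.
  exact: (measurableT_comp (measurable_coord k) measurable_fst).
rewrite ge0_integralD//; last 2 first.
- move=> p _; rewrite mule_ge0 ?lee_fin// sume_ge0// => k _; rewrite lee_fin sqr_ge0//.
- by apply: measurable_funeM; apply: emeasurable_sum.
apply: lte_add_pinfty; last first.
  rewrite integral_cst// (@le_lt_trans _ _ c%:E) ?ltry//.
  rewrite -[leRHS]mule1; apply: lee_wpmul2l; first by rewrite lee_fin.
  exact: probability_le1.
rewrite ge0_integralZl_EFin//; last 2 first.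
- by move=> p _; rewrite sume_ge0// => k _; rewrite lee_fin sqr_ge0.
- exact: emeasurable_sum.
rewrite ge0_integral_sum//; last by move=> k p _; rewrite lee_fin sqr_ge0.
apply: lte_mul_pinfty => //.
apply: lte_sum_pinfty => k _; exact: mom.
Qed.

Lemma kl_bound_terms_cvg k : (k < 6)%N ->
  (fun m => nth 0%E (kl_bound_terms F f r sigma0 (T m)) k) @ \oo --> 0%E.
Proof.
have [irr irr0 IrrE] := integral_sup_rr_fin.
case: k => [|[|[|[|[|[|//]]]]]] _ /=.
- apply: (@squeeze_cvge _ _ _ _ (cst 0%E) _ (fun m =>
    ((delta (T m) * (Num.sqrt d%:R / 2) + Num.sqrt (xdiag2 (T m))) * irr)%:E)).
  + near=> m.
    have A0 : 0 <= delta (T m) * (Num.sqrt d%:R / 2) + Num.sqrt (xdiag2 (T m)).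
      by rewrite addr_ge0 ?sqrtr_ge0// mulr_ge0 ?divr_ge0 ?sqrtr_ge0// ltW ?delta_gt0.
    rewrite mule_ge0 ?lee_fin//=; last first.
      apply: integral_ge0 => p YXp; apply: sup_dlog_ge0 => //; apply: ltW => //.
      exact: delta_gt0.
    rewrite EFinM -IrrE lee_wpmul2l ?lee_fin//.
    by near: m; exact: near_sup_le.
  + exact: cvg_cst.
  have [_ [dl _ _] [_ sx _]] := condT.
  have sq : (fun m => Num.sqrt (xdiag2 (T m))) @ \oo --> 0.
    rewrite -[X in _ --> X](@sqrtr0 R).
    by apply: (continuous_cvg _ _ sx); exact: sqrt_continuous.
  apply: cvg_EFin; first exact: nearW.
  rewrite -[X in _ --> X](_ : (0 * (Num.sqrt d%:R / 2) + 0) * irr = 0); last by ring.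
  by apply: cvgMl; apply: cvgD => //; apply: cvgMl.
- by apply: cvg_EFin; [exact: nearW|exact: cvg_sum_term].
- by apply: cvg_EFin; [exact: nearW|exact: cvg_tail_term].
- rewrite -[X in _ --> X](mule0 (r * Num.sqrt d%:R / 2)%:E).
  apply: cvgeZl => //; apply: cvg_integral_near_rest.
  + exact: (measurable_target_sup Ftarget).
  + by move=> p; exact: sup_rr_ge0.
  + by rewrite IrrE ltry.
- apply: cvg_integral_near_rest.
  + by apply: measurable_funTS; exact: measurable_rest_cost.
  + by move=> p _; rewrite lee_fin (rest_cost_ge0 r_gt0 sigma0_gt0 Ftarget).
  + exact: integral_rest_cost_lt.
- apply: cvg_EFin; first exact: nearW.
  apply: (@squeeze_cvgr _ _ _ _ (cst 0) (fun m =>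
    2 * ((ncells (T m))%:R * expR (- (gateR (T m) * xdiag2 (T m)))))).
  + have half : 0 < 2^-1 :> R by rewrite invr_gt0.
    near=> m.
    have e2 : (ncells (T m))%:R * expR (- (gateR (T m) * xdiag2 (T m))) <= 2^-1.
      apply: le_trans (ler_norm _) (ltW _); near: m.
      exact: (near_small (cvg_gate_defect dx_gt0 condT)).
    have e0 : 0 <= (ncells (T m))%:R * expR (- (gateR (T m) * xdiag2 (T m))).
      by rewrite mulr_ge0 ?expR_ge0.
    rewrite /= -/(gate_term (T m)) gate_termE// ln_defect_le// andbT.
    by apply: ln_defect_ge0 => //; lra.
  + exact: cvg_cst.
  rewrite -[X in _ --> X](mulr0 2); apply: cvgMr.
  exact: cvg_gate_defect.
Unshelve. all: by end_near. Qed.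

End part_one.

(** * Explicit partitions *)

Section nat_root.

Definition nroot d m : nat := \max_(i < m.+1 | (i ^ d <= m)%N) i.

Lemma nroot_le d m : (0 < d)%N -> (nroot d m ^ d <= m)%N.
Proof.
move=> d0; rewrite /nroot; elim/big_ind : _ => [|x y xm ym|i //].
  by rewrite exp0n.
by rewrite /maxn; case: ifP.
Qed.

Lemma nroot_lt d m : (0 < d)%N -> (m < (nroot d m).+1 ^ d)%N.
Proof.
move=> d0; rewrite ltnNge; apply/negP => H.
have lt : ((nroot d m).+1 < m.+1)%N.
  by rewrite ltnS; apply: leq_trans H; rewrite -{1}(expn1 _.+1) leq_pexp2l.
have := @leq_bigmax_cond _ (fun i : 'I_m.+1 => (i ^ d <= m)%N) val (Ordinal lt) H.
by rewrite /= -/(nroot d m) ltnn.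
Qed.

Lemma nroot_ge d m K : (0 < d)%N -> (K ^ d <= m)%N -> (K <= nroot d m)%N.
Proof.
move=> d0 Km; rewrite -ltnS -(ltn_exp2r _ _ d0).
exact: leq_ltn_trans Km (nroot_lt m d0).
Qed.

End nat_root.

Section cube_partition.
Context (R : realType) (d m : nat) (h : R).
Hypotheses (d_gt0 : (0 < d)%N) (h_gt0 : 0 < h).
Local Notation n := (nroot d m).

(** As m need not be a d-th power, the m cells are the first m ones in a list of
    (n + 1)^d > m cells, in which those of the cube with n cells per edge come
    first; the other cells that are taken form an incomplete layer around this
    cube. *)
Definition inner_index (p : {ffun 'I_d -> 'I_n.+1}) : bool := [forall a, (p a < n)%N].

Definition cell_list : seq {ffun 'I_d -> 'I_n.+1} :=
  seq.filter inner_index (enum {ffun 'I_d -> 'I_n.+1}) ++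
  seq.filter (predC inner_index) (enum {ffun 'I_d -> 'I_n.+1}).

Lemma cell_list_perm : perm_eq cell_list (enum {ffun 'I_d -> 'I_n.+1}).
Proof. by rewrite /cell_list perm_filterC. Qed.

Lemma cell_list_uniq : uniq cell_list.
Proof. by rewrite (perm_uniq cell_list_perm) enum_uniq. Qed.

Lemma cell_list_size : (m < size cell_list)%N.
Proof.
by rewrite (perm_size cell_list_perm) -cardE card_ffun !card_ord nroot_lt.
Qed.

Lemma inner_count : (count inner_index (enum {ffun 'I_d -> 'I_n.+1}) <= m)%N.
Proof.
rewrite -size_filter; apply: leq_trans (nroot_le m d_gt0).
have -> : size (seq.filter inner_index (enum {ffun 'I_d -> 'I_n.+1})) =
    #|@ffun_on_mem 'I_d 'I_n.+1 (mem [pred i : 'I_n.+1 | (i < n)%N])|.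
  rewrite cardE; apply: perm_size; apply: uniq_perm => [||p].
  - by rewrite filter_uniq// enum_uniq.
  - exact: enum_uniq.
  rewrite mem_filter !mem_enum andbT.
  by apply/forallP/ffun_onP.
rewrite card_ffun_on card_ord leq_exp2r//.
rewrite -sum1_card (eq_bigl (fun i : 'I_n.+1 => (i < n)%N))//.
by rewrite (big_ord_narrow (leqnSn n)) sum_nat_const card_ord muln1.
Qed.

Definition cell_vector (p : {ffun 'I_d -> 'I_n.+1}) : 'rV[int]_d :=
  \row_a (p a : nat)%:Z.

Definition cube_index (j : 'I_m) : 'rV[int]_d :=
  cell_vector (nth [ffun=> ord0] cell_list j).

Lemma cube_index_inj : injective cube_index.
Proof.
move=> i j ij; apply/val_inj/eqP.
have lt (k : 'I_m) : (k < size cell_list)%N by exact: ltn_trans (ltn_ord k) cell_list_size.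
rewrite -(nth_uniq [ffun=> ord0] (lt i) (lt j) cell_list_uniq); apply/eqP/ffunP => a.
by apply/val_inj; move/rowP/(_ a) : ij; rewrite !mxE => -[].
Qed.

Lemma cube_index_inner (k : 'rV[int]_d) : (forall a, 0 <= k ord0 a < n%:Z) ->
  exists j, cube_index j = k.
Proof.
move=> kn; pose p := [ffun a => inord `|k ord0 a|%N : 'I_n.+1].
have pE a : (p a : nat) = `|k ord0 a|%N.
  rewrite ffunE inordK//; have /andP[k0 k1] := kn a.
  by rewrite ltnS -lez_nat gez0_abs// ltW.
have pin : p \in seq.filter inner_index (enum {ffun 'I_d -> 'I_n.+1}).
  rewrite mem_filter mem_enum andbT; apply/forallP => a.
  by have /andP[k0 k1] := kn a; rewrite pE -ltz_nat gez0_abs.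
have lt : (index p cell_list < m)%N.
  rewrite /cell_list index_cat pin; apply: leq_trans inner_count.
  by rewrite -size_filter index_mem.
exists (Ordinal lt); rewrite /cube_index/= nth_index; last first.
  by rewrite /cell_list mem_cat pin.
by apply/rowP => a; rewrite mxE pE gez0_abs//; have /andP[] := kn a.
Qed.

Lemma cube_adjacent : exists lo hi : 'rV[int]_d,
  (forall k : 'rV[int]_d,
     (forall a, lo ord0 a <= k ord0 a < hi ord0 a) -> exists j, cube_index j = k) /\
  (forall j a, lo ord0 a - 1 <= cube_index j ord0 a < hi ord0 a + 1).
Proof.
exists 0, (const_mx n%:Z); split=> [k kn|j a].
  by apply: cube_index_inner => a; have := kn a; rewrite !mxE.
rewrite !mxE; set p := nth _ _ _; have := ltn_ord (p a); move: (p a : nat) => i iN.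
by apply/andP; split; lia.
Qed.

Definition cube_partition : ypartition R d m :=
  YPartition (const_mx (- (n%:R * h / 2))) h_gt0 cube_index_inj cube_adjacent.

Lemma cube_partition_cover (y : 'rV[R]_d) :
  (forall a, - (n%:R * h / 2) <= y ord0 a < n%:R * h / 2) -> ~ yrest cube_partition y.
Proof.
move=> yn /yrestP H; pose o : 'rV[R]_d := const_mx (- (n%:R * h / 2)).
have [j jE] : exists j, cube_index j = grid_index o h y.
  apply: cube_index_inner => a; rewrite !mxE; have /andP[y1 y2] := yn a.
  rewrite floor_ge_int_tmp -(ltr_int R); apply/andP; split.
    by rewrite divr_ge0 ?(ltW h_gt0)// opprK; lra.
  apply: le_lt_trans (floor_le_tmp _) _; rewrite ltr_pdivrMr// opprK -pmulrn; lra.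
exact: H jE.
Qed.

End cube_partition.

Section lattice_partition.
Context (R : realType) (dx k : nat).
Hypothesis k_gt0 : (0 < k)%N.
Local Notation lattice := ({ffun 'I_dx -> 'I_k}).

Definition lattice_center (i : 'I_#|{: lattice}|) : 'rV[R]_dx :=
  \row_a (((enum_val i a : nat)%:R + 2^-1) / k%:R).

Let k0 : 0 < k%:R :> R. Proof. by rewrite ltr0n. Qed.

Lemma side_gt0 : 0 < k%:R^-1 :> R. Proof. by rewrite invr_gt0 ltr0n. Qed.

Lemma lattice_cellE i (x : 'rV[R]_dx) : xcell k%:R^-1 (lattice_center i) x <->
  forall a, (enum_val i a : nat)%:R <= x ord0 a * k%:R /\
    (x ord0 a * k%:R < (enum_val i a : nat)%:R + 1 \/
     x ord0 a * k%:R = (enum_val i a : nat)%:R + 1 /\ x ord0 a = 1).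
Proof.
have lE (e : R) : (e + 2^-1) / k%:R - k%:R^-1 / 2 = e / k%:R.
  by field; rewrite gt_eqF// ltr0n.
have hE (e : R) : (e + 2^-1) / k%:R + k%:R^-1 / 2 = (e + 1) / k%:R.
  by field; rewrite gt_eqF// ltr0n.
split=> H a; have := H a; rewrite !mxE lE hE ler_pdivrMr ?ltr0n// ltr_pdivlMr ?ltr0n//.
  move=> [h1 [h2|[h2 h3]]]; split=> //; [by left|right; split=> //].
  by rewrite h2 divfK// gt_eqF// ltr0n.
move=> [h1 [h2|[h2 h3]]]; split=> //; [by left|right; split=> //].
by rewrite -h2 mulfK// gt_eqF// ltr0n.
Qed.

Lemma lattice_disjoint :
  trivIset [set: 'I_#|{: lattice}|] (fun i => xcell k%:R^-1 (lattice_center i)).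
Proof.
move=> i j _ _ [x [/lattice_cellE xi /lattice_cellE xj]].
apply/enum_val_inj/ffunP => a; apply/val_inj => /=.
have aux (i' j' : 'I_#|{: lattice}|) : (forall a, (enum_val i' a : nat)%:R <= x ord0 a * k%:R /\
    (x ord0 a * k%:R < (enum_val i' a : nat)%:R + 1 \/
     x ord0 a * k%:R = (enum_val i' a : nat)%:R + 1 /\ x ord0 a = 1)) ->
   (forall a, (enum_val j' a : nat)%:R <= x ord0 a * k%:R /\
    (x ord0 a * k%:R < (enum_val j' a : nat)%:R + 1 \/
     x ord0 a * k%:R = (enum_val j' a : nat)%:R + 1 /\ x ord0 a = 1)) ->
   (enum_val j' a <= enum_val i' a)%N.
  move=> xi' xj'; rewrite leqNgt; apply/negP => ij.
  have [_ hi] := xi' a; have [lj _] := xj' a.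
  have : (enum_val i' a).+1%:R <= (enum_val j' a : nat)%:R :> R by rewrite ler_nat.
  rewrite -natr1 => ij'.
  case: hi => [|[hi x1]]; first by lra.
  have := ltn_ord (enum_val j' a); rewrite -(ltr_nat R).
  by rewrite x1 mul1r in lj hi; lra.
by apply/eqP; rewrite eqn_leq !aux.
Qed.

Lemma lattice_cover :
  \bigcup_(i in [set: 'I_#|{: lattice}|]) xcell k%:R^-1 (lattice_center i) = @ucube R dx.
Proof.
apply/seteqP; split=> [x [i _ /lattice_cellE xi] a|x xX].
  have [x1 x2] := xi a; rewrite in_itv/=.
  have ik : (enum_val i a).+1%:R <= k%:R :> R by rewrite ler_nat.
  rewrite -natr1 in ik; apply/andP; split.
    by rewrite -(pmulr_lge0 _ k0); apply: le_trans x1.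
  case: x2 => [x2|[_ ->]]; last exact: lexx.
  by rewrite -(ler_pM2r k0) mul1r; lra.
pose u a := minn (Num.truncn (x ord0 a * k%:R)) k.-1.
have uk a : (u a < k)%N by rewrite /u (leq_ltn_trans (geq_minr _ _))// prednK.
pose p : lattice := [ffun a => Ordinal (uk a)].
exists (enum_rank p) => //; apply/lattice_cellE => a; rewrite enum_rankK ffunE /=.
have := xX a; rewrite in_itv/= => /andP[x0 x1].
have xk0 : 0 <= x ord0 a * k%:R by rewrite mulr_ge0// ltW.
have xk1 : x ord0 a * k%:R <= k%:R by rewrite ler_piMl// ltW.
have /andP[t1 t2] := truncn_itv xk0; rewrite -natr1 in t2.
have kE : k%:R = k.-1%:R + 1 :> R by rewrite natr1 prednK.
rewrite /u; have [tk|tk] := leqP (Num.truncn (x ord0 a * k%:R)) k.-1.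
  by split=> //; left.
have kt : k%:R <= (Num.truncn (x ord0 a * k%:R))%:R :> R.
  by rewrite ler_nat; apply: leq_trans tk; rewrite prednK.
have xk : x ord0 a * k%:R = k%:R by apply/eqP; rewrite eq_le xk1 (le_trans kt).
split; first by rewrite xk ler_nat leq_pred.
right; split; first by rewrite xk.
by apply: (mulIf (lt0r_neq0 k0)); rewrite xk mul1r.
Qed.

Definition lattice_partition : xpartition R dx #|{: lattice}| :=
  XPartition side_gt0 lattice_disjoint lattice_cover.

Lemma card_lattice : #|{: lattice}| = (k ^ dx)%N.
Proof. by rewrite card_ffun !card_ord. Qed.

End lattice_partition.

(** * Tuning sequences for the rate *)

Section rate_tuning.
Context (R : realType) (d dx : nat) (q eps : R).
Hypotheses (d_gt0 : (0 < d)%N) (dx_gt0 : (0 < dx)%N).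
Hypotheses (q_gt2 : 2 < q) (eps_gt0 : 0 < eps).

Definition rate_exp : R := 2 + (q - 2)^-1 + eps.

Lemma iq_gt0 : 0 < (q - 2)^-1. Proof. by rewrite invr_gt0 subr_gt0. Qed.

Lemma rate_exp_gt0 : 0 < rate_exp.
Proof. by rewrite /rate_exp !addr_gt0// iq_gt0. Qed.

(** With n cells of side h = tau^(2 + eps) per edge, the block has a half side of
    order tau^(-1/(q - 2)) when n is of order tau^(- rate_exp). *)
Definition tau m : R := (nroot d m).+1%:R `^ (- rate_exp^-1).

Lemma tau_gt0 m : 0 < tau m.
Proof. by rewrite powR_gt0// ltr0n. Qed.

Lemma tau_le1 m : tau m <= 1.
Proof.
rewrite /tau powRN invf_le1 ?powR_gt0 ?ltr0n//.
by rewrite -[leLHS](powRr0 (nroot d m).+1%:R) ler_powR ?ler1n// invr_ge0 ltW// rate_exp_gt0.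
Qed.

Lemma tau_rate m : tau m `^ (- rate_exp) = (nroot d m).+1%:R.
Proof.
by rewrite -powRrM mulrNN mulVf ?gt_eqF ?rate_exp_gt0// powRr1.
Qed.

Lemma near_tau (e : R) : 0 < e -> \forall m \near \oo, tau m <= e.
Proof.
move=> e0; exists (`|Num.ceil (e `^ (- rate_exp))|%N ^ d)%N => //= m /= Km.
have b0 := rate_exp_gt0.
have {}Km := nroot_ge d_gt0 Km.
have K1 : e `^ (- rate_exp) <= (nroot d m).+1%:R.
  have : (Num.ceil (e `^ (- rate_exp)))%:~R <= (nroot d m)%:R :> R.
    rewrite pmulrn ler_int; apply: le_trans (_ : `|Num.ceil (e `^ (- rate_exp))|%:Z <= _).
      by rewrite abszE ler_norm.
    by rewrite lez_nat.
  have /andP[_] := ceil_itv (e `^ (- rate_exp)).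
  by rewrite -natr1; lra.
have -> : e = (e `^ (- rate_exp)) `^ (- rate_exp^-1).
  by rewrite -powRrM mulrNN mulfV ?gt_eqF// powRr1// ltW.
have : 0 < e `^ (- rate_exp) by rewrite powR_gt0.
rewrite /tau; move: (e `^ _) K1 => K K1 K0.
rewrite !powRN lef_pV2 ?posrE ?powR_gt0 ?ltr0n//.
by rewrite ge0_ler_powR ?nnegrE ?ler0n// ?invr_ge0 ltW.
Qed.

Lemma near_tau_pow (a e : R) : 0 < a -> 0 < e -> \forall m \near \oo, tau m `^ a <= e.
Proof.
move=> a0 e0; have e'0 : 0 < e `^ a^-1 by rewrite powR_gt0.
apply: filterS (near_tau e'0) => m te.
have -> : e = (e `^ a^-1) `^ a by rewrite -powRrM mulVf ?gt_eqF// powRr1// ltW.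
by rewrite ge0_ler_powR ?nnegrE ?powR_ge0// ltW// tau_gt0.
Qed.

Lemma near_tau_inv (a B : R) : 0 < a -> \forall m \near \oo, B <= tau m `^ (- a).
Proof.
move=> a0; have B0 : 0 < (`|B| + 1)^-1 by rewrite invr_gt0 ltr_wpDl.
apply: filterS (near_tau_pow a0 B0) => m; rewrite powRN => te.
apply: (@le_trans _ _ (`|B| + 1)); first by have := ler_norm B; lra.
by rewrite -[leLHS]invrK lef_pV2 ?posrE ?powR_gt0 ?tau_gt0.
Qed.

Lemma cvg_tau_squeeze (u : nat -> R) (C a : R) : 0 < a -> 0 <= C ->
  (\forall m \near \oo, 0 <= u m <= C * tau m `^ a) -> u @ \oo --> 0.
Proof.
move=> a0 C0 ub; apply/cvgrPdist_le => e e0.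
have e'0 : 0 < e / (C + 1) by rewrite divr_gt0// ltr_wpDl.
near=> m; rewrite sub0r normrN.
have /andP[u0 uC] : 0 <= u m <= C * tau m `^ a by near: m.
rewrite ger0_norm//; apply: le_trans uC _.
have te : tau m `^ a <= e / (C + 1) by near: m; exact: near_tau_pow.
apply: le_trans (ler_wpM2l C0 te) _.
by rewrite mulrA ler_pdivrMr ?ltr_wpDl// mulrC ler_pM2l//; lra.
Unshelve. all: by end_near. Qed.

Definition tau_side m : R := tau m `^ (2 + eps).
Definition tau_sigma m : R := tau m `^ (1 + eps / d%:R).
Definition tau_cells m : nat := (Num.truncn (tau m)^-1).+1.

Lemma tau_side_gt0 m : 0 < tau_side m.
Proof. by rewrite powR_gt0// tau_gt0. Qed.

Lemma tau_sigma_gt0 m : 0 < tau_sigma m.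
Proof. by rewrite powR_gt0// tau_gt0. Qed.

Lemma tau_cells_gt0 m : (0 < tau_cells m)%N. Proof. by []. Qed.

Lemma tau_gate_gt0 m : 0 < (tau_cells m)%:R ^+ 3 :> R.
Proof. by rewrite exprn_gt0// ltr0n. Qed.

(** The gate parameter K^3, with K cells per edge, makes R s = dx K, so that
    N exp(- R s) decays exponentially in K. *)
Definition rate_tuning m : tuning R d dx m :=
  Tuning (cube_partition m d_gt0 (tau_side_gt0 m))
    (lattice_partition R dx (tau_cells_gt0 m))
    (tau_gt0 m) (tau_sigma_gt0 m) (tau_gate_gt0 m).

Lemma tau_cells_ge m : (tau m)^-1 <= (tau_cells m)%:R.
Proof.
have t0 : 0 <= (tau m)^-1 by rewrite invr_ge0 ltW// tau_gt0.
by have /andP[_ /ltW] := truncn_itv t0.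
Qed.

Lemma tau_cells_le m : (tau_cells m)%:R <= 2 / tau m.
Proof.
have t0 : 0 <= (tau m)^-1 by rewrite invr_ge0 ltW// tau_gt0.
have /andP[tl _] := truncn_itv t0; rewrite /tau_cells -natr1.
have : 1 <= (tau m)^-1 by rewrite invf_ge1 ?tau_gt0// tau_le1.
lra.
Qed.

Lemma tau_cells_inv m : (tau_cells m)%:R^-1 <= tau m.
Proof.
have := tau_cells_ge m; rewrite -[leRHS]invrK.
by rewrite lef_pV2 ?posrE ?invr_gt0 ?tau_gt0 ?ltr0n.
Qed.

Lemma tau_sigmaE m : tau_sigma m = tau m * tau m `^ (eps / d%:R).
Proof.
have t0 := tau_gt0 m.
by rewrite /tau_sigma powRD ?powRr1 ?(ltW t0)// (gt_eqF t0) implybT.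
Qed.

Lemma tau_sideE m : tau_side m = tau m ^+ 2 * tau m `^ eps.
Proof.
have t0 := tau_gt0 m.
rewrite /tau_side powRD; last by rewrite (gt_eqF t0) implybT.
by rewrite powR_mulrn// ltW.
Qed.

Lemma tau_ratio m :
  tau m ^+ d.-1 * tau_side m / tau_sigma m ^+ d = tau m.
Proof.
have t0 := tau_gt0 m; have e0 : 0 < tau m `^ eps by rewrite powR_gt0.
have dn0 : d%:R != 0 :> R by rewrite pnatr_eq0 -lt0n.
have -> : tau_sigma m ^+ d = tau m * tau m ^+ d.-1 * tau m `^ eps.
  rewrite tau_sigmaE exprMn -exprS prednK//; congr (_ * _).
  have -> : tau m `^ eps = tau m `^ (eps / d%:R * d%:R) by rewrite divfK.
  by rewrite (powRrM _ (eps / d%:R)) powR_mulrn// powR_ge0.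
rewrite tau_sideE; move: (tau m) (tau m `^ _) t0 e0 => t u t0 u0.
have td0 : t ^+ d.-1 != 0 by rewrite expf_neq0// gt_eqF.
by move: (t ^+ d.-1) td0 => v v0; field; rewrite v0 !gt_eqF.
Qed.

Lemma rate_xdiag2 m : xdiag2 (rate_tuning m) = dx%:R * ((tau_cells m)%:R^-1) ^+ 2.
Proof. exact: xdiag2E. Qed.

Lemma rate_ncells m : ncells (rate_tuning m) = (tau_cells m ^ dx)%N.
Proof. exact: card_lattice. Qed.

Lemma rate_gate m : 4 * tau m <= 1 ->
  (ncells (rate_tuning m))%:R *
    expR (- (gateR (rate_tuning m) * xdiag2 (rate_tuning m))) <= 4 * tau m.
Proof.
move=> t4; have t0 := tau_gt0 m; set K : R := (tau_cells m)%:R.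
have K0 : 0 < K by rewrite ltr0n.
have -> : gateR (rate_tuning m) * xdiag2 (rate_tuning m) = dx%:R * K.
  by rewrite rate_xdiag2 /= -/K; field; rewrite gt_eqF.
rewrite rate_ncells natrX -/K -mulrN expRM_natl -exprMn.
have Ke : K * expR (- K) <= 4 * tau m.
  apply: (@le_trans _ _ (4 * K^-1)); last by rewrite ler_pM2l// tau_cells_inv.
  have e2 : K / 2 <= expR (K / 2) by apply: le_trans (expR_ge1Dx _); lra.
  have e1 : (K / 2) ^+ 2 <= expR K.
    have -> : expR K = expR (K / 2) ^+ 2.
      by rewrite expr2 -expRD; congr expR; field.
    by rewrite ler_pXn2r// nnegrE ?expR_ge0// divr_ge0// ltW.
  rewrite expRN ler_pdivrMr ?expR_gt0//; apply: le_trans (ler_wpM2l _ e1).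
    by rewrite le_eqVlt; apply/orP; left; apply/eqP; field; rewrite gt_eqF.
  by rewrite mulr_ge0// invr_ge0 ltW.
apply: (@le_trans _ _ ((4 * tau m) ^+ dx)).
  by rewrite lerXn2r// nnegrE ?mulr_ge0 ?expR_ge0// ltW.
by rewrite -[leRHS]expr1 ler_wiXn2l// mulr_ge0// ltW.
Qed.

End rate_tuning.

Section rate_tuning_conditions.
Context (R : realType) (d dx : nat) (q eps : R).
Hypotheses (d_gt0 : (0 < d)%N) (dx_gt0 : (0 < dx)%N).
Hypotheses (q_gt2 : 2 < q) (eps_gt0 : 0 < eps).
Local Notation tau := (tau d q eps).
Local Notation T := (@rate_tuning R d dx q eps d_gt0).

Lemma tau_grid m :
  (nroot d m).+1%:R * tau_side d q eps m = tau m `^ (- (q - 2)^-1).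
Proof.
rewrite -(tau_rate d q_gt2 eps_gt0 m) /tau_side -powRD; last first.
  by rewrite (gt_eqF (tau_gt0 _ _ _ _)) implybT.
by congr (_ `^ _); rewrite /rate_exp; ring.
Qed.

Lemma near_radius : \forall m \near \oo,
  tau m `^ (- (q - 2)^-1) / 4 <= (nroot d m)%:R * tau_side d q eps m / 2.
Proof.
exists 1%N => //= m m1.
have n1 : 1 <= (nroot d m)%:R :> R.
  by rewrite ler1n; apply: nroot_ge => //; rewrite exp1n.
rewrite -tau_grid -natr1; have h0 := tau_side_gt0 d q eps m.
have := ler_wpM2r (ltW h0) n1; lra.
Qed.

Lemma near_far (B : R) : \forall m \near \oo, B <= tau m `^ (- (q - 2)^-1).
Proof. by apply: (near_tau_inv d_gt0 q_gt2 eps_gt0); exact: iq_gt0. Qed.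

Lemma rate_cover m (y : 'rV[R]_d) :
  (forall a, `|y ord0 a| < (nroot d m)%:R * tau_side d q eps m / 2) ->
  ~ yrest (ypart (T m)) y.
Proof.
move=> yr; apply: cube_partition_cover => a; have := yr a.
by rewrite ltr_norml => /andP[y1 y2]; rewrite y2 ltW.
Qed.

Lemma cvg_tau : tau @ \oo --> 0.
Proof.
apply: (@cvg_tau_squeeze _ d q eps d_gt0 q_gt2 eps_gt0 _ 1 1) => //.
by near=> m; rewrite mul1r powRr1 ?lexx ltW// tau_gt0.
Unshelve. all: by end_near. Qed.

Lemma rate_ratio m : delta (T m) / sigma (T m) = tau m `^ (- (eps / d%:R)).
Proof.
rewrite /= tau_sigmaE powRN; have t0 := tau_gt0 d q eps m.
by rewrite invfM mulrA mulfV ?mul1r ?gt_eqF.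
Qed.

Lemma rate_xdiag2_le m : xdiag2 (T m) <= dx%:R * tau m ^+ 2.
Proof.
rewrite rate_xdiag2//; apply: ler_wpM2l => //; rewrite lerXn2r ?nnegrE//.
- by rewrite ltW// tau_gt0.
- exact: tau_cells_inv.
Qed.

Lemma rate_tuning_conditions : tuning_conditions T.
Proof.
have ed0 : 0 < eps / d%:R by rewrite divr_gt0// ltr0n.
split; [split|split|split].
- apply: (@cvg_tau_squeeze _ d q eps d_gt0 q_gt2 eps_gt0 _ 1 (2 + eps)) => //.
    by rewrite addr_gt0.
  by near=> m; rewrite /= mul1r /tau_side powR_ge0 lexx.
- move=> y; near=> m; apply/seteqP; split=> // z [zy].
  apply: rate_cover => a; have /= := zy a.
  have : `|y ord0 a| <= enorm y by exact: coord_enorm.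
  have := ler_distD 0 (z ord0 a) (y ord0 a).
  have t1 : tau m <= 1 by exact: tau_le1.
  have fa : 4 * (enorm y + 1) <= tau m `^ (- (q - 2)^-1) by near: m; exact: near_far.
  have ra : tau m `^ (- (q - 2)^-1) / 4 <= (nroot d m)%:R * tau_side d q eps m / 2.
    by near: m; exact: near_radius.
  have := ler_normD (z ord0 a - y ord0 a) (y ord0 a); rewrite subrK; lra.
- exact: cvg_tau.
- apply: (@cvg_tau_squeeze _ d q eps d_gt0 q_gt2 eps_gt0 _ 1 (eps / d%:R)) => //.
  near=> m; rewrite -invf_div rate_ratio powRN invrK mul1r lexx.
  by rewrite powR_ge0.
- rewrite /=; under eq_fun do rewrite tau_ratio//.
  exact: cvg_tau.
- apply/cvgryPge => A; near=> m.
  apply: le_trans (_ : (tau m)^-1 <= _).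
    have : A <= tau m `^ (- 1) by near: m; exact: near_tau_inv.
    by rewrite powR_inv1// ltW// tau_gt0.
  apply: le_trans (tau_cells_ge _ _ _ _) _.
  by rewrite -[leLHS]expr1 /= ler_weXn2l// ler1n.
- apply: (@cvg_tau_squeeze _ d q eps d_gt0 q_gt2 eps_gt0 _ dx%:R 2) => //.
  near=> m; rewrite ltW ?xdiag2_gt0//= powR_mulrn ?rate_xdiag2_le//.
  by rewrite ltW// tau_gt0.
- apply: (@cvg_tau_squeeze _ d q eps d_gt0 q_gt2 eps_gt0 _ 4 1) => //.
  near=> m; cbv beta; set e := expR _ / _.
  have e0 : 0 <= e by rewrite divr_ge0 ?expR_ge0 ?powR_ge0.
  rewrite e0 /= powRr1; last by rewrite ltW// tau_gt0.
  have t4 : tau m <= 4^-1 by near: m; apply: near_tau.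
  have := @rate_gate R d dx q eps d_gt0 dx_gt0 m.
  rewrite -ncellsE// -/e => H; apply: le_trans (H _); last by lra.
  rewrite ler_peMl// -[leLHS](powRr0 dx%:R) ler_powR ?ler1n//.
Unshelve. all: by end_near. Qed.

End rate_tuning_conditions.

Section moments.
Context (R : realType) (d : nat) (q : R).
Hypothesis q_gt2 : 2 < q.
Implicit Types y : 'rV[R]_d.

Definition moment y : R := \sum_(a < d) `|y ord0 a| `^ q.

Lemma moment_ge0 y : 0 <= moment y.
Proof. by apply: sumr_ge0 => a _; exact: powR_ge0. Qed.

Lemma sqr_le_moment (L : R) y a : 0 < L -> L <= `|y ord0 a| ->
  L `^ (q - 2) * `|y ord0 a| ^+ 2 <= moment y.
Proof.
move=> L0 La; have u0 : 0 < `|y ord0 a| by exact: lt_le_trans La.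
apply: (@le_trans _ _ (`|y ord0 a| `^ q)); last first.
  by rewrite /moment (bigD1 a)//= lerDl sumr_ge0// => b _; exact: powR_ge0.
have -> : `|y ord0 a| `^ q = `|y ord0 a| `^ (q - 2) * `|y ord0 a| ^+ 2.
  rewrite -powR_mulrn ?ltW// -powRD ?subrK//.
  by rewrite (gt_eqF u0) implybT.
apply: ler_wpM2r; first exact: sqr_ge0.
by rewrite ge0_ler_powR ?nnegrE ?(ltW L0) ?(ltW u0)// subr_ge0 ltW.
Qed.

(** A coordinate beyond L satisfies u^2 <= u^q / L^(q-2), and the smaller ones are
    dominated by it. *)
Lemma far_moment (L : R) y : 0 < L ->
  (exists a, L <= `|y ord0 a|) ->
  let X := moment y / L `^ (q - 2) in
  L ^+ 2 <= X /\ forall k, y ord0 k ^+ 2 <= X.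
Proof.
move=> L0 [a La] X; have K0 : 0 < L `^ (q - 2) by rewrite powR_gt0.
have far b : L <= `|y ord0 b| -> `|y ord0 b| ^+ 2 <= X.
  by move=> Lb; rewrite /X ler_pdivlMr// mulrC; exact: sqr_le_moment.
have LX : L ^+ 2 <= X.
  by apply: le_trans (far _ La); rewrite lerXn2r ?nnegrE// ltW.
split=> // k; rewrite -real_normK ?num_real//.
have [/ltW kL|] := ltP `|y ord0 k| L; last exact: far.
by apply: le_trans LX; rewrite lerXn2r ?nnegrE// ltW.
Qed.

End moments.

(** An exponential beats the power of degree k in t^(-2a), and k is chosen so
    large that this power is at least 1 / t. *)
Lemma expR_powR_decay (R : realType) (a : R) : 0 < a ->
  exists2 C : R, 0 <= C & forall t : R, 0 < t <= 1 ->
    expR (- ((t `^ (- a)) ^+ 2 / 8)) <= C * t.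
Proof.
move=> a0; pose k := (Num.truncn (a * 2)^-1).+1.
have a20 : 0 < a * 2 by rewrite mulr_gt0.
have k0 : 0 < k%:R :> R by rewrite ltr0n.
have ak : 1 <= a * 2 * k%:R.
  have i0 : 0 <= (a * 2)^-1 by rewrite invr_ge0 ltW.
  have /andP[_ /ltW] := truncn_itv i0.
  by move/(ler_wpM2l (ltW a20)); rewrite mulfV// gt_eqF.
exists ((8 * k%:R) ^+ k) => [|t /andP[t0 t1]].
  by rewrite exprn_ge0// mulr_ge0// ltW.
set Y := (t `^ (- a)) ^+ 2; have Y0 : 0 < Y by rewrite exprn_gt0// powR_gt0.
have Yk : t^-1 <= Y ^+ k.
  rewrite /Y -exprM -powR_mulrn ?powR_ge0// -powRrM mulNr powRN lef_pV2 ?posrE ?powR_gt0//.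
  rewrite -[leRHS](powRr1 (ltW t0)) natrM mulrA.
  by apply: ger_powR ak; rewrite t0.
rewrite expRN -[leRHS]invrK invfM lef_pV2 ?posrE ?expR_gt0//; last first.
  by rewrite mulr_gt0 ?invr_gt0 ?exprn_gt0// mulr_gt0.
have e1 : Y / 8 / k%:R <= expR (Y / 8 / k%:R) by apply: le_trans (expR_ge1Dx _); lra.
have -> : expR (Y / 8) = expR (Y / 8 / k%:R) ^+ k.
  by rewrite -expRM_natl [k%:R * _]mulrC divfK// gt_eqF.
apply: (@le_trans _ _ ((Y / 8 / k%:R) ^+ k)).
  have -> : Y / 8 / k%:R = Y * (8 * k%:R)^-1 by rewrite -mulrA -invfM.
  rewrite [leRHS]exprMn exprVn [leLHS]mulrC.
  by rewrite ler_wpM2r ?invr_ge0 ?exprn_ge0// mulr_ge0// ltW.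
by rewrite lerXn2r ?nnegrE ?expR_ge0// !divr_ge0// ltW.
Qed.

(** * The rate *)

Section far_cost.
Context (R : realType) (d : nat) (r sigma0 : R).
Hypotheses (r_gt0 : 0 < r) (sigma0_gt0 : 0 < sigma0).

Definition log_norm : R := ln ((2 * pi * sigma0 ^+ 2) `^ (d%:R / 2)).

Lemma rest_costD (rho : R) (y : 'rV[R]_d) : 0 < rho ->
  rest_cost sigma0 rho y =
  dotrV y y / (2 * sigma0 ^+ 2) - d%:R * ln (rho / 2) + log_norm.
Proof.
move=> rho0; have Z0 : 0 < 2 * pi * sigma0 ^+ 2.
  by rewrite !mulr_gt0// ?pi_gt0 ?exprn_gt0.
have h0 : 0 < rho / 2 by rewrite divr_gt0.
rewrite /rest_cost /log_norm; move: Z0; move: (2 * pi * _) => Z Z0.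
have -> : ln ((rho / 2) ^+ d / Z `^ (d%:R / 2)) =
    ln ((rho / 2) ^+ d) - ln (Z `^ (d%:R / 2)).
  by rewrite ln_div// posrE ?exprn_gt0// powR_gt0.
by rewrite lnXn// -[ln _ *+ d]mulr_natl opprB addrA [LHS]addrAC.
Qed.

Definition far_const (B : R) : R :=
  Num.sqrt d%:R / 2 + d%:R / (2 * sigma0 ^+ 2) + d%:R * B +
  d%:R * `|ln (r / 2)| + `|log_norm|.

(** Shrinking the radius r with the local slope S keeps the variation of ln f
    over the cube below a constant, at the price of ln (1 + r S). The inequality
    ln u <= - ln t + t u makes the coefficient of S as small as t, and the term
    - ln t is affordable because X is large far from the origin. *)
Lemma far_cost_le (B S t X : R) (y : 'rV[R]_d) :
  0 <= S -> 0 < t -> 1 <= X -> - ln t <= B * X -> dotrV y y <= d%:R * X ->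
  forall rho : R, rho = r / (1 + r * S) ->
  S * (rho * (Num.sqrt d%:R / 2)) + rest_cost sigma0 rho y <=
  far_const B * X + t * (d%:R * (1 + r)) * (1 + S).
Proof.
move=> S0 t0 X1 tB yX rho rhoE; have X0 : 0 <= X by lra.
have rS : 0 <= r * S by rewrite mulr_ge0// ltW.
have rS0 : 0 < 1 + r * S by lra.
have rho0 : 0 < rho by rewrite rhoE divr_gt0.
have d0 : 0 <= d%:R :> R by [].
have w0 : 0 <= Num.sqrt d%:R / 2 :> R by rewrite divr_ge0.
have s0 : 0 <= (2 * sigma0 ^+ 2)^-1 by rewrite invr_ge0 mulr_ge0// exprn_ge0// ltW.
have b1 : S * (rho * (Num.sqrt d%:R / 2)) <= Num.sqrt d%:R / 2 * X.
  apply: (@le_trans _ _ (Num.sqrt d%:R / 2)); last by rewrite ler_peMr.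
  rewrite mulrA; apply: ler_piMl => //.
  by rewrite rhoE mulrA ler_pdivrMr// mul1r [S * r]mulrC; lra.
have b2 : dotrV y y / (2 * sigma0 ^+ 2) <= d%:R / (2 * sigma0 ^+ 2) * X.
  by rewrite mulrAC; exact: ler_wpM2r.
have lnrho : ln (rho / 2) = ln (r / 2) - ln (1 + r * S).
  have r2 : 0 < r / 2 by rewrite divr_gt0.
  have -> : rho / 2 = r / 2 / (1 + r * S) by rewrite rhoE mulrAC.
  by rewrite ln_div ?posrE.
have b3 : ln (1 + r * S) <= - ln t + t * (1 + r * S).
  have : ln (t * (1 + r * S)) <= t * (1 + r * S).
    by apply/ltW/ln_sublinear; rewrite mulr_gt0.
  by rewrite lnM ?posrE//; lra.
have b4 : t * (1 + r * S) <= t * ((1 + r) * (1 + S)).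
  rewrite ler_pM2l//; have : 0 <= r by exact: ltW.
  lra.
have b5 : d%:R * ln (1 + r * S) <= d%:R * B * X + d%:R * (t * ((1 + r) * (1 + S))).
  by rewrite -mulrA -mulrDr; apply: ler_wpM2l => //; lra.
have b6 : - (d%:R * ln (r / 2)) <= d%:R * `|ln (r / 2)| * X.
  apply: (@le_trans _ _ (d%:R * `|ln (r / 2)|)).
    by rewrite -mulrN; apply: ler_wpM2l => //; rewrite -normrN ler_norm.
  by rewrite ler_peMr// mulr_ge0.
have b7 : log_norm <= `|log_norm| * X.
  by apply: le_trans (ler_norm _) _; rewrite ler_peMr.
rewrite rest_costD// lnrho /far_const.
have -> : t * (d%:R * (1 + r)) * (1 + S) = d%:R * (t * ((1 + r) * (1 + S))) by ring.
lra.
Qed.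

End far_cost.

Section rate.
Context (R : realType) (d dx : nat).
Variables (F : probability ('rV[R]_d * 'rV[R]_dx)%type R)
  (nu : {measure set 'rV[R]_dx -> \bar R})
  (f : 'rV[R]_d * 'rV[R]_dx -> R) (g : 'rV[R]_dx -> R) (r sigma0 q eps : R).
Local Notation YX := ([set: 'rV[R]_d] `*` @ucube R dx).
Hypotheses (d_gt0 : (0 < d)%N) (dx_gt0 : (0 < dx)%N).
Hypothesis Fdens : has_densities F nu f g.
Hypotheses (r_gt0 : 0 < r) (sigma0_gt0 : 0 < sigma0).
Hypothesis Ftarget : target_conditions F f r sigma0.
Hypotheses (q_gt2 : 2 < q) (eps_gt0 : 0 < eps).
Local Notation tau := (tau d q eps).
Local Notation T := (@rate_tuning R d dx q eps d_gt0).
Let condT := @rate_tuning_conditions R d dx q eps d_gt0 dx_gt0 q_gt2 eps_gt0.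

(** A point of near_rest has a coordinate beyond L = tau^(-1/(q - 2)) / 8, which
    is half the half side of the block; then L^(q - 2) is 1 / tau up to the factor
    8^(q - 2). *)
Lemma near_rest_moment : \forall m \near \oo, forall p, near_rest (T m) p ->
  let X := 8 `^ (q - 2) * tau m * moment q p.1 in
  [/\ 1 <= X, - ln (tau m) <= 8 * (q - 2) * X & forall k, p.1 ord0 k ^+ 2 <= X].
Proof.
near=> m; move=> -[y x] [_ /= [z [zy zrest]]]; set X := _ * moment q y.
have t0 := tau_gt0 d q eps m.
have : tau m `^ (- (q - 2)^-1) / 4 <= (nroot d m)%:R * tau_side d q eps m / 2.
  by near: m; exact: near_radius.
have : 8 <= tau m `^ (- (q - 2)^-1) by near: m; exact: near_far.
set W := tau m `^ _ => W8 radius; have W0 : 0 < W by lra.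
have t1 : tau m <= 1 by exact: tau_le1.
have far : exists a, W / 8 <= `|y ord0 a|.
  apply: contrapT => H; move: zrest; apply: rate_cover => // a.
  have ya : `|y ord0 a| < W / 8.
    by rewrite ltNge; apply/negP => Wa; apply: H; exists a.
  have := zy a; have := ler_normD (z ord0 a - y ord0 a) (y ord0 a).
  by rewrite subrK /=; lra.
have q2 : 0 < q - 2 by rewrite subr_gt0.
have WX : moment q y / (W / 8) `^ (q - 2) = X.
  have W1 : W `^ (q - 2) = (tau m)^-1.
    by rewrite /W -powRrM mulNr mulVf ?gt_eqF// powR_inv1// ltW.
  have L1 : (W / 8) `^ (q - 2) * 8 `^ (q - 2) = (tau m)^-1.
    by rewrite -powRM ?divr_ge0 ?(ltW W0)// divfK.
  have e0 : 0 < 8 `^ (q - 2) :> R by rewrite powR_gt0.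
  have -> : (W / 8) `^ (q - 2) = (tau m)^-1 / 8 `^ (q - 2).
    by rewrite -L1 mulfK// gt_eqF.
  by rewrite /X; move: (8 `^ _) e0 => k k0; field; rewrite !gt_eqF.
have [] := @far_moment R d q q_gt2 (W / 8) y _ far; first by rewrite divr_gt0.
rewrite WX => LX yX; have L1 : 1 <= W / 8 by lra.
have LL : W / 8 <= (W / 8) ^+ 2 by rewrite expr2 ler_peMl; lra.
split=> //; first by lra.
have lnW : ln W = - (q - 2)^-1 * ln (tau m) by rewrite ln_powR.
have : ln W < W by exact: ln_sublinear.
move=> lW; have -> : - ln (tau m) = (q - 2) * ln W.
  by rewrite lnW mulNr mulrN mulVKf ?gt_eqF.
rewrite [8 * _]mulrC -mulrA ler_pM2l//; lra.
Unshelve. all: by end_near. Qed.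

Lemma combine_bounds (a b c u v w L : R) :
  0 <= a -> 0 <= b -> 0 <= c -> 0 <= u -> 0 <= v -> 0 <= w ->
  L <= a * u + b * v + c * w -> L <= (a + b + c) * (u + v + w).
Proof.
move=> a0 b0 c0 u0 v0 w0.
have := (mulr_ge0 a0 v0, mulr_ge0 a0 w0, mulr_ge0 b0 u0, mulr_ge0 b0 w0,
  mulr_ge0 c0 u0, mulr_ge0 c0 v0).
move=> [[[[[h1 h2] h3] h4] h5] h6]; lra.
Qed.

Lemma rate_sum_term : exists2 C : R, 0 <= C & forall m, sum_term (T m) = C * tau m.
Proof.
exists (2 * (3 * d%:R `^ (3 / 2) / (2 * pi) `^ (d%:R / 2))) => [|m].
  by rewrite !mulr_ge0 ?invr_ge0 ?powR_ge0.
rewrite /sum_term /= -[in RHS](tau_ratio q eps d_gt0 m) invfM.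
ring.
Qed.

(** Near A_0 every cost is at most a multiple of X = 8^(q - 2) tau sum_a |y_a|^q,
    because X is at least one there; this includes the constant loss of the
    position next to the block. *)
Lemma near_ln_ratio : exists2 C : R, 0 < C &
  \forall m \near \oo, forall y x (S : R), ucube x ->
    sup_dlog f r r (y, x) = S%:E ->
    ln (f (y, x) / model3 f sigma0 (T m) (y, x)) <=
    C * (tau m + tau m * S + tau m * moment q y).
Proof.
have [c1 c10 sumE] := rate_sum_term.
have ed0 : 0 < eps / d%:R by rewrite divr_gt0// ltr0n.
have [c2 c20 tailE] := expR_powR_decay ed0.
pose kap : R := 8 `^ (q - 2); have kap0 : 0 <= kap by exact: powR_ge0.
pose B : R := 8 * (q - 2).
have B0 : 0 <= B by rewrite mulr_ge0// subr_ge0 ltW.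
pose K := far_const d r sigma0 B.
have K0 : 0 <= K.
  have s0 : 0 <= 2 * sigma0 ^+ 2 by rewrite mulr_ge0// sqr_ge0.
  have k1 : 0 <= d%:R * B by rewrite mulr_ge0.
  have k2 : 0 <= d%:R * `|ln (r / 2)| by rewrite mulr_ge0.
  have k3 : 0 <= d%:R / (2 * sigma0 ^+ 2) by rewrite divr_ge0.
  have k4 : 0 <= Num.sqrt d%:R / 2 :> R by rewrite divr_ge0 ?sqrtr_ge0.
  by rewrite /K /far_const !addr_ge0.
have l20 : 0 <= d.+1%:R * ln 2 :> R by rewrite mulr_ge0// ln_ge0//; lra.
have r1 : 0 <= d%:R * (1 + r) by rewrite mulr_ge0// addr_ge0// ltW.
have sd0 : 0 <= Num.sqrt d%:R / 2 :> R by rewrite divr_ge0.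
have sx0 : 0 <= Num.sqrt dx%:R :> R by exact: sqrtr_ge0.
(* Coefficients of tau, of tau S and of tau times the moment. *)
pose a := Num.sqrt dx%:R + 8 + c1 + 2 * c2 + d%:R * (1 + r).
pose b := Num.sqrt d%:R / 2 + Num.sqrt dx%:R + d%:R * (1 + r).
pose c := (d.+1%:R * ln 2 + K) * kap.
have a0 : 0 < a by rewrite /a; lra.
have b0 : 0 <= b by rewrite /b; lra.
have c0 : 0 <= c by rewrite mulr_ge0// addr_ge0.
exists (a + b + c); first by lra.
near=> m; move=> y x S xX SE.
have t0 := tau_gt0 d q eps m; have t1 : tau m <= 1 by exact: tau_le1.
have t8 : tau m <= 8^-1 by near: m; apply: near_tau.
have [th [eta [adm th0 eta0 e3 geq]]] : exists theta eta : R,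
  [/\ admissible r (T m) theta eta, 0 <= theta, 0 <= eta,
      3 / 2 * d%:R * err2 (T m) <= sum_term (T m) + tail_term (T m) &
      - ln (1 - eta) <=
      (1 - theta) * Num.sqrt (xdiag2 (T m)) * 1 + gate_term (T m)].
  by near: m; apply: (near_admissible d_gt0 dx_gt0 condT).
have th1 : th <= 1 by case: adm => [[]].
have dr : delta (T m) <= r by near: m; exact: (near_delta_le condT).
have sr : Num.sqrt (xdiag2 (T m)) <= r by near: m; exact: (near_diag_le dx_gt0 condT).
have far : forall p, near_rest (T m) p ->
  let X := 8 `^ (q - 2) * tau m * moment q p.1 in
  [/\ 1 <= X, - ln (tau m) <= 8 * (q - 2) * X & forall k, p.1 ord0 k ^+ 2 <= X].
  by near: m; exact: near_rest_moment.
have Sle : (sup_dlog f r r (y, x) <= S%:E)%E by rewrite SE.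
have S0 : 0 <= S by rewrite -lee_fin -SE; exact: sup_rr_ge0.
have Sle1 : (sup_dlog f (delta (T m)) (Num.sqrt (xdiag2 (T m))) (y, x) <= S%:E)%E.
  by apply: le_trans Sle; exact: le_sup_dlog.
have rS : 0 < 1 + r * S by rewrite ltr_wpDr// mulr_ge0// ltW.
have rho0 : 0 < r / (1 + r * S) by rewrite divr_gt0.
have rhor : r / (1 + r * S) <= r.
  by rewrite ler_pdivrMr// ler_peMr ?(ltW r_gt0)// lerDl mulr_ge0// ltW.
have := ln_ratio_cases Fdens (target_gt0 Ftarget) (target_C1 Ftarget) sigma0_gt0
    S adm rho0 rhor xX Sle1.
rewrite /=; set L := ln (_ / _).
have sqt : Num.sqrt (xdiag2 (T m)) <= Num.sqrt dx%:R * tau m.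
  have -> : Num.sqrt dx%:R * tau m = Num.sqrt (dx%:R * tau m ^+ 2).
    by rewrite sqrtrM// sqrtr_sqr gtr0_norm.
  by rewrite ler_wsqrtr// rate_xdiag2_le.
have sq0 : 0 <= Num.sqrt (xdiag2 (T m)) by exact: sqrtr_ge0.
have gate8 : gate_term (T m) <= 8 * tau m.
  have gle : (ncells (T m))%:R * expR (- (gateR (T m) * xdiag2 (T m))) <= 4 * tau m.
    by apply: rate_gate => //; lra.
  rewrite gate_termE//; apply: le_trans (ln_defect_le _ _) _; last by lra.
    by rewrite mulr_ge0// expR_ge0.
  by lra.
have tail2 : tail_term (T m) <= 2 * (c2 * tau m).
  rewrite /tail_term rate_ratio ler_pM2l//; apply: tailE.
  by rewrite t0.
rewrite (sumE m) in e3.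
set A := S * _ - ln _.
have Ab : A <= tau m * ((Num.sqrt d%:R / 2 + Num.sqrt dx%:R) * S) +
    tau m * (Num.sqrt dx%:R + 8).
  have h1 := ler_wpM2l th0 sqt.
  have h2 : (1 - th) * Num.sqrt (xdiag2 (T m)) <= (1 - th) * (Num.sqrt dx%:R * tau m).
    by apply: ler_wpM2l => //; rewrite subr_ge0.
  have h3 : th * (Num.sqrt dx%:R * tau m) <= Num.sqrt dx%:R * tau m.
    by rewrite ler_piMl// mulr_ge0// ltW.
  have h4 : 0 <= th * (Num.sqrt dx%:R * tau m) by rewrite !mulr_ge0// ltW.
  have h5 : S * (tau m * (Num.sqrt d%:R / 2) + th * Num.sqrt (xdiag2 (T m))) <=
      S * (tau m * (Num.sqrt d%:R / 2) + Num.sqrt dx%:R * tau m).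
    by apply: ler_wpM2l => //; lra.
  rewrite /A /=; lra.
have M0 : 0 <= moment q y by exact: moment_ge0.
have v0 : 0 <= tau m * S by rewrite mulr_ge0// ltW.
have w0 : 0 <= tau m * moment q y by rewrite mulr_ge0// ltW.
have u0 := ltW t0.
have p5 := mulr_ge0 c10 u0; have p6 := mulr_ge0 c20 u0.
have p1 := mulr_ge0 r1 u0; have p2 := mulr_ge0 r1 v0.
have p3 := mulr_ge0 (mulr_ge0 l20 kap0) w0; have p4 := mulr_ge0 (mulr_ge0 K0 kap0) w0.
move=> cases; apply: combine_bounds => //; first exact: ltW.
clearbody L A; rewrite /a /b /c.
clear geq th0 th1 eta0 adm dr sr Sle1 rS rho0 rhor sqt sq0 gate8 t8 t1 a0 b0 c0 a b c sumE tailE.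
case: cases => [Lle|[nr Lle]]; first by lra.
have [] := far _ nr; rewrite /= -/kap -/B; set X := kap * _ * _ => X1 tX yX.
have XE : X = kap * (tau m * moment q y) by rewrite /X mulrA.
case: Lle => [Lle|/(_ Sle) Lle].
  have h := ler_wpM2l l20 X1; move: h; rewrite XE mulr1; lra.
have yy : dotrV y y <= d%:R * X.
  rewrite /dotrV mulr_natl -[d in _ *+ d]card_ord -sumr_const.
  by apply: ler_sum => k _; rewrite -expr2.
have := far_cost_le r_gt0 sigma0_gt0 S0 t0 X1 tX yy erefl.
rewrite -/K XE; lra.
Unshelve. all: by end_near. Qed.

End rate.

Section integrated_rate.
Context (R : realType) (d dx : nat).
Variables (F : probability ('rV[R]_d * 'rV[R]_dx)%type R)
  (nu : {measure set 'rV[R]_dx -> \bar R})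
  (f : 'rV[R]_d * 'rV[R]_dx -> R) (g : 'rV[R]_dx -> R) (r sigma0 q eps : R).
Local Notation YX := ([set: 'rV[R]_d] `*` @ucube R dx).
Hypotheses (d_gt0 : (0 < d)%N) (dx_gt0 : (0 < dx)%N).
Hypothesis Fdens : has_densities F nu f g.
Hypotheses (r_gt0 : 0 < r) (sigma0_gt0 : 0 < sigma0).
Hypothesis Ftarget : target_conditions F f r sigma0.
Hypotheses (q_gt2 : 2 < q) (eps_gt0 : 0 < eps).
Hypothesis q_moments : forall i,
  (\int[F]_(p in YX) (`|p.1 ord0 i| `^ q)%:E < +oo)%E.
Local Notation tau := (tau d q eps).
Local Notation T := (@rate_tuning R d dx q eps d_gt0).

Lemma measurable_coord_powR (i : 'I_d) : measurable_fun setT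
  (fun p : 'rV[R]_d * 'rV[R]_dx => (`|p.1 ord0 i| `^ q)%:E).
Proof.
apply/measurable_EFinP/(measurableT_comp (measurable_powR q)).
apply: (measurableT_comp (@normr_measurable R setT)).
exact: (measurableT_comp (measurable_coord i) measurable_fst).
Qed.

Lemma measurable_moment : measurable_fun setT
  (fun p : 'rV[R]_d * 'rV[R]_dx => (moment q p.1)%:E).
Proof.
apply/measurable_EFinP; apply: (@measurable_sum _ _ _ _ _ _
  (fun (i : 'I_d) (p : 'rV[R]_d * 'rV[R]_dx) => `|p.1 ord0 i| `^ q)) => i.
by apply/measurable_EFinP; exact: measurable_coord_powR.
Qed.

Lemma integral_moment_fin :
  exists2 c : R, 0 <= c & (\int[F]_(p in YX) (moment q p.1)%:E = c%:E)%E.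
Proof.
have mYX := @measurable_YX R d dx.
have -> : (\int[F]_(p in YX) (moment q p.1)%:E =
    \sum_(i < d) \int[F]_(p in YX) (`|p.1 ord0 i| `^ q)%:E)%E.
  rewrite -ge0_integral_sum//.
    by apply: eq_integral => p _; rewrite /moment sumEFin.
  by move=> i; apply: measurable_funTS; exact: measurable_coord_powR.
have i0 (i : 'I_d) : (0 <= \int[F]_(p in YX) (`|p.1 ord0 i| `^ q)%:E)%E.
  by apply: integral_ge0 => p _; rewrite lee_fin powR_ge0.
set s := (\sum_(i < d) _)%E; exists (fine s).
  by rewrite fine_ge0// sume_ge0.
rewrite fineK// /s; apply/sum_fin_numP => i _ _.
by rewrite ge0_fin_numE.
Qed.

Lemma kl_le_tau : exists2 C : R, 0 <= C &
  \forall m \near \oo, (kl F f (model3 f sigma0 (T m)) <= (C * tau m)%:E)%E.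
Proof.
have [C C0 H] := near_ln_ratio d_gt0 dx_gt0 Fdens r_gt0 sigma0_gt0 Ftarget q_gt2 eps_gt0.
have [cM cM0 ME] := integral_moment_fin.
have [cS cS0 SE] := integral_sup_rr_fin r_gt0 Ftarget.
exists (C * (1 + (cS + cM))) => [|]; first by rewrite mulr_ge0 ?(ltW C0)// !addr_ge0.
apply: filterS H => m Hm; have t0 := tau_gt0 d q eps m.
have Ct0 : 0 < C * tau m by rewrite mulr_gt0.
have mYX := @measurable_YX R d dx.
have M0 (p : 'rV[R]_d * 'rV[R]_dx) : (0 <= (moment q p.1)%:E)%E.
  by rewrite lee_fin moment_ge0.
have S0 p : YX p -> (0 <= sup_dlog f r r p)%E by exact: sup_rr_ge0.
have mS : measurable_fun YX (sup_dlog f r r) by exact: (measurable_target_sup Ftarget).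
have mM : measurable_fun YX (fun p => (moment q p.1)%:E).
  by apply: measurable_funTS; exact: measurable_moment.
pose h p := (1%:E + (sup_dlog f r r p + (moment q p.1)%:E))%E.
have h0 p : YX p -> (0 <= h p)%E.
  by move=> YXp; apply: adde_ge0 => //; apply: adde_ge0 => //; exact: S0.
have mSM : measurable_fun YX (fun p => sup_dlog f r r p + (moment q p.1)%:E)%E.
  exact: emeasurable_funD.
have mh : measurable_fun YX h by exact: emeasurable_funD.
apply: (@le_trans _ _ (\int[F]_(p in YX) ((C * tau m)%:E * h p))%E).
  apply: le_integral_upper => -[y x] YXp.
    by rewrite mule_ge0 ?lee_fin ?(ltW Ct0)// h0.
  have xX : ucube x by case: YXp.
  have [Sfin|] := boolP (sup_dlog f r r (y, x) \is a fin_num); last first.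
    rewrite ge0_fin_numE ?S0// -leNgt leye_eq => /eqP Soo.
    by rewrite /h Soo addye// addey// gt0_muley ?lte_fin// leey.
  have := Hm y x (fine (sup_dlog f r r (y, x))) xX; rewrite fineK// => /(_ erefl).
  rewrite /h; set L := ln _; rewrite -{2}(fineK Sfin) -!EFinD -EFinM lee_fin /=.
  by move=> Lle; apply: le_trans Lle _; rewrite -mulrA !mulrDr !mulr1 addrA.
rewrite ge0_integralZl_EFin ?(ltW Ct0)//.
rewrite ge0_integralD//; last first.
  by move=> p YXp; apply: adde_ge0 => //; exact: S0.
rewrite integral_cst// ge0_integralD// SE ME mul1e.
rewrite mulrAC [leRHS]EFinM.
apply: lee_wpmul2l; first by rewrite lee_fin ltW.
rewrite [leRHS]EFinD; apply: leeD => //.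
exact: probability_le1.
Qed.

(** The number of cells of Y is less than (n + 1)^d = tau^(- d rate_exp), and that
    of X is at most (2 / tau)^dx. *)
Lemma tau_le_rate m : (0 < m)%N ->
  tau m <= 2 `^ (dx%:R / (dx%:R + d%:R * rate_exp q eps)) * kl_rate q eps (T m).
Proof.
move=> m0; set D : R := dx%:R + d%:R * rate_exp q eps.
have e0 := rate_exp_gt0 q_gt2 eps_gt0.
have D0 : 0 < D by rewrite ltr_wpDl// mulr_gt0// ltr0n.
have t0 := tau_gt0 d q eps m.
have N0 : (0 < ncells (T m))%N by rewrite rate_ncells expn_gt0.
have mN : (m * ncells (T m))%:R <= 2 `^ dx%:R * tau m `^ (- D).
  rewrite natrM rate_ncells natrX.
  have mt : m%:R <= (nroot d m).+1%:R ^+ d :> R.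
    by rewrite -natrX ler_nat ltnW// nroot_lt.
  have Nt : (tau_cells d q eps m)%:R ^+ dx <= (2 / tau m) ^+ dx :> R.
    by rewrite lerXn2r ?nnegrE ?divr_ge0 ?(ltW t0)// tau_cells_le.
  have K0 : 0 <= (tau_cells d q eps m)%:R ^+ dx :> R by rewrite exprn_ge0.
  apply: le_trans (ler_pM (ler0n _ _) K0 mt Nt) _.
  rewrite -(tau_rate d q_gt2 eps_gt0 m) exprMn exprVn.
  have -> : tau m `^ (- D) = (tau m `^ (- rate_exp q eps)) ^+ d * (tau m ^+ dx)^-1.
    rewrite -powR_mulrn ?powR_ge0// -powRrM -powR_mulrn ?(ltW t0)// -powRN -powRD.
      by congr (_ `^ _); rewrite /D; ring.
    by rewrite (gt_eqF t0) implybT.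
  by rewrite powR_mulrn//; lra.
have mN0 : 0 < (m * ncells (T m))%:R :> R by rewrite ltr0n muln_gt0 m0.
have -> : kl_rate q eps (T m) = (m * ncells (T m))%:R `^ (- D^-1) by [].
rewrite powRN ler_pdivlMr ?powR_gt0//.
have : (m * ncells (T m))%:R `^ D^-1 <= (2 `^ dx%:R * tau m `^ (- D)) `^ D^-1.
  by rewrite ge0_ler_powR ?nnegrE ?mulr_ge0 ?powR_ge0// ?invr_ge0 ltW.
have -> : (2 `^ dx%:R * tau m `^ (- D)) `^ D^-1 = 2 `^ (dx%:R / D) / tau m.
  by rewrite powRM ?powR_ge0// -(powRrM 2) -(powRrM (tau m) (- D)) mulNr (mulfV (lt0r_neq0 D0)) powR_inv1// ltW.
by rewrite ler_pdivlMr// mulrC.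
Qed.

End integrated_rate.

Theorem corollary4p1 (R : realType) (d dx : nat)
    (F : probability ('rV[R]_d * 'rV[R]_dx)%type R)
    (nu : {measure set 'rV[R]_dx -> \bar R})
    (f : 'rV[R]_d * 'rV[R]_dx -> R) (g : 'rV[R]_dx -> R)
    (r sigma0 : R)
    (d_gt0 : (0 < d)%N) (dx_gt0 : (0 < dx)%N)
    (Fdens : has_densities F nu f g)
    (r_gt0 : 0 < r) (sigma0_gt0 : 0 < sigma0)
    (Ftarget : target_conditions F f r sigma0) :
  (forall T : (forall m, tuning R d dx m), tuning_conditions T ->
     (\forall m \near \oo,
        (kl F f (model3 f sigma0 (T m)) <=
         \sum_(t <- kl_bound_terms F f r sigma0 (T m)) t)%E) /\
     (forall k, (k < 6)%N ->
        (fun m => nth 0%E (kl_bound_terms F f r sigma0 (T m)) k) @ \oo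
          --> 0%E)) /\
  (forall (q : R) (i1 : 'I_d), 2 < q ->
     (forall i, (\int[F]_(p in [set: 'rV[R]_d] `*` @ucube R dx)
        (`|p.1 ord0 i| `^ q)%:E < +oo)%E) ->
     (\int[F]_(p in [set: 'rV[R]_d] `*` @ucube R dx)
        ((`|p.1 ord0 i1| `^ (q - 2))%:E * sup_dlog f r r p) < +oo)%E ->
     forall eps : R, 0 < eps ->
     exists T : (forall m, tuning R d dx m), tuning_conditions T /\
       exists C : R, \forall m \near \oo,
         (kl F f (model3 f sigma0 (T m)) <= (C * kl_rate q eps (T m))%:E)%E).
Proof.
split=> [T condT|q i1 q2 qm _ eps eps0].
  split; first exact: (kl_bound_eventually d_gt0 dx_gt0 Fdens r_gt0 sigma0_gt0).
  exact: (kl_bound_terms_cvg dx_gt0 r_gt0 sigma0_gt0 Ftarget condT).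
exists (rate_tuning dx q eps d_gt0); split; first exact: rate_tuning_conditions.
have [C C0 klC] := kl_le_tau d_gt0 dx_gt0 Fdens r_gt0 sigma0_gt0 Ftarget q2 eps0 qm.
exists (C * 2 `^ (dx%:R / (dx%:R + d%:R * rate_exp q eps))).
near=> m; apply: (@le_trans _ _ (C * tau d q eps m)%:E).
  by near: m; exact: klC.
rewrite lee_fin -mulrA ler_wpM2l//; apply: tau_le_rate => //.
by near: m; exists 1%N.
Unshelve. all: by end_near. Qed.
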